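(* Let $\Omega(X,\tau)$ be a solution, for $\tau\ge0$, of $$\Omega_\tau+\tfrac12 X\Omega_X=(-1+\mathcal H(\Omega))\Omega$$ (the dynamic rescaling equation of the gCLM model with $a=0$ and constant scaling factors $c_l\equiv\frac12$, $c_\omega\equiv-1$), with smooth initial datum $\Omega_0=\Omega(\cdot,0)$ (with enough decay, e.g. $\Omega_0\in H^1(\mathbb R)$, that $\mathcal H(\Omega_0)$ is well defined) satisfying: $\Omega_0$ is odd, $\Omega_0'(0)=0$, $\Omega_0(X)<0$ for all $X>0$, $$\limsup_{X\to0}\left|\frac{X\Omega_0'(X)}{\Omega_0(X)}\right|<\infty,$$ and $\mathcal H(\Omega_0)(0)=2$, $\mathcal H(\Omega_0)''(0)=4$. Then $\mathcal H(\Omega)(0,\tau)\equiv2$ and $\partial_X^2\mathcal H(\Omega)(0,\tau)\equiv4$ for all $\tau\ge0$, and, with $\bar\Omega(X)=-\pi(\delta(X-1)-\delta(X+1))$ and $\mathcal H(\bar\Omega)(X)=\frac{2}{1-X^2}$: (i) for every $X\ne\pm1$, $\lim_{\tau\to\infty}\Omega(X,\tau)=0$ and $\lim_{\tau\to\infty}\mathcal H(\Omega)(X,\tau)=\frac{2}{1-X^2}$; (ii) for every $\phi\in C_c^\infty(\mathbb R)$, $\lim_{\tau\to\infty}\int_{\mathbb R}\Omega(X,\tau)\phi(X)\,dX=-\pi(\phi(1)-\phi(-1))$.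
   Context: $\mathcal H$ denotes the Hilbert transform on $\mathbb R$: $\mathcal H(f)(x)=\frac1\pi\,\mathrm{P.V.}\int_{\mathbb R}\frac{f(y)}{x-y}\,dy$; here it is applied in the $X$ variable at each fixed $\tau$. $\delta$ is the Dirac delta. *)

(* Defs.v *)
From HB Require Import structures.
From mathcomp Require Import all_boot all_order all_algebra.
From mathcomp Require Import all_classical all_reals all_analysis.
Set Implicit Arguments. Unset Strict Implicit. Unset Printing Implicit Defensive.
Import Order.TTheory GRing.Theory Num.Theory.
Import numFieldNormedType.Exports.
Local Open Scope classical_set_scope.
Local Open Scope ring_scope.

Section Defs.
Variable R : realType.
Notation mu := (@lebesgue_measure R).

Definition smooth (f : R -> R) : Prop :=
  forall (n : nat) (x : R), derivable (derive1n n f) x 1.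

Definition L2 (f : R -> R) : Prop :=
  measurable_fun setT f /\
  mu.-integrable setT (fun x => ((f x) ^+ 2)%:E).

(* f in H^1(R) (for a differentiable f: f, f' in L^2) *)
Definition H1 (f : R -> R) : Prop := L2 f /\ L2 (derive1 f).

Definition hilbert (f : R -> R) (x : R) : R :=
  pi^-1 * lim ((fun eps : R =>
      Rintegral mu [set y | eps < `|x - y|] (fun y => f y / (x - y))) @ 0^'+).

Definition has_second_deriv (f : R -> R) (x v : R) : Prop :=
  (\forall y \near x, derivable f y 1) /\ is_derive x 1 (derive1 f) v.

Definition gCLM_solution (Om : R -> R -> R) (Om0 : R -> R) : Prop :=
  (forall X, Om X 0 = Om0 X) /\
  (forall tau, 0 <= tau -> smooth (fun X => Om X tau) /\ H1 (fun X => Om X tau)) /\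
  {within [set p : R * R | 0 <= p.2], continuous (fun p : R * R => Om p.1 p.2)} /\
  (forall X, {within `[0, +oo[, continuous (Om X)}) /\
  (forall X tau, 0 < tau ->
     derivable (Om X) tau 1 /\
     derive1 (Om X) tau + 2^-1 * X * derive1 (fun Y => Om Y tau) X
       = (-1 + hilbert (fun Y => Om Y tau) X) * Om X tau).

End Defs.

(* Main.v *)
Require Import Defs.
From HB Require Import structures.
From mathcomp Require Import all_boot all_order all_algebra.
From mathcomp Require Import ring lra.
From mathcomp Require Import all_classical all_reals all_analysis.
From mathcomp Require Import measurable_realfun lebesgue_integral_under.
Set Implicit Arguments. Unset Strict Implicit. Unset Printing Implicit Defensive.
Import Order.TTheory GRing.Theory Num.Theory.
Import numFieldNormedType.Exports.
Local Open Scope classical_set_scope.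
Local Open Scope ring_scope.

(** In the variables [w(x,t) = e^t Om(e^(t/2) x, t)] the equation reads [w_t = e^(-t) H(w) w], and the Cauchy
    integral [F = A + iB] of [w], with boundary values [H(w) - i w], satisfies [F_t = e^(-t) F^2 / 2]. Hence
    [F(t) (2 - s F(0)) = 2 F(0)] with [s = 1 - e^(-t)], and everything is read off this Moebius formula.

    The solution is only assumed continuous in [(X,t)] and of class H^1 in [X] for each [t], without uniformity
    in [t]. Times of uniform regularity are handled directly: the equation is integrated along characteristics
    by a maximum principle, and the ODE for [F] follows by differentiating under the integral. The regularity
    classes are closed in time and cover all times, so by Baire's argument the singular times, if any, would
    contain a relatively open portion of uniform regularity; the Moebius formula, extended to the endpoints of
    the complementary intervals, then controls these intervals too, a contradiction.

    At [0] the initial datum has [F(z) = 2 + 2 z^2 + o(z^2)], which gives the values at the origin and the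
    pointwise limits. For the weak limit, [- Om / (pi y) dy] is a positive even measure of mass [2], and the
    expansion of [F] on the imaginary axis shows that it concentrates at [1] and [-1]. *)

(** The equation closes because the Cauchy integral of [f * hilbert f] is [F^2 / 2], which gives a
    Riccati equation at each point of the upper half-plane. The obstacle is to differentiate [F] in
    time: pointwise continuity of [w] controls neither its L^2 norm nor [hilbert (w ^~ t)], which is
    the growth rate of [w]. The bounds defining a regularity class are therefore imposed at positive
    heights, where they survive weak L^2 limits; the rate [sqrt e], natural for H^1 functions,
    carries them down to the real line. Once known, the Moebius formula supplies its own bounds:
    [|2 - s F| >= 1] wherever the real part of [s F] is at most [1] in size. Seen from a fixed time
    this holds far from the origin, and joint continuity bounds [w] elsewhere; over a short gap it
    holds everywhere, so that crossing a gap costs only a fixed factor. For large times, inserting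
    [z = exp(-t/2) X] in the expansion at [0] makes [2 - s F] comparable to [2 exp(-t) (1 - X^2)],
    which is why the limit is singular exactly at [1] and [-1]. *)

Notation "'RI' f" := (Rintegral lebesgue_measure setT f) (at level 10, f at level 9).
Notation "'itg' f" := (lebesgue_measure.-integrable setT (EFin \o f)) (at level 10, f at level 9).

(** * Integration toolbox *)

Section RealIntegral.
Variable R : realType.
Notation mu := (@lebesgue_measure R).
Implicit Types f g : R -> R.

Lemma itg_measurable f : itg f -> measurable_fun setT f.
Proof. by move=> /integrableP[/measurable_EFinP]. Qed.

Lemma itg_le f g : measurable_fun setT f -> (forall x, `|f x| <= g x) -> itg g -> itg f.
Proof.
move=> mf fg ig; apply: (le_integrable measurableT _ _ ig).
  exact/measurable_EFinP.
move=> x _ /=; rewrite lee_fin; exact: (le_trans (fg x) (ler_norm _)).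
Qed.

Lemma itgD f g : itg f -> itg g -> itg (fun x => f x + g x).
Proof. by move=> hf hg; exact: (integrableD measurableT hf hg). Qed.

Lemma itgB f g : itg f -> itg g -> itg (fun x => f x - g x).
Proof. by move=> hf hg; exact: (integrableB measurableT hf hg). Qed.

Lemma itgZ (c : R) f : itg f -> itg (fun x => c * f x).
Proof. by move=> hf; exact: (integrableZl measurableT c hf). Qed.

Lemma itg_norm f : itg f -> itg (fun x => `|f x|).
Proof. exact: integrable_norm. Qed.

Lemma RI_D f g : itg f -> itg g -> RI (fun x => f x + g x) = RI f + RI g.
Proof. by move=> hf hg; rewrite RintegralD. Qed.

Lemma RI_B f g : itg f -> itg g -> RI (fun x => f x - g x) = RI f - RI g.
Proof. by move=> hf hg; rewrite RintegralB. Qed.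

Lemma RI_Z c f : itg f -> RI (fun x => c * f x) = c * RI f.
Proof. by move=> hf; rewrite RintegralZl. Qed.

Lemma RI_N f : itg f -> RI (fun x => - f x) = - RI f.
Proof.
by move=> hf; rewrite -mulN1r -RI_Z//; apply: eq_Rintegral => x _; rewrite mulN1r.
Qed.

Lemma RI_le f g : itg f -> itg g -> (forall x, f x <= g x) -> RI f <= RI g.
Proof. by move=> hf hg fg; apply: le_Rintegral. Qed.

Lemma RI_ge0 f : (forall x, 0 <= f x) -> 0 <= RI f.
Proof. by move=> f0; apply: Rintegral_ge0. Qed.

Lemma RI_norm f g : measurable_fun setT f -> itg g -> (forall x, `|f x| <= g x) ->
  `|RI f| <= RI g.
Proof.
move=> mf ig fg; have hf := itg_le mf fg ig.
apply: (le_trans (le_normr_Rintegral measurableT hf)).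
by apply: RI_le => //; exact: itg_norm.
Qed.

Lemma EFin_RI f : itg f -> (RI f)%:E = (\int[mu]_x (f x)%:E)%E.
Proof. by move=> hf; rewrite /Rintegral fineK//; exact: integrable_fin_num. Qed.

Lemma itg_dominated (F : nat -> R -> R) f g :
  (forall n, measurable_fun setT (F n)) ->
  (forall x, F ^~ x @ \oo --> f x) -> itg g ->
  (forall n x, `|F n x| <= g x) ->
  itg f /\ (fun n => RI (F n)) @ \oo --> RI f.
Proof.
move=> mF cF ig Fg.
have mf : measurable_fun setT f.
  apply: (measurable_fun_cvg (h := F)) => // x _; exact: cF.
have fg x : `|f x| <= g x.
  have : `|F n x| @[n --> \oo] --> `|f x| by apply: cvg_norm; exact: cF.
  move=> /(@cvg_lim _) <- //; apply: limr_le => //.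
    by apply/cvg_ex; exists `|f x|; apply: cvg_norm; exact: cF.
  by apply: nearW => n; exact: Fg.
have hf := itg_le mf fg ig.
split => //.
have mE n : measurable_fun setT (fun x => (F n x)%:E) by apply/measurable_EFinP.
have mfE : measurable_fun setT (fun x => (f x)%:E) by apply/measurable_EFinP.
have cE : {ae mu, forall x, setT x -> (fun n => (F n x)%:E) @ \oo --> (f x)%:E}.
  by apply: aeW => x _; apply: cvg_EFin; [exact: nearW|exact: cF].
have gE : {ae mu, forall x n, setT x -> (`|(F n x)%:E| <= (EFin \o g) x)%E}.
  by apply: aeW => x n _ /=; rewrite lee_fin.
have [_ _] := @dominated_convergence _ (measurableTypeR R) R mu setT measurableT
  (fun n x => (F n x)%:E) (EFin \o f) (EFin \o g) mE mfE cE ig gE.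
rewrite /= -EFin_RI// => /fine_cvg/=; exact.
Qed.

Let affine (a b : R) : measurableTypeR R -> measurableTypeR R := fun s => a * s + b.

Let maffine a b : measurable_fun setT (affine a b).
Proof. by apply: measurable_funD => //; apply: measurable_funM. Qed.

(** Lebesgue measure is determined by its values on half-open intervals, so the rescaled pushforward
    only has to be compared with it there. For [a < 0] the preimage is half-open on the other side,
    with the same length. *)
Lemma lebesgue_affine (a b : R) (a0 : a != 0) A : measurable A ->
  mu A = (`|a|%:E * mu ((affine a b) @^-1` A))%E.
Proof.
have ga : 0 < `|a| by rewrite normr_gt0.
pose m'_ : {measure set (measurableTypeR R) -> \bar R} :=
  mscale (NngNum (normr_ge0 a)) (pushforward mu (affine a b)).
pose m' := m'_ (maffine a b).
suff H : forall X, ocitv X -> mu X = m' X.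
  by move=> mA; rewrite (lebesgue_measure_unique H).
move=> X [[u v] _ <-] /=.
rewrite /m' /mscale /= /pushforward.
have [a1|a1] := ltP 0 a.
  have -> : affine a b @^-1` `]u, v]%classic = `]((u - b) / a), ((v - b) / a)]%classic.
    apply/seteqP; split => x /=; rewrite /affine !in_itv /= ltr_pdivrMr// ler_pdivlMr// (mulrC x); lra.
  rewrite !lebesgue_measure_itv /= !lte_fin ltr_pM2r ?invr_gt0// ltrD2r.
  case: ifP => _; last by rewrite mule0.
  rewrite -EFinM -EFinD; congr EFin; rewrite gtr0_norm//; field; exact: a0.
have a2 : a < 0 by rewrite lt_neqAle a0.
have -> : affine a b @^-1` `]u, v]%classic = `[((v - b) / a), ((u - b) / a)[%classic.
  apply/seteqP; split => x /=; rewrite /affine !in_itv /= ltr_ndivlMr// ler_ndivrMr// (mulrC x); lra.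
rewrite !lebesgue_measure_itv /= !lte_fin ltr_nM2r ?invr_lt0// ltrD2r.
case: ifP => _; last by rewrite mule0.
rewrite -EFinM -EFinD; congr EFin; rewrite ltr0_norm//; field; exact: a0.
Qed.

Lemma ge0_integral_affine (a b : R) (f : measurableTypeR R -> \bar R) : a != 0 ->
  measurable_fun setT f -> (forall x, 0 <= f x)%E ->
  (\int[mu]_x f x = `|a|%:E * \int[mu]_x f (affine a b x))%E.
Proof.
move=> a0 mf f0.
pose m'_ : {measure set (measurableTypeR R) -> \bar R} :=
  mscale (NngNum (normr_ge0 a)) (pushforward mu (affine a b)).
pose m' := m'_ (maffine a b).
transitivity (\int[m']_x f x)%E.
  apply: eq_measure_integral => A mA _.
  first [exact: (lebesgue_affine b a0 mA) | exact: (esym (lebesgue_affine b a0 mA))].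
rewrite /m' ge0_integral_mscale//= ge0_integral_pushforward//; exact: maffine.
Qed.

Lemma itg_affine (a b : R) f : a != 0 -> itg f -> itg (fun s => f (a * s + b)).
Proof.
move=> a0 hf; have mf := itg_measurable hf.
apply/integrableP; split.
  by apply/measurable_EFinP; exact: (measurableT_comp mf (maffine a b)).
move/integrableP: hf => [_].
rewrite (@ge0_integral_affine a b (fun x => `|(EFin \o f) x|%E) a0)//; last first.
  by apply: measurableT_comp => //; apply/measurable_EFinP.
rewrite /affine /=.
have na : 0 < `|a| by rewrite normr_gt0.
move=> h; rewrite ltey; apply/eqP => e; move: h; rewrite e gt0_muley ?lte_fin//.
Qed.

(** The sign of [a] is free, so that one change of variables serves both the scalings and the
    reflections behind all parity arguments. *)
Lemma RI_affine (a b : R) f : a != 0 -> itg f ->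
  RI f = `|a| * RI (fun s => f (a * s + b)).
Proof.
move=> a0 hf; apply: EFin_inj; rewrite EFinM !EFin_RI//; last exact: itg_affine.
have mf := itg_measurable hf.
have mE : measurable_fun setT (EFin \o f) by apply/measurable_EFinP.
have mE' : measurable_fun setT (EFin \o (fun s => f (a * s + b))).
  by apply/measurable_EFinP; exact: (measurableT_comp mf (maffine a b)).
have E1 := integralE mu setT (EFin \o f).
have E2 := integralE mu setT (EFin \o (fun s => f (a * s + b))).
have P1 := @ge0_integral_affine a b _ a0 (measurable_funepos mE) (fun x => funepos_ge0 _ x).
have P2 := @ge0_integral_affine a b _ a0 (measurable_funeneg mE) (fun x => funeneg_ge0 _ x).
have Q1 : (\int[mu]_x (EFin \o f)^\+%E (affine a b x) =
  \int[mu]_x (EFin \o (fun s => f (a * s + b)%R))^\+%E x)%E by apply: eq_integral => x _; rewrite !(funeposE, funenegE).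
have Q2 : (\int[mu]_x (EFin \o f)^\-%E (affine a b x) =
  \int[mu]_x (EFin \o (fun s => f (a * s + b)%R))^\-%E x)%E by apply: eq_integral => x _; rewrite !(funeposE, funenegE).
rewrite [LHS]E1 P1 P2 Q1 Q2 -muleBr//; first by congr (_ * _)%E; exact: (esym E2).
have hg := itg_affine b a0 hf.
by apply: fin_num_adde_defr; exact: (@integrable_pos_fin_num _ (measurableTypeR R) R mu setT measurableT _ hg).
Qed.

End RealIntegral.

(** * Fatou's lemma and weak convergence in L^2 *)

Section Fatou.
Variable R : realType.
Notation mu := (@lebesgue_measure R).
Implicit Types f g q : R -> R.

Lemma RI_fatou (F : nat -> R -> R) f (C : R) :
  (forall n, itg (F n)) -> (forall n x, 0 <= F n x) ->
  (forall x, F ^~ x @ \oo --> f x) ->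
  (forall n, RI (F n) <= C) -> itg f /\ RI f <= C.
Proof.
move=> iF F0 cF FC.
have mF n := itg_measurable (iF n).
have mf : measurable_fun setT f.
  apply: (measurable_fun_cvg (h := F)) => // x _; exact: cF.
have f0 x : 0 <= f x.
  have <- : limn (F ^~ x) = f x by apply/cvg_lim => //; exact: cF.
  apply: limr_ge; first by apply/cvg_ex; exists (f x); exact: cF.
  by apply: nearW => n; exact: F0.
have key : (\int[mu]_x (f x)%:E <= C%:E)%E.
  have := @fatou _ (measurableTypeR R) R mu setT measurableT (fun n x => (F n x)%:E)
    (fun n => (measurable_EFinP _ _).2 (mF n)) (fun n x _ => F0 n x).
  rewrite [X in (X <= _)%E -> _](_ : _ = \int[mu]_x (f x)%:E)%E; last first.
    apply: eq_integral => x _; apply: (cvg_limn_einf_sup _).1.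
    by apply: cvg_EFin; [exact: nearW|exact: cF].
  move=> /le_trans; apply.
  rewrite limn_einf_lim; apply: lime_le; first exact: is_cvg_einfs.
  apply: nearW => n; apply: (@le_trans _ _ (\int[mu]_x (F n x)%:E)%E).
    by apply: ereal_inf_lbound; exists n => /=.
  by rewrite -EFin_RI// lee_fin.
have hf : itg f.
  apply/integrableP; split; first exact/measurable_EFinP.
  apply: (le_lt_trans _ (ltry C)); apply: le_trans key.
  by apply: ge0_le_integral => //= [||x _]; rewrite ?lee_fin ?ger0_norm//; exact/measurable_EFinP/measurableT_comp.
by split => //; rewrite -lee_fin EFin_RI.
Qed.

Lemma RI_fatou_near (F : nat -> R -> R) f (e : R) : 0 < e ->
  (forall n, itg (F n)) -> (forall n x, 0 <= F n x) ->
  (forall x, F ^~ x @ \oo --> f x) -> itg f ->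
  \forall n \near \oo, RI f - e <= RI (F n).
Proof.
move=> e0 iF F0 cF hf.
have mF n := itg_measurable (iF n).
apply: contrapT => nH.
have {}nH : forall N, exists2 n, (N <= n)%N & RI (F n) <= RI f - e.
  move=> N; apply: contrapT => h; apply: nH; exists N => // n /= Nn.
  by case: (leP (RI f - e) (RI (F n))) => // /ltW hh; case: h; exists n.
have := @fatou _ (measurableTypeR R) R mu setT measurableT (fun n x => (F n x)%:E)
    (fun n => (measurable_EFinP _ _).2 (mF n)) (fun n x _ => F0 n x).
rewrite [X in (X <= _)%E -> _](_ : _ = \int[mu]_x (f x)%:E)%E; last first.
    apply: eq_integral => x _; apply: (cvg_limn_einf_sup _).1.
    by apply: cvg_EFin; [exact: nearW|exact: cF].
suff h : (limn_einf (fun n => \int[mu]_x (F n x)%:E) <= (RI f - e)%:E)%E.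
  move=> /le_trans /(_ h); by rewrite -EFin_RI// lee_fin leNgt ltrBlDr ltrDl e0.
rewrite limn_einf_lim; apply: lime_le; first exact: is_cvg_einfs.
apply: nearW => n; have [m nm hm] := nH n.
apply: (@le_trans _ _ (\int[mu]_x (F m x)%:E)%E).
  by apply: ereal_inf_lbound; exists m.
by rewrite -EFin_RI// lee_fin.
Qed.

Lemma itg_mul f g : measurable_fun setT f -> measurable_fun setT g ->
  itg (fun x => f x ^+ 2) -> itg (fun x => g x ^+ 2) -> itg (fun x => f x * g x).
Proof.
move=> mf mg hf hg.
apply: (@itg_le _ _ (fun x => f x ^+ 2 + g x ^+ 2)); last exact: itgD.
  exact: measurable_funM.
move=> x; rewrite normrM -(real_normK (num_real (f x))) -(real_normK (num_real (g x))).
have := normr_ge0 (f x); have := normr_ge0 (g x).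
set a := `|f x|; set b := `|g x| => b0 a0.
have := sqr_ge0 (a - b); nra.
Qed.

(** Young's inequality with a free weight [l] stands in for Cauchy-Schwarz; each use chooses its own
    weight. *)
Lemma RI_amgm f g (l : R) : 0 < l -> measurable_fun setT f -> measurable_fun setT g ->
  itg (fun x => f x ^+ 2) -> itg (fun x => g x ^+ 2) ->
  RI (fun x => `|f x * g x|) <= l / 2 * RI (fun x => f x ^+ 2) + (2 * l)^-1 * RI (fun x => g x ^+ 2).
Proof.
move=> l0 mf mg hf hg.
have h1 := itg_norm (itg_mul mf mg hf hg).
have h2 := itgZ (l / 2) hf; have h3 := itgZ (2 * l)^-1 hg.
rewrite -!RI_Z// -RI_D//; apply: RI_le => //; first exact: itgD.
move=> x; rewrite normrM -(real_normK (num_real (f x))) -(real_normK (num_real (g x))).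
set a := `|f x|; set b := `|g x|.
rewrite -subr_ge0 (_ : _ - _ = (2 * l)^-1 * (l * a - b) ^+ 2).
  by rewrite mulr_ge0 ?sqr_ge0// invr_ge0; lra.
field; lra.
Qed.

(** Fatou applied to the squares [(l w + q)^2] and [(l w - q)^2] bounds the limit of the cross term
    from both sides. The term in [q^2] cancels, and the term in [w^2] is made negligible by a small
    [l]. No dominating function is required, only a bound in L^2. *)
Lemma RI_weak_cvg (w : nat -> R -> R) f q (C : R) :
  (forall n, measurable_fun setT (w n)) -> measurable_fun setT q ->
  (forall n, itg (fun x => w n x ^+ 2)) ->
  (forall n, RI (fun x => w n x ^+ 2) <= C) ->
  itg (fun x => q x ^+ 2) ->
  (forall x, w ^~ x @ \oo --> f x) ->
  (fun n => RI (fun x => w n x * q x)) @ \oo --> RI (fun x => f x * q x).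
Proof.
move=> mw mq iw wC iq cw.
have mf : measurable_fun setT f.
  apply: (measurable_fun_cvg (h := w)) => // x _; exact: cw.
have cw2 x : (fun n => w n x ^+ 2) @ \oo --> f x ^+ 2.
  by apply: cvgM; exact: cw.
have [hf fC] := RI_fatou iw (fun n x => sqr_ge0 _) cw2 wC.
have C0 : 0 <= C by apply: le_trans fC; apply: RI_ge0 => x; exact: sqr_ge0.
apply/cvgrPdist_le => e e0.
(* The weight is chosen so that [l * C <= e]: the squares of [w n] then contribute at most [e / 2],
   whatever [n]. *)
pose l := e / (C + 1).
have l0 : 0 < l by rewrite divr_gt0//; lra.
have lC : l * C <= e.
  by rewrite /l mulrAC ler_pdivrMr ?ler_pM2l//; lra.
have half (s : R) : s ^+ 2 = 1 -> \forall n \near \oo,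
    s * (RI (fun x => w n x * q x) - RI (fun x => f x * q x)) >= - e.
  move=> s1.
  (* This is [(2 l)^-1 (l u + s q)^2] expanded, with [s] equal to [1] or [-1]. *)
  pose G u (x : R) := l / 2 * u ^+ 2 + (2 * l)^-1 * q x ^+ 2 + s * (u * q x).
  have iG (u : R -> R) : measurable_fun setT u -> itg (fun x => u x ^+ 2) ->
      itg (fun x => G (u x) x) /\ RI (fun x => G (u x) x) =
      l / 2 * RI (fun x => u x ^+ 2) + (2 * l)^-1 * RI (fun x => q x ^+ 2) + s * RI (fun x => u x * q x).
    move=> mu' iu.
    have h1 := itgZ (l / 2) iu; have h2 := itgZ (2 * l)^-1 iq.
    have h3 := itg_mul mu' mq iu iq; have h4 := itgZ s h3.
    split; first by apply: itgD => //; exact: itgD.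
    rewrite /G RI_D//; last exact: itgD.
    by rewrite RI_D// !RI_Z.
  have G0 n x : 0 <= G (w n x) x.
    rewrite /G (_ : _ + _ = (2 * l)^-1 * (l * w n x + s * q x) ^+ 2).
      by rewrite mulr_ge0 ?sqr_ge0// invr_ge0; lra.
    have -> : (2 * l)^-1 * q x ^+ 2 = (2 * l)^-1 * (s ^+ 2 * q x ^+ 2) by rewrite s1 mul1r.
    by field; lra.
  have e20 : 0 < e / 2 by lra.
  have cG x : (fun n => G (w n x) x) @ \oo --> G (f x) x.
    rewrite /G; apply: cvgD; first apply: cvgD; first by apply: cvgM; [exact: cvg_cst|exact: cw2].
      exact: cvg_cst.
    by apply: cvgM; [exact: cvg_cst|apply: cvgM; [exact: cw|exact: cvg_cst]].
  have [iGf GfE] := iG f mf hf.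
  have := RI_fatou_near (F := fun n x => G (w n x) x) e20 (fun n => (iG _ (mw n) (iw n)).1) G0 cG iGf.
  apply: filterS => n; rewrite (iG _ (mw n) (iw n)).2 GfE => h.
  have w0 : 0 <= RI (fun x => f x ^+ 2) by apply: RI_ge0 => x; exact: sqr_ge0.
  have l2 : l / 2 * RI (fun x => w n x ^+ 2) <= e / 2.
    by apply: (@le_trans _ _ (l / 2 * C)); [rewrite ler_pM2l ?wC//; lra|lra].
  have l3 : 0 <= l / 2 * RI (fun x => f x ^+ 2) by apply: mulr_ge0 => //; lra.
  lra.
have h1 := half 1 (expr1n _ _).
have h2 := half (-1) (etrans (sqrrN 1) (expr1n _ _)).
near=> n.
have a1 : 1 * (RI (fun x => w n x * q x) - RI (fun x => f x * q x)) >= - e by near: n.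
have a2 : -1 * (RI (fun x => w n x * q x) - RI (fun x => f x * q x)) >= - e by near: n.
by rewrite ler_norml; lra.
Unshelve. all: by end_near. Qed.

End Fatou.

(** * Poisson kernels and their majorants *)

Section Kernels.
Variable R : realType.
Notation mu := (@lebesgue_measure R).

(** The inverse is the pointwise limit of the continuous functions [x / (x^2 + 1/(n+1))], at [0] as
    well since [0^-1 = 0]. *)
Lemma measurable_inv : measurable_fun setT (fun x : R => x^-1).
Proof.
have pos (x : R) n : 0 < x ^+ 2 + n.+1%:R^-1 by rewrite ltr_wpDl ?sqr_ge0// invr_gt0.
apply: (@measurable_fun_cvg _ (measurableTypeR R) R setT
  (fun n x => x / (x ^+ 2 + n.+1%:R^-1)) (fun x => x^-1)).
  move=> n; apply: continuous_measurable_fun => x; apply: cvgM; first exact: cvg_id.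
  apply: cvgV; first by rewrite gt_eqF.
  by apply: cvgD; [apply: cvgM; exact: cvg_id|exact: cvg_cst].
move=> x _; have [->|x0] := eqVneq x 0.
  rewrite (_ : (fun n => _) = fun=> 0); first by rewrite invr0; exact: cvg_cst.
  by apply/funext => n; rewrite mul0r.
rewrite [X in _ --> X](_ : _ = x / (x ^+ 2 + 0)); last by field.
apply: cvgM; first exact: cvg_cst.
apply: cvgV; first by rewrite addr0 expf_neq0.
by apply: cvgD; [exact: cvg_cst|exact: cvg_harmonic].
Qed.

Lemma measurable_funV (f : R -> R) : measurable_fun setT f -> measurable_fun setT (fun x => (f x)^-1).
Proof. by move=> mf; exact: (measurableT_comp measurable_inv mf). Qed.

Lemma measurable_patch (f : R -> R) (D : set (measurableTypeR R)) : measurable D ->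
  measurable_fun setT f -> measurable_fun setT (f \_ D).
Proof. by move=> mD mf; exact/(measurable_restrictT _ _).1/measurable_funTS. Qed.

Lemma ler_inv2 (a b c : R) : 0 < a -> 0 < b -> b <= c * a -> a^-1 <= c * b^-1.
Proof. by move=> a0 b0 h; rewrite ler_pdivlMr// mulrC ler_pdivrMr. Qed.

(** The conjugate Poisson kernel and, below, the Poisson kernel: [Qk e s - i Pk e s] equals
    [1 / (pi (s + i e))]. *)
Definition Qk (e s : R) : R := s / (pi * (s ^+ 2 + e ^+ 2)).
Definition Pk (e s : R) : R := e / (pi * (s ^+ 2 + e ^+ 2)).

(** A common majorant for [sqrt |s|] times the error made when [1 / s] is regularised at scale [e].
    It is homogeneous of degree [-1/2] in [(e, s)] and integrable both at [0] and at infinity. *)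
Definition vk (e s : R) : R := (Num.sqrt `|s|)^-1 * ((e ^+ 2 + `|s| * e) / (s ^+ 2 + e ^+ 2)).

Lemma ge0_itg (f : R -> R) : measurable_fun setT f -> (forall x, 0 <= f x) ->
  (\int[mu]_x (f x)%:E < +oo)%E -> itg f.
Proof.
move=> mf f0 fi; apply/integrableP; split; first exact/measurable_EFinP.
rewrite (_ : (\int[mu]_x _ = \int[mu]_x (f x)%:E)%E)//.
by apply: eq_integral => x _ /=; rewrite ger0_norm.
Qed.

Lemma ge0_itg_even (g : R -> R) : measurable_fun setT g -> (forall x, 0 <= g x) ->
  (forall x, g (- x) = g x) -> (\int[mu]_(x in [set` `[0%R, +oo[]) (g x)%:E < +oo)%E -> itg g.
Proof.
move=> mg g0 ev hg.
have m0 : measurable [set` `[0%R, +oo[ : interval R] by exact: measurable_itv.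
pose h := g \_ [set` `[0%R, +oo[ : interval R].
have mh : measurable_fun setT h by exact: measurable_patch.
have h0 x : 0 <= h x by rewrite /h patchE; case: ifP.
have ih : itg h.
  apply/integrableP; split; first exact/measurable_EFinP.
  rewrite (_ : (\int[mu]_x _ = \int[mu]_(x in [set` `[0%R, +oo[]) (g x)%:E)%E)//.
  rewrite [RHS]integral_mkcond; apply: eq_integral => x _ /=.
  by rewrite ger0_norm// /h !patchE; case: ifP.
apply: (@itg_le _ _ (fun x => h x + h (- 1 * x + 0))) => //; last first.
  by apply: itgD => //; apply: itg_affine => //; rewrite oppr_eq0 oner_eq0.
move=> x; rewrite ger0_norm// addr0 mulN1r.
have [x0|x0] := leP 0 x.
  have -> : h x = g x by rewrite /h patchE mem_set//= in_itv/= andbT.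
  by rewrite lerDl.
have -> : h (- x) = g x by rewrite /h patchE mem_set ?ev//= in_itv/= andbT oppr_ge0 ltW.
by rewrite lerDr.
Qed.

Lemma itg_cauchy (e : R) : 0 < e -> itg (fun s => (s ^+ 2 + e ^+ 2)^-1).
Proof.
move=> e0.
have pos s : 0 < s ^+ 2 + e ^+ 2 by rewrite ltr_wpDl ?sqr_ge0// exprn_gt0.
have pos1 (s : R) : 0 < 1 + s ^+ 2 by rewrite ltr_pwDl ?sqr_ge0.
have mc (a : R) : measurable_fun setT (fun s : R => (s ^+ 2 + a)).
  by apply: measurable_funD => //; exact: measurable_funX.
have i1 : itg (fun s : R => (1 + s ^+ 2)^-1).
  apply: ge0_itg_even.
  - by apply: continuous_measurable_fun; exact: continuous_oneDsqrV.
  - by move=> x; rewrite invr_ge0 ltW.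
  - by move=> x; rewrite sqrrN.
  - by have := @integral0y_oneDsqr R; rewrite /oneDsqr => ->; rewrite ltry.
apply: (@itg_le _ _ (fun s => (1 + (e ^+ 2)^-1) * (1 + s ^+ 2)^-1)); last exact: itgZ.
  apply: continuous_measurable_fun => s; apply: cvgV; first by rewrite gt_eqF.
  by apply: cvgD; [apply: cvgM; exact: cvg_id|exact: cvg_cst].
move=> s /=; rewrite ger0_norm; last by rewrite invr_ge0 ltW.
apply: ler_inv2 => //.
rewrite mulrDl mul1r mulrDr mulVf ?gt_eqF ?exprn_gt0//.
have : 0 <= (e ^+ 2)^-1 * s ^+ 2 by rewrite mulr_ge0 ?invr_ge0 ?sqr_ge0.
have := sqr_ge0 e; lra.
Qed.

(** [2 atan (sqrt s)] is an antiderivative on the positive half-line. It is singular at [0], so the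
    fundamental theorem is used on [[1/(n+1), +oo[], where it gives the bound [pi], and Fatou's
    lemma reaches [0]. *)
Lemma itg_sqrt_kernel : itg (fun s : R => (Num.sqrt `|s|)^-1 * (1 + `|s|)^-1).
Proof.
pose k (s : R) : R := (Num.sqrt `|s|)^-1 * (1 + `|s|)^-1.
have k0 s : 0 <= k s by rewrite mulr_ge0 ?invr_ge0 ?sqrtr_ge0// addr_ge0.
have ck (s : R) : 0 < s -> {for s, continuous k}.
  move=> s0; apply: cvgM; apply: cvgV.
  - by rewrite gt_eqF// sqrtr_gt0 normr_gt0 gt_eqF.
  - by apply: continuous_comp; [exact: norm_continuous|exact: sqrt_continuous].
  - by rewrite gt_eqF// ltr_pwDl.
  - by apply: cvgD; [exact: cvg_cst|exact: norm_continuous].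
have mk0 : measurable_fun [set` `]0, +oo[ : interval R] k.
  apply: open_continuous_measurable_fun; first exact: interval_open.
  by move=> s; rewrite inE/= in_itv/= andbT => s0; exact: ck.
pose F (s : R) : R := 2 * atan (Num.sqrt s).
have FT (e : R) : 0 < e -> (\int[mu]_(x in [set` `[e, +oo[]) (k x)%:E <= pi%:E)%E.
  move=> e0.
  have dF (x : R) : 0 < x -> is_derive x 1 F (k x).
    move=> x0; have s0 : 0 < Num.sqrt x by rewrite sqrtr_gt0.
    have := is_derive1_sqrt x0 => ds.
    have := @is_derive1_comp _ (@atan R) Num.sqrt x _ _ (is_derive1_atan _) ds.
    move=> /(@is_deriveZ _ _ _ _ 2) h.
    apply: (is_derive_eq h); rewrite /k gtr0_norm// sqr_sqrtr ?ltW//.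
    rewrite /GRing.scale /=; field; rewrite !gt_eqF//; first by rewrite addr_gt0.
  have -> : (\int[mu]_(x in [set` `[e, +oo[]) (k x)%:E = pi%:E - (F e)%:E)%E.
    apply: ge0_continuous_FTC2y => //.
    - apply/continuous_within_itvcyP; split.
        by move=> x; rewrite in_itv/= andbT => ex; apply: ck; exact: lt_trans ex.
      by apply: cvg_at_right_filter; exact: ck.
    - rewrite /F [X in _ --> X](_ : _ = 2 * (pi / 2)); last by field.
      apply: cvgM; first exact: cvg_cst.
      have h : Num.sqrt x @[x --> +oo%R] --> (+oo : set_system R).
        apply/cvgryPge => A.
        have := @nbhs_pinfty_ge R (A ^+ 2) (num_real _); apply: filterS => x Ax.
        by apply: (le_trans (ler_norm A)); rewrite -sqrtr_sqr ler_wsqrtr.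
      exact: (cvg_comp _ _ h (@cvgy_atan R)).
    - by move=> x ex; have [] := dF x (lt_trans e0 ex).
    - apply: cvg_at_right_filter; apply: differentiable_continuous.
      by apply/derivable1_diffP; have [] := dF e e0.
    - by move=> x; rewrite in_itv/= andbT => ex; rewrite derive1E; have [_ ->] := dF x (lt_trans e0 ex).
  by rewrite -EFinB lee_fin gerBl mulr_ge0// -atan0 le_atan// sqrtr_ge0.
have mk : measurable_fun setT k.
  apply: measurable_funM; apply: measurable_funV.
    apply: continuous_measurable_fun => s.
    by apply: continuous_comp; [exact: norm_continuous|exact: sqrt_continuous].
  apply: continuous_measurable_fun => s.
  by apply: cvgD; [exact: cvg_cst|exact: norm_continuous].
apply: ge0_itg_even => //; first by move=> x; rewrite normrN.
pose I (n : nat) := [set` `[n.+1%:R^-1, +oo[ : interval R].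
pose I0 := [set` `]0, +oo[ : interval R].
have mI n : measurable (I n) by exact: measurable_itv.
have mI0 : measurable I0 by exact: measurable_itv.
have ER D : measurable D -> (\int[mu]_x ((k \_ D) x)%:E = \int[mu]_(x in D) (k x)%:E)%E.
  move=> mD; rewrite [RHS]integral_mkcond; apply: eq_integral => x _ /=.
  by rewrite !patchE; case: ifP.
have iI n : itg (k \_ (I n)) /\ RI (k \_ (I n)) <= pi.
  have n0 : 0 < n.+1%:R^-1 :> R by rewrite invr_gt0.
  have hi : itg (k \_ (I n)).
    apply: ge0_itg; [exact: (measurable_patch (mI n) mk)|by move=> x; rewrite patchE; case: ifP|].
    by rewrite ER//; apply: (le_lt_trans (FT _ n0)); rewrite ltry.
  by split => //; rewrite -lee_fin EFin_RI// ER//; exact: FT.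
have [h _] : itg (k \_ I0) /\ RI (k \_ I0) <= pi.
  apply: (RI_fatou (F := fun n => k \_ (I n))) => [n|n x|x|n].
  - exact: (iI n).1.
  - by rewrite patchE; case: ifP.
  - have [x0|x0] := ltP 0 x.
      rewrite patchE mem_set; last by rewrite /I0/= in_itv/= x0.
      apply: cvg_near_cst; near=> n; rewrite patchE mem_set// /I/= in_itv/= andbT.
      by apply: ltW; near: n; exact: near_infty_natSinv_lt (PosNum x0).
    rewrite patchE memNset; last by rewrite /I0/= in_itv/= andbT; apply/negP; rewrite -leNgt.
    rewrite (_ : (fun n => _) = fun=> 0); first exact: cvg_cst.
    apply/funext => n; rewrite patchE memNset// /I/= in_itv/= andbT; apply/negP.
    by rewrite -ltNge (le_lt_trans x0)// invr_gt0.
  - exact: (iI n).2.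
rewrite -ER; last exact: measurable_itv.
(* With [0^-1 = 0] the kernel vanishes at [0], hence the closed and the open half-line give the same
   restriction. *)
have -> : k \_ [set` `[0%R, +oo[] = k \_ I0.
  apply/funext => x; rewrite !patchE.
  have [->|x0] := eqVneq x 0.
    by rewrite [k 0](_ : _ = 0) ?if_same// /k normr0 sqrtr0 invr0 mul0r.
  congr (if _ then _ else _); rewrite /I0; apply/idP/idP; rewrite !inE/= !in_itv/= !andbT.
    by move=> x1; rewrite lt_neqAle eq_sym x0.
  exact: ltW.
by rewrite -EFin_RI// ltry.
Unshelve. all: by end_near. Qed.

End Kernels.

Section Cauchy.
Variable R : realType.
Notation mu := (@lebesgue_measure R).
Implicit Types f : R -> R.

Lemma den_gt0 (e s : R) : 0 < e -> 0 < s ^+ 2 + e ^+ 2.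
Proof. by move=> e0; rewrite ltr_wpDl ?sqr_ge0// exprn_gt0. Qed.

Lemma pi_den_gt0 (e s : R) : 0 < e -> 0 < pi * (s ^+ 2 + e ^+ 2).
Proof. by move=> e0; rewrite mulr_gt0 ?pi_gt0// den_gt0. Qed.

Lemma continuous_den (e : R) : 0 < e -> continuous (fun s : R => (pi * (s ^+ 2 + e ^+ 2))^-1).
Proof.
move=> e0 s; apply: cvgV; first by rewrite gt_eqF ?pi_den_gt0.
apply: cvgM; first exact: cvg_cst.
by apply: cvgD; [apply: cvgM; exact: cvg_id|exact: cvg_cst].
Qed.

Lemma continuous_Qk (e : R) : 0 < e -> continuous (Qk e).
Proof. by move=> e0 s; apply: cvgM; [exact: cvg_id|exact: continuous_den]. Qed.

Lemma continuous_Pk (e : R) : 0 < e -> continuous (Pk e).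
Proof. by move=> e0 s; apply: cvgM; [exact: cvg_cst|exact: continuous_den]. Qed.

Lemma QkN (e s : R) : Qk e (- s) = - Qk e s.
Proof. by rewrite /Qk sqrrN mulNr. Qed.

Lemma PkN (e s : R) : Pk e (- s) = Pk e s.
Proof. by rewrite /Pk sqrrN. Qed.

Lemma pi_ge1 : 1 <= pi :> R.
Proof. by apply: le_trans (pi_ge2 R); rewrite ler1n. Qed.

Lemma sqr_kernel_le (a e s : R) : 0 < e -> a ^+ 2 <= s ^+ 2 + e ^+ 2 ->
  (a / (pi * (s ^+ 2 + e ^+ 2))) ^+ 2 <= (s ^+ 2 + e ^+ 2)^-1.
Proof.
move=> e0 h; have d0 := den_gt0 s e0; have p1 := pi_ge1.
set d := s ^+ 2 + e ^+ 2 in h d0 *.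
rewrite exprMn exprVn ler_pdivrMr; last by rewrite exprn_gt0// mulr_gt0// pi_gt0.
rewrite exprMn expr2 -[d ^+ 2]/(d * d) mulrCA mulKf ?gt_eqF//.
by apply: (le_trans h); apply: ler_peMl; [exact: ltW|exact: exprn_ege1].
Qed.

Lemma Qk_sqr (e s : R) : 0 < e -> Qk e s ^+ 2 <= (s ^+ 2 + e ^+ 2)^-1.
Proof. by move=> e0; apply: sqr_kernel_le => //; rewrite lerDl sqr_ge0. Qed.

Lemma Pk_sqr (e s : R) : 0 < e -> Pk e s ^+ 2 <= (s ^+ 2 + e ^+ 2)^-1.
Proof. by move=> e0; apply: sqr_kernel_le => //; rewrite lerDr sqr_ge0. Qed.

Lemma itg_sqr_le (k : R -> R) (c e : R) : 0 < e -> measurable_fun setT k ->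
  (forall s, k s ^+ 2 <= c * (s ^+ 2 + e ^+ 2)^-1) -> itg (fun s => k s ^+ 2).
Proof.
move=> e0 mk kc; apply: (itg_le _ _ (itgZ c (itg_cauchy e0))).
  exact: measurable_funX.
by move=> x; rewrite ger0_norm ?sqr_ge0// kc.
Qed.

Lemma itg_Qk2 (e : R) : 0 < e -> itg (fun s => Qk e s ^+ 2).
Proof.
move=> e0; apply: (@itg_sqr_le _ 1 e) => //.
  by apply: continuous_measurable_fun; exact: continuous_Qk.
by move=> s; rewrite mul1r Qk_sqr.
Qed.

Lemma itg_Pk2 (e : R) : 0 < e -> itg (fun s => Pk e s ^+ 2).
Proof.
move=> e0; apply: (@itg_sqr_le _ 1 e) => //.
  by apply: continuous_measurable_fun; exact: continuous_Pk.
by move=> s; rewrite mul1r Pk_sqr.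
Qed.

Lemma itg_Pk (e : R) : 0 < e -> itg (Pk e).
Proof.
move=> e0; have := itgZ (e / pi) (itg_cauchy e0); congr integrable; apply/funext => s /=.
by congr EFin; rewrite /Pk invfM mulrA.
Qed.

Lemma RI_Pk (e : R) : 0 < e -> RI (Pk e) = 1.
Proof.
move=> e0; have p0 := pi_gt0 R.
rewrite (RI_affine 0 (lt0r_neq0 e0) (itg_Pk e0)) gtr0_norm// -RI_Z; last first.
  exact: (itg_affine 0 (lt0r_neq0 e0) (itg_Pk e0)).
have i1 := itg_cauchy (@ltr01 R).
transitivity (RI (fun s : R => pi^-1 * (s ^+ 2 + 1 ^+ 2)^-1)).
  apply: eq_Rintegral => s _; rewrite /Pk addr0.
  have -> : (e * s) ^+ 2 + e ^+ 2 = e ^+ 2 * (s ^+ 2 + 1 ^+ 2) by ring.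
  have := den_gt0 s (@ltr01 R); set d := _ + 1 ^+ 2 => h.
  by move: (pi : R) p0 => p p0; field; rewrite !gt_eqF.
rewrite RI_Z//.
suff -> : RI (fun s : R => (s ^+ 2 + 1 ^+ 2)^-1) = pi by rewrite mulVf ?gt_eqF.
apply: EFin_inj; rewrite EFin_RI//.
have c1 : continuous (fun s : R => (s ^+ 2 + 1 ^+ 2)^-1).
  move=> s; apply: cvgV; first by rewrite gt_eqF// den_gt0.
  by apply: cvgD; [apply: cvgM; exact: cvg_id|exact: cvg_cst].
rewrite (ge0_symfun_integralT _ c1).
- rewrite (_ : [set x | 0 <= x] = [set` `[0, +oo[ ]); last first.
    by apply/seteqP; split => x /=; rewrite in_itv/= andbT.
  have := @integral0y_oneDsqr R; rewrite /oneDsqr => h.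
  rewrite (_ : (\int[mu]_(x in _) _ = (pi / 2)%:E)%E).
    by rewrite -EFinM; congr EFin; field.
  by rewrite -h; apply: eq_integral => x _; rewrite expr1n addrC.
- by move=> x; rewrite invr_ge0 ltW// den_gt0.
- by move=> x /=; rewrite sqrrN.
Qed.

Lemma vk_ge0 (e s : R) : 0 < e -> 0 <= vk e s.
Proof.
move=> e0; rewrite mulr_ge0 ?invr_ge0 ?sqrtr_ge0//; apply: divr_ge0; last exact/ltW/den_gt0.
by rewrite addr_ge0 ?sqr_ge0// mulr_ge0// ltW.
Qed.

Lemma measurable_vk (e : R) : measurable_fun setT (vk e).
Proof.
have ma : measurable_fun setT (fun s : R => `|s|).
  by apply: continuous_measurable_fun; exact: norm_continuous.
apply: measurable_funM.
  apply: measurable_funV; apply: continuous_measurable_fun => s.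
  by apply: continuous_comp; [exact: norm_continuous|exact: sqrt_continuous].
apply: measurable_funM.
  by apply: measurable_funD => //; apply: measurable_funM.
apply: measurable_funV; apply: measurable_funD => //; exact: measurable_funX.
Qed.

Lemma itg_vk (e : R) : 0 < e -> itg (vk e).
Proof.
move=> e0; apply: (itg_le (measurable_vk e) _ (itgZ (2 + 2 * e) (@itg_sqrt_kernel R))).
move=> s /=; rewrite ger0_norm ?vk_ge0// /vk [leRHS]mulrCA ler_wpM2l ?invr_ge0 ?sqrtr_ge0//.
have d0 := den_gt0 s e0; have a0 := normr_ge0 s.
rewrite -[s ^+ 2]real_normK ?num_real// in d0 *; set a := `|s| in d0 a0 *.
rewrite ler_pdivrMr// mulrAC ler_pdivlMr ?ltr_pwDl//.
have h1 : 0 <= e * (a - e) ^+ 2 by rewrite mulr_ge0 ?sqr_ge0// ltW.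
have h2 := sqr_ge0 (a - e).
have h3 : 0 <= e * a ^+ 2 by rewrite mulr_ge0 ?sqr_ge0// ltW.
have h4 : 0 <= e * e ^+ 2 by rewrite mulr_ge0 ?sqr_ge0// ltW.
nra.
Qed.

Definition vk_mass : R := RI (vk 1).

Lemma vk_mass_ge0 : 0 <= vk_mass.
Proof. by apply: RI_ge0 => x; exact: vk_ge0. Qed.

(** By homogeneity the mass scales like [sqrt e]. This is the rate at which every regularisation
    below converges. *)
Lemma RI_vk (e : R) : 0 < e -> RI (vk e) = Num.sqrt e * vk_mass.
Proof.
move=> e0; have iv := itg_vk e0; have i1 := itg_vk (@ltr01 R).
rewrite (RI_affine 0 (lt0r_neq0 e0) iv) gtr0_norm// -RI_Z; last first.
  exact: (itg_affine 0 (lt0r_neq0 e0) iv).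
rewrite /vk_mass -RI_Z//; apply: eq_Rintegral => s _.
rewrite /vk addr0 normrM (gtr0_norm e0) sqrtrM ?ltW// invfM.
have q0 : 0 < Num.sqrt e by rewrite sqrtr_gt0.
have qe : e = Num.sqrt e ^+ 2 by rewrite sqr_sqrtr// ltW.
have d0 := den_gt0 s (@ltr01 R).
have -> : (e * s) ^+ 2 + e ^+ 2 = e ^+ 2 * (s ^+ 2 + 1 ^+ 2) by ring.
set d := _ + 1 ^+ 2 in d0 *; set q := Num.sqrt e in q0 qe *; set r := (Num.sqrt `|s|)^-1.
by rewrite qe; field; rewrite !gt_eqF.
Qed.

End Cauchy.

(** * Cauchy integrals and the Hilbert transform of Hoelder functions *)

Section CauchyIntegral.
Variable R : realType.
Notation mu := (@lebesgue_measure R).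
Implicit Types f : R -> R.

Definition holder (H : R) f := [/\ continuous f, itg (fun x => f x ^+ 2) &
  forall x y, `|f x - f y| <= H * Num.sqrt `|x - y| ].

(* [CA f x e + i CB f x e] is the Cauchy integral [pi^-1 \int f(y)/(z - y) dy] at [z = x + i e]. *)
Definition CA f (x e : R) : R := RI (fun s => f (x - s) * Qk e s).
Definition CB f (x e : R) : R := - RI (fun s => f (x - s) * Pk e s).

Lemma itg_shift (g : R -> R) (x : R) : itg g -> itg (fun s => g (x - s)).
Proof.
move=> ig; have := itg_affine x (_ : -1 != 0) ig; rewrite oppr_eq0 oner_eq0 => /(_ isT).
by congr integrable; apply/funext => s /=; rewrite mulN1r addrC.
Qed.

Lemma RI_shift (g : R -> R) (x : R) : itg g -> RI (fun s => g (x - s)) = RI g.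
Proof.
move=> ig; have n1 : -1 != 0 :> R by rewrite oppr_eq0 oner_eq0.
rewrite (RI_affine x n1 ig) normrN1 mul1r.
by apply: eq_Rintegral => s _; rewrite mulN1r addrC.
Qed.

Lemma measurable_shift (g : R -> R) (x : R) : measurable_fun setT g ->
  measurable_fun setT (fun s : R => g (x - s)).
Proof.
move=> mg; have ms : measurable_fun setT (fun s : R => x - s).
  apply: continuous_measurable_fun => s.
  by apply: cvgB; [exact: cvg_cst|exact: cvg_id].
exact: (measurableT_comp mg ms).
Qed.

Lemma itg_conv f (k : R -> R) (x : R) : measurable_fun setT f -> itg (fun x => f x ^+ 2) ->
  measurable_fun setT k -> itg (fun s => k s ^+ 2) -> itg (fun s => f (x - s) * k s).
Proof.
move=> mf f2 mk k2; apply: itg_mul => //; first exact: measurable_shift.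
exact: (itg_shift x f2).
Qed.

Lemma measurable_Qk (e : R) : 0 < e -> measurable_fun setT (Qk e).
Proof. by move=> e0; apply: continuous_measurable_fun; exact: continuous_Qk. Qed.

Lemma measurable_Pk (e : R) : 0 < e -> measurable_fun setT (Pk e).
Proof. by move=> e0; apply: continuous_measurable_fun; exact: continuous_Pk. Qed.

Lemma holder_ge0 H f : holder H f -> 0 <= H.
Proof.
move=> [_ _ /(_ 1 0)]; rewrite subr0 normr1 sqrtr1 mulr1.
exact: le_trans.
Qed.

Lemma holder_measurable H f : holder H f -> measurable_fun setT f.
Proof. by move=> [cf _ _]; exact: continuous_measurable_fun. Qed.

(** Against an odd kernel only the difference [f (x - s) - f (x + s)] counts. The Hoelder modulus
    turns it into a multiple of [sqrt |s|], which compensates the singularity of [D] at [0]. *)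
Lemma odd_kernel_bound H f (D : R -> R) (x e : R) : 0 < e -> holder H f ->
  measurable_fun setT D -> itg (fun s => D s ^+ 2) -> (forall s, D (- s) = - D s) ->
  (forall s, Num.sqrt `|s| * `|D s| <= vk e s) ->
  `|RI (fun s => f (x - s) * D s)| <= H * (Num.sqrt e * vk_mass R).
Proof.
move=> e0 hf mD D2 oD Dv; have H0 := holder_ge0 hf; have mf := holder_measurable hf.
have [cf f2 fH] := hf.
have ig := itg_conv x mf f2 mD D2.
set g := (fun s => f (x - s) * D s) in ig *.
have igN := itg_shift 0 ig; have IN := RI_shift 0 ig.
have : `|RI g + RI g| <= 2 * (H * (Num.sqrt e * vk_mass R)).
  rewrite -{2}IN -RI_D// -(RI_vk e0) -RI_Z ?itg_vk// -RI_Z; last exact/itgZ/itg_vk.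
  apply: RI_norm; [|by apply: itgZ; apply: itgZ; exact: itg_vk|].
    by apply: measurable_funD; [exact: itg_measurable|exact: (itg_measurable igN)].
  move=> s /=; rewrite /g sub0r opprK oD mulrN -mulrBl normrM.
  have h1 := fH (x - s) (x + s).
  have e1 : x - s - (x + s) = - (2 * s) by ring.
  rewrite e1 normrN normrM sqrtrM ?normr_ge0// gtr0_norm// in h1.
  have s2 : Num.sqrt 2 <= 2 :> R.
    by rewrite -[leRHS](@ger0_norm R 2)// -sqrtr_sqr ler_wsqrtr// expr2; lra.
  apply: (@le_trans _ _ (H * (2 * Num.sqrt `|s|) * `|D s|)).
    apply: ler_wpM2r => //; apply: (le_trans h1); apply: ler_wpM2l => //.
    by apply: ler_wpM2r => //; exact: sqrtr_ge0.
  rewrite [leLHS](_ : _ = 2 * (H * (Num.sqrt `|s| * `|D s|))); last by ring.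
  by rewrite ler_pM2l// ler_wpM2l.
have -> : RI g + RI g = 2 * RI g by ring.
by rewrite normrM gtr0_norm// ler_pM2l.
Qed.

Lemma vk_dom (s a e : R) : 0 < e -> (s != 0 -> `|a| <= (e ^+ 2 + `|s| * e) / (`|s| * (s ^+ 2 + e ^+ 2))) ->
  Num.sqrt `|s| * `|a| <= vk e s.
Proof.
move=> e0 h; have [->|s0] := eqVneq s 0.
  by rewrite normr0 sqrtr0 mul0r vk_ge0.
have {h}h := h s0; have a0 : 0 < `|s| by rewrite normr_gt0.
apply: (@le_trans _ _ (Num.sqrt `|s| * ((e ^+ 2 + `|s| * e) / (`|s| * (s ^+ 2 + e ^+ 2))))).
  by apply: ler_wpM2l => //; exact: sqrtr_ge0.
rewrite /vk le_eqVlt; apply/orP; left; apply/eqP.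
have q0 : 0 < Num.sqrt `|s| by rewrite sqrtr_gt0.
have qs : `|s| = Num.sqrt `|s| ^+ 2 by rewrite sqr_sqrtr.
have d0 := den_gt0 s e0; set d := _ + e ^+ 2 in d0 *.
move: qs q0; set q := Num.sqrt `|s| => qs q0; rewrite qs.
by field; rewrite !gt_eqF.
Qed.

(** The difference of two conjugate kernels is odd and at most [e^2 / (|s| (s^2 + e^2))]. The bound
    does not involve the smaller height [e'], hence [CA f x] is Cauchy as the height tends to
    [0]. *)
Lemma CA_diff H f (x e e' : R) : holder H f -> 0 < e' -> e' <= e ->
  `|CA f x e - CA f x e'| <= H * (Num.sqrt e * vk_mass R).
Proof.
move=> hf e'0 ee'; have e0 := lt_le_trans e'0 ee'.
have mf := holder_measurable hf; have [_ f2 _] := hf.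
have i1 := itg_conv x mf f2 (measurable_Qk e0) (itg_Qk2 e0).
have i2 := itg_conv x mf f2 (measurable_Qk e'0) (itg_Qk2 e'0).
rewrite /CA -RI_B//.
rewrite (_ : RI _ = RI (fun s => f (x - s) * (Qk e s - Qk e' s))); last first.
  by apply: eq_Rintegral => s _; rewrite mulrBr.
have mD : measurable_fun setT (fun s => Qk e s - Qk e' s).
  by apply: measurable_funB; exact: measurable_Qk.
apply: odd_kernel_bound => //.
- apply: (itg_le _ _ (itgD (itgZ 2 (itg_Qk2 e0)) (itgZ 2 (itg_Qk2 e'0)))).
    exact: measurable_funX.
  move=> s /=; rewrite ger0_norm ?sqr_ge0//.
  have := sqr_ge0 (Qk e s + Qk e' s); lra.
- by move=> s /=; rewrite !QkN; ring.
- move=> s; apply: vk_dom => // s0.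
  have d0 := den_gt0 s e0; have d0' := den_gt0 s e'0; have p1 := pi_ge1 R.
  have a0 : 0 < `|s| by rewrite normr_gt0.
  have -> : Qk e s - Qk e' s = - (s * ((e ^+ 2 - e' ^+ 2) / (pi * (s ^+ 2 + e ^+ 2) * (s ^+ 2 + e' ^+ 2)))).
    rewrite /Qk; move: (pi : R) p1 => p p1; field; rewrite !gt_eqF//; lra.
  have ee2 : 0 <= e ^+ 2 - e' ^+ 2 by rewrite subr_ge0 ler_sqr ?nnegrE ?(ltW e0) ?(ltW e'0).
  rewrite normrN normrM (@ger0_norm _ (_ / _)); last first.
    by apply: divr_ge0 => //; apply/ltW; exact: mulr_gt0 (pi_den_gt0 s e0) d0'.
  have ss : s ^+ 2 = `|s| ^+ 2 by rewrite real_normK ?num_real.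
  rewrite ss in d0 d0' *; set a := `|s| in a0 d0 d0' *.
  set d := a ^+ 2 + e ^+ 2 in d0 *; set d' := a ^+ 2 + e' ^+ 2 in d0' *.
  apply: (@le_trans _ _ (e ^+ 2 / (a * d))); last first.
    rewrite ler_pM2r ?invr_gt0 ?mulr_gt0// lerDl mulr_ge0// ltW//.
  rewrite ler_pdivlMr ?mulr_gt0//.
  rewrite [leLHS](_ : _ = (a ^+ 2 / d') * (e ^+ 2 - e' ^+ 2) / pi); last first.
    by move: (pi : R) p1 => p p1; field; rewrite !gt_eqF//; lra.
  rewrite ler_pdivrMr ?pi_gt0//.
  apply: (@le_trans _ _ (e ^+ 2)); last by rewrite ler_peMr ?sqr_ge0.
  apply: (@le_trans _ _ (1 * (e ^+ 2 - e' ^+ 2))).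
    by apply: ler_wpM2r => //; rewrite ler_pdivrMr// mul1r lerDl sqr_ge0.
  by rewrite mul1r gerBl sqr_ge0.
Qed.

(** Since the Poisson kernel has mass [1], the left side averages [f x - f (x - s)]. *)
Lemma CB_bound H f (x e : R) : holder H f -> 0 < e ->
  `|CB f x e + f x| <= H * (Num.sqrt e * vk_mass R).
Proof.
move=> hf e0; have mf := holder_measurable hf; have [_ f2 fH] := hf.
have H0 := holder_ge0 hf.
have i1 := itg_conv x mf f2 (measurable_Pk e0) (itg_Pk2 e0).
have i2 := itgZ (f x) (itg_Pk e0).
have -> : CB f x e + f x = RI (fun s => f x * Pk e s - f (x - s) * Pk e s).
  by rewrite RI_B// RI_Z ?itg_Pk// RI_Pk// mulr1 addrC.
rewrite -RI_vk// -RI_Z ?itg_vk//; apply: RI_norm; [|by apply: itgZ; exact: itg_vk|].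
  by apply: measurable_funB; exact: itg_measurable.
move=> s /=; rewrite -mulrBl normrM.
apply: (@le_trans _ _ (H * Num.sqrt `|s| * `|Pk e s|)).
  apply: ler_wpM2r => //; apply: (le_trans (fH _ _)).
  by rewrite (_ : x - (x - s) = s)//; ring.
rewrite -mulrA ler_wpM2l//; apply: vk_dom => // s0.
have d0 := den_gt0 s e0; have p1 := pi_ge1 R.
have a0 : 0 < `|s| by rewrite normr_gt0.
rewrite /Pk normrM normfV (gtr0_norm e0) (gtr0_norm (pi_den_gt0 s e0)).
set d := _ + _ in d0 *.
apply: (@le_trans _ _ (e / d)).
  rewrite ler_pM2l// lef_pV2 ?posrE ?mulr_gt0 ?pi_gt0//.
  by rewrite ler_peMl// ltW.
rewrite ler_pdivlMr ?mulr_gt0//.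
have -> : e / d * (`|s| * d) = `|s| * e by field; rewrite gt_eqF.
by rewrite lerDr sqr_ge0.
Qed.


Lemma measurable_far (e : R) : measurable [set s : R | e < `|s|].
Proof.
rewrite (_ : [set s : R | _] = setT `&` (fun s : R => `|s|) @^-1` [set` `]e, +oo[]).
  have ma : measurable_fun setT (fun s : R => `|s|).
    by apply: continuous_measurable_fun; exact: norm_continuous.
  by apply: ma => //; exact: measurable_itv.
by rewrite setTI; apply/seteqP; split => s /=; rewrite in_itv/= andbT.
Qed.

Definition Tk (e s : R) : R := ((fun u => u^-1) \_ [set s : R | e < `|s|]) s.

Lemma TkE (e s : R) : Tk e s = if e < `|s| then s^-1 else 0.
Proof.
rewrite /Tk patchE; case: ifPn => h; case: ifPn => //; first by rewrite inE /= in h; rewrite h.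
by move=> h'; rewrite mem_set in h.
Qed.

Lemma measurable_Tk (e : R) : measurable_fun setT (Tk e).
Proof. by apply: measurable_patch; [exact: measurable_far|exact: measurable_inv]. Qed.

Lemma itg_Tk2 (e : R) : 0 < e -> itg (fun s => Tk e s ^+ 2).
Proof.
move=> e0; apply: (@itg_sqr_le R _ 2 e) => //; first exact: measurable_Tk.
move=> s; rewrite TkE; have d0 := den_gt0 s e0; case: ifP => h; last first.
  by rewrite expr0n/= mulr_ge0 ?invr_ge0// ltW.
have a0 := lt_trans e0 h.
have ss : s ^+ 2 = `|s| ^+ 2 by rewrite real_normK ?num_real.
rewrite exprVn; apply: ler_inv2 => //; first by rewrite ss exprn_gt0.
have : e ^+ 2 <= `|s| ^+ 2 by rewrite ler_sqr ?nnegrE ?ltW.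
rewrite ss; lra.
Qed.

Lemma truncatedE H f (x e : R) : 0 < e -> holder H f ->
  Rintegral mu [set y | e < `|x - y|] (fun y => f y / (x - y)) = RI (fun s => f (x - s) * Tk e s).
Proof.
move=> e0 hf; have mf := holder_measurable hf; have [_ f2 _] := hf.
have ih := itg_conv x mf f2 (measurable_Tk e) (itg_Tk2 e0).
rewrite -(RI_shift x ih) Rintegral_mkcond; apply: eq_Rintegral => y _.
rewrite patchE TkE; have -> : x - (x - y) = y by ring.
case: ifPn; first by rewrite inE /= => ->.
by move=> h; rewrite ifF ?mulr0//; apply/negP => h'; move: h; rewrite mem_set.
Qed.

(** [pi^-1 * Tk e - Qk e] is again odd and dominated by [vk e], so sharp truncation and the shift
    off the real line have the same limit. *)
Lemma truncated_CA H f (x e : R) : 0 < e -> holder H f ->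
  `|pi^-1 * Rintegral mu [set y | e < `|x - y|] (fun y => f y / (x - y)) - CA f x e|
    <= H * (Num.sqrt e * vk_mass R).
Proof.
move=> e0 hf; rewrite (truncatedE _ e0 hf).
have mf := holder_measurable hf; have [_ f2 _] := hf.
have i1 := itg_conv x mf f2 (measurable_Tk e) (itg_Tk2 e0).
have i2 := itg_conv x mf f2 (measurable_Qk e0) (itg_Qk2 e0).
rewrite /CA -RI_Z// -RI_B//; last exact: itgZ.
rewrite (_ : RI _ = RI (fun s => f (x - s) * (pi^-1 * Tk e s - Qk e s))); last first.
  by apply: eq_Rintegral => s _; rewrite mulrBr mulrCA.
apply: odd_kernel_bound => //.
- apply: measurable_funB; last exact: measurable_Qk.
  by apply: measurable_funM => //; exact: measurable_Tk.
- apply: (itg_le _ _ (itgD (itgZ (2 * pi^-1 ^+ 2) (itg_Tk2 e0)) (itgZ 2 (itg_Qk2 e0)))).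
    apply: measurable_funX; apply: measurable_funB; last exact: measurable_Qk.
    by apply: measurable_funM => //; exact: measurable_Tk.
  move=> s /=; rewrite ger0_norm ?sqr_ge0//.
  have := sqr_ge0 (pi^-1 * Tk e s + Qk e s); lra.
- move=> s; rewrite QkN !TkE normrN; case: ifP => _; rewrite ?invrN; ring.
- move=> s; apply: vk_dom => // s0; rewrite TkE.
  have d0 := den_gt0 s e0; have p1 := pi_ge1 R.
  have a0 : 0 < `|s| by rewrite normr_gt0.
  have ss : s ^+ 2 = `|s| ^+ 2 by rewrite real_normK ?num_real.
  have bnd : e ^+ 2 / (`|s| * (s ^+ 2 + e ^+ 2)) <= (e ^+ 2 + `|s| * e) / (`|s| * (s ^+ 2 + e ^+ 2)).
    by rewrite ler_pM2r ?invr_gt0 ?mulr_gt0// lerDl mulr_ge0// ltW.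
  apply: le_trans bnd; case: ifPn => h.
    have -> : pi^-1 * s^-1 - Qk e s = pi^-1 * (s^-1 * (e ^+ 2 / (s ^+ 2 + e ^+ 2))).
      rewrite /Qk; move: (pi : R) p1 => p p1; field; rewrite s0 gt_eqF ?gt_eqF//; lra.
    rewrite normrM ger0_norm ?invr_ge0 ?pi_ge0// normrM normfV (@ger0_norm _ (_ / _)); last first.
      by rewrite divr_ge0 ?sqr_ge0 ?(ltW d0).
    rewrite [leRHS](_ : _ = `|s|^-1 * (e ^+ 2 / (s ^+ 2 + e ^+ 2))); last by field; rewrite !gt_eqF.
    rewrite ger_pMl ?invf_le1 ?pi_gt0//.
    by rewrite mulr_gt0 ?invr_gt0// divr_gt0// exprn_gt0.
  rewrite mulr0 sub0r normrN /Qk normrM normfV (gtr0_norm (pi_den_gt0 s e0)).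
  rewrite ler_pdivlMr ?mulr_gt0//.
  rewrite [leLHS](_ : _ = `|s| ^+ 2 / pi); last first.
    by move: (pi : R) p1 => p p1; field; rewrite !gt_eqF//; lra.
  rewrite ler_pdivrMr ?pi_gt0//; rewrite -leNgt in h.
  apply: (@le_trans _ _ (e ^+ 2)); first by rewrite ler_sqr ?nnegrE ?(ltW e0).
  by rewrite ler_peMr ?sqr_ge0.
Qed.

Lemma bound_cvg0 (c : R) : (fun e : R => c * (Num.sqrt e * vk_mass R)) @ 0^'+ --> 0.
Proof.
rewrite [X in _ --> X](_ : _ = c * (Num.sqrt 0 * vk_mass R)); last first.
  by rewrite sqrtr0 mul0r mulr0.
apply: cvgM; first exact: cvg_cst.
apply: cvgM; last exact: cvg_cst.
apply: cvg_at_right_filter; exact: sqrt_continuous.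
Qed.

(** [hilbert] is defined through [lim] and carries information only once convergence is known: the
    smooth regularisations converge because they are Cauchy, and the truncated integrals follow
    them. *)
Lemma CA_cvg H f (x : R) : holder H f -> CA f x @ 0^'+ --> hilbert f x.
Proof.
move=> hf.
have cA : cvg (CA f x @ 0^'+).
  apply: cauchy_cvg; apply/cauchy_exP => e e0.
  have := @bound_cvg0 H; move=> /cvgrPdist_lt/(_ e e0) hb.
  have : \forall d \near (0:R)^'+, 0 < d /\ H * (Num.sqrt d * vk_mass R) < e.
    near=> d; split; first by near: d; exact: nbhs_right_gt.
    have : `|0 - H * (Num.sqrt d * vk_mass R)| < e by near: d.
    by rewrite sub0r normrN; apply: le_lt_trans; exact: ler_norm.
  move=> /filter_ex[d [d0 dlt]].
  exists (CA f x d); change (\forall d' \near (0:R)^'+, ball (CA f x d) e (CA f x d')).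
  near=> d'; rewrite /ball/=.
  apply: (le_lt_trans _ dlt); apply: CA_diff => //.
  by near: d'; exact: nbhs_right_le.
suff -> : hilbert f x = lim (CA f x @ 0^'+) by [].
have h2 : (fun e => pi^-1 * Rintegral mu [set y | e < `|x - y|] (fun y => f y / (x - y)) - CA f x e)
   @ 0^'+ --> 0.
  apply/cvgrPdist_lt => e e0; have := @bound_cvg0 H; move=> /cvgrPdist_lt/(_ e e0) hb.
  near=> d; rewrite sub0r normrN.
  have : `|0 - H * (Num.sqrt d * vk_mass R)| < e by near: d.
  rewrite sub0r normrN => h; apply: le_lt_trans (le_lt_trans (ler_norm _) h).
  by apply: truncated_CA => //; near: d; exact: nbhs_right_gt.
have p0 : pi != 0 :> R by rewrite gt_eqF// pi_gt0.
have h4 : (fun e => Rintegral mu [set y | e < `|x - y|] (fun y => f y / (x - y))) @ 0^'+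
    --> pi * (0 + lim (CA f x @ 0^'+)).
  rewrite (_ : (fun e => _) = (fun e => pi * ((pi^-1 * Rintegral mu [set y | e < `|x - y|] (fun y => f y / (x - y)) - CA f x e) + CA f x e))); last first.
    by apply/funext => e /=; rewrite subrK mulVKf.
  by apply: cvgM; [exact: cvg_cst|apply: cvgD; [exact: h2|exact: cA]].
rewrite add0r in h4.
by rewrite /hilbert (cvg_lim _ h4)// mulKf.
Unshelve. all: by end_near. Qed.

Lemma CA_hilbert H f (x e : R) : holder H f -> 0 < e ->
  `|CA f x e - hilbert f x| <= H * (Num.sqrt e * vk_mass R).
Proof.
move=> hf e0.
have h : (fun d => `|CA f x e - CA f x d|) @ 0^'+ --> `|CA f x e - hilbert f x|.
  by apply: cvg_norm; apply: cvgB; [exact: cvg_cst|exact: CA_cvg hf].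
rewrite -(cvg_lim _ h)//; apply: limr_le; first by apply/cvg_ex; eexists; exact: h.
near=> d; apply: CA_diff => //.
by near: d; exact: nbhs_right_le.
Unshelve. all: by end_near. Qed.

Lemma CB_cvg H f (x : R) : holder H f -> CB f x @ 0^'+ --> - f x.
Proof.
move=> hf; apply/cvgrPdist_lt => e e0; have := @bound_cvg0 H; move=> /cvgrPdist_lt/(_ e e0) hb.
near=> d.
have : `|0 - H * (Num.sqrt d * vk_mass R)| < e by near: d.
rewrite sub0r normrN => h; apply: le_lt_trans (le_lt_trans (ler_norm _) h).
rewrite distrC opprK; apply: CB_bound => //; near: d; exact: nbhs_right_gt.
Unshelve. all: by end_near. Qed.

End CauchyIntegral.

(** * Convolutions with square integrable kernels *)

Section StaticIdentity.
Variable R : realType.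
Notation mu := (@lebesgue_measure R).
Implicit Types f : R -> R.

(** The translates of [f] have a constant L^2 norm and converge pointwise, so they converge
    weakly. *)
Lemma conv_cvg f (k : R -> R) (u : nat -> R) (x : R) : continuous f -> itg (fun y => f y ^+ 2) ->
  measurable_fun setT k -> itg (fun s => k s ^+ 2) -> u @ \oo --> x ->
  (fun n => RI (fun s => f (u n - s) * k s)) @ \oo --> RI (fun s => f (x - s) * k s).
Proof.
move=> cf f2 mk k2 ux; have mf := continuous_measurable_fun cf.
apply: (RI_weak_cvg (C := RI (fun y => f y ^+ 2))) => //.
- by move=> n; exact: measurable_shift.
- by move=> n; exact: (itg_shift (u n) f2).
- by move=> n; rewrite (RI_shift (u n) f2).
- move=> s; apply: continuous_cvg; first exact: cf.
  by apply: cvgB => //; exact: cvg_cst.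
Qed.

Lemma conv_continuous f (k : R -> R) : continuous f -> itg (fun y => f y ^+ 2) ->
  measurable_fun setT k -> itg (fun s => k s ^+ 2) ->
  continuous (fun x => RI (fun s => f (x - s) * k s)).
Proof.
move=> cf f2 mk k2 x; apply/(@cvg_nbhsP R R^o) => u ux; exact: conv_cvg.
Qed.

Lemma measurable_hilbert H f : holder H f -> measurable_fun setT (hilbert f).
Proof.
move=> hf; have [cf f2 _] := hf.
apply: (@measurable_fun_cvg _ (measurableTypeR R) R setT (fun n x => CA f x n.+1%:R^-1)).
  move=> n; apply: continuous_measurable_fun; apply: conv_continuous => //.
    by apply: measurable_Qk; rewrite invr_gt0.
  by apply: itg_Qk2; rewrite invr_gt0.
move=> x _; have := CA_cvg (x := x) hf; move=> /cvg_at_rightP; apply; split => [n|].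
  by rewrite invr_gt0.
exact: cvg_harmonic.
Qed.

Lemma RI_amgm1 (f g : R -> R) : measurable_fun setT f -> measurable_fun setT g ->
  itg (fun x => f x ^+ 2) -> itg (fun x => g x ^+ 2) ->
  RI (fun x => `|f x * g x|) <= (RI (fun x => f x ^+ 2) + RI (fun x => g x ^+ 2)) / 2.
Proof.
move=> mf mg f2 g2; have := RI_amgm (@ltr01 R) mf mg f2 g2.
by move=> /le_trans; apply; rewrite mulr1 mul1r mulrDl ![_ / 2]mulrC.
Qed.

Lemma conv_bound f (k : R -> R) (x : R) : measurable_fun setT f -> itg (fun y => f y ^+ 2) ->
  measurable_fun setT k -> itg (fun s => k s ^+ 2) ->
  RI (fun s => `|f (x - s) * k s|) <= (RI (fun y => f y ^+ 2) + RI (fun s => k s ^+ 2)) / 2.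
Proof.
move=> mf f2 mk k2.
have := RI_amgm1 (measurable_shift x mf) mk (itg_shift x f2) k2.
by rewrite (RI_shift x f2).
Qed.

(** At height [1], the Hoelder modulus controls [CB f x 1 + f x], and the L^2 norm controls
    [CB f x 1]. *)
Lemma holder_bounded H f : holder H f -> exists C, forall x, `|f x| <= C.
Proof.
move=> hf; have [cf f2 _] := hf; have mf := holder_measurable hf.
exists (H * (Num.sqrt 1 * vk_mass R) + (RI (fun y => f y ^+ 2) + RI (fun s => Pk 1 s ^+ 2)) / 2) => x.
have h1 := CB_bound x hf (@ltr01 R).
have h2 := conv_bound x mf f2 (measurable_Pk (@ltr01 R)) (itg_Pk2 (@ltr01 R)).
have h3 : `|CB f x 1| <= (RI (fun y => f y ^+ 2) + RI (fun s => Pk 1 s ^+ 2)) / 2.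
  rewrite /CB normrN; apply: le_trans h2; apply: le_normr_Rintegral => //.
  exact: (itg_conv x mf f2 (measurable_Pk (@ltr01 R)) (itg_Pk2 (@ltr01 R))).
have -> : f x = CB f x 1 + f x - CB f x 1 by ring.
by apply: (le_trans (ler_normB _ _)); exact: lerD.
Qed.

(** The integral in [y'] is bounded uniformly in [y] because [q] and [K] are square integrable, and
    [p] is then integrable in [y]. Boundedness of [K] makes the inner integral in [y] converge as
    well. *)
Lemma RI_fubini (p q K : R -> R) (C : R) : itg p -> measurable_fun setT q ->
  itg (fun s => q s ^+ 2) -> measurable_fun setT K -> itg (fun s => K s ^+ 2) ->
  (forall s, `|K s| <= C) ->
  [/\ itg (fun y => p y * RI (fun y' => q y' * K (y - y'))),
      itg (fun y' => q y' * RI (fun y => p y * K (y - y'))) &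
   RI (fun y => p y * RI (fun y' => q y' * K (y - y'))) =
   RI (fun y' => q y' * RI (fun y => p y * K (y - y')))].
Proof.
move=> ip mq q2 mK K2 KC; have mp := itg_measurable ip.
pose G (z : R * R) : R := p z.1 * (q z.2 * K (z.1 - z.2)).
have mG : measurable_fun setT (EFin \o G : measurableTypeR R * measurableTypeR R -> \bar R).
  apply/measurable_EFinP; apply: measurable_funM; first exact: (measurableT_comp mp measurable_fst).
  apply: measurable_funM; first exact: (measurableT_comp mq measurable_snd).
  apply: (measurableT_comp mK); apply: measurable_funB; [exact: measurable_fst|exact: measurable_snd].
have i1 y : itg (fun y' => q y' * K (y - y')).
  by apply: itg_mul => //; [exact: measurable_shift|exact: (itg_shift y K2)].
have mKt (y' : R) : measurable_fun setT (fun y : R => K (y - y')).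
  have ms : measurable_fun setT (fun y : R => y - y').
    by apply: continuous_measurable_fun => s; apply: cvgB; [exact: cvg_id|exact: cvg_cst].
  exact: (measurableT_comp mK ms).
have i2 y' : itg (fun y => p y * K (y - y')).
  apply: (itg_le _ _ (itgZ C (itg_norm ip))); first exact: measurable_funM.
  by move=> y /=; rewrite normrM mulrC ler_wpM2r.
pose D := (RI (fun y => q y ^+ 2) + RI (fun y => K y ^+ 2)) / 2.
have i1D y : RI (fun y' => `|q y' * K (y - y')|) <= D.
  have := RI_amgm1 mq (measurable_shift y mK) q2 (itg_shift y K2).
  by rewrite (RI_shift y K2).
have mA : measurable_fun setT (abse \o (EFin \o G) : measurableTypeR R * measurableTypeR R -> \bar R).
  exact: measurableT_comp.
have hfin : (\int[mu]_y \int[mu]_y' `|(EFin \o G) (y, y')| < +oo)%E.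
  apply: (@le_lt_trans _ _ (\int[mu]_y (D * `|p y|)%:E)%E); last first.
    by rewrite -EFin_RI ?ltry//; exact/itgZ/itg_norm.
  apply: ge0_le_integral => //.
  - by move=> y _; exact: integral_ge0.
  - exact: (@measurable_fun_fubini_tonelli_F _ _ (measurableTypeR R) (measurableTypeR R) R mu
      (abse \o (EFin \o G)) mA (fun _ => abse_ge0 _)).
  - by apply/measurable_EFinP; apply: measurable_funM => //; exact: measurableT_comp.
  - move=> y _.
    rewrite [X in (X <= _)%E](_ : _ = (\int[mu]_y' (`|p y| * `|q y' * K (y - y')|)%:E)%E); last first.
      by apply: eq_integral => y' _ /=; rewrite /G/= normrM.
    rewrite -EFin_RI; last exact/itgZ/itg_norm.
    by rewrite RI_Z ?lee_fin; [rewrite mulrC ler_wpM2r|exact: itg_norm].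
have iG := (@integrable12ltyP _ _ (measurableTypeR R) (measurableTypeR R) R mu mu (EFin \o G) mG).2 hfin.
have E1 y : (\int[mu]_y' (EFin \o G) (y, y') = (p y * RI (fun y' => q y' * K (y - y')))%:E)%E.
  by rewrite -RI_Z// EFin_RI//; exact: itgZ.
have E2 y' : (\int[mu]_y (EFin \o G) (y, y') = (q y' * RI (fun y => p y * K (y - y')))%:E)%E.
  rewrite -RI_Z// EFin_RI; last exact: itgZ.
  by apply: eq_integral => y _ /=; rewrite /G/= mulrCA.
pose G' (z : measurableTypeR R * measurableTypeR R) : R := G (z.2, z.1).
have mG' : measurable_fun setT (EFin \o G' : measurableTypeR R * measurableTypeR R -> \bar R).
  exact: (measurableT_comp mG (@measurable_swap _ _ (measurableTypeR R) (measurableTypeR R))).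
have iG' := (@integrable21ltyP _ _ (measurableTypeR R) (measurableTypeR R) R mu mu (EFin \o G') mG').2 hfin.
have F1 := integrable_fubini_F iG; have F2 := integrable_fubini_F iG'.
have F3 := Fubini iG.
have O1 : itg (fun y => p y * RI (fun y' => q y' * K (y - y'))).
  by move: F1; congr integrable; apply/funext => y /=; rewrite /fubini_F E1.
have O2 : itg (fun y' => q y' * RI (fun y => p y * K (y - y'))).
  by move: F2; congr integrable; apply/funext => y /=; rewrite /fubini_F -E2.
split; [exact: O1|exact: O2|apply: EFin_inj].
rewrite (EFin_RI O1) (EFin_RI O2).
have -> : (\int[mu]_y (p y * RI (fun y' => q y' * K (y - y')))%:E =
   \int[mu]_y \int[mu]_y' (EFin \o G) (y, y'))%E by apply: eq_integral => y _; rewrite E1.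
by rewrite F3; apply: eq_integral => y' _; rewrite E2.
Qed.

End StaticIdentity.

(** * The Cauchy integral of [f * hilbert f] *)

Section ProductIdentity.
Variable R : realType.
Notation mu := (@lebesgue_measure R).
Implicit Types f : R -> R.

Definition Ka (x e y : R) : R := Qk e (x - y).
Definition Kb (x e y : R) : R := - Pk e (x - y).

Lemma CAE H f (x e : R) : holder H f -> 0 < e -> CA f x e = RI (fun y => f y * Ka x e y).
Proof.
move=> hf e0; have mf := holder_measurable hf; have [_ f2 _] := hf.
have i1 := itg_conv x mf f2 (measurable_Qk e0) (itg_Qk2 e0).
rewrite /CA -(RI_shift x i1); apply: eq_Rintegral => y _; rewrite /Ka.
by have -> : x - (x - y) = y by ring.
Qed.

Lemma CBE H f (x e : R) : holder H f -> 0 < e -> CB f x e = RI (fun y => f y * Kb x e y).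
Proof.
move=> hf e0; have mf := holder_measurable hf; have [_ f2 _] := hf.
have i1 := itg_conv x mf f2 (measurable_Pk e0) (itg_Pk2 e0).
rewrite /CB -(RI_shift x i1) -RI_N; last exact: (itg_shift x i1).
apply: eq_Rintegral => y _; rewrite /Kb mulrN.
by have -> : x - (x - y) = y by ring.
Qed.

Lemma measurable_Ka (x e : R) : 0 < e -> measurable_fun setT (Ka x e).
Proof. by move=> e0; apply: (measurable_shift x); exact: measurable_Qk. Qed.

Lemma measurable_Kb (x e : R) : 0 < e -> measurable_fun setT (Kb x e).
Proof. by move=> e0; apply: measurable_funN; apply: (measurable_shift x); exact: measurable_Pk. Qed.

Lemma itg_Ka2 (x e : R) : 0 < e -> itg (fun y => Ka x e y ^+ 2).
Proof. by move=> e0; exact: (itg_shift x (itg_Qk2 e0)). Qed.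

Lemma itg_Kb2 (x e : R) : 0 < e -> itg (fun y => Kb x e y ^+ 2).
Proof.
move=> e0; have := itg_shift x (itg_Pk2 e0); congr integrable; apply/funext => y /=.
by rewrite /Kb sqrrN.
Qed.

Lemma kernel_bounded (k s e : R) : 0 < e -> k ^+ 2 <= (s ^+ 2 + e ^+ 2)^-1 -> `|k| <= e^-1.
Proof.
move=> e0 h; rewrite -[leRHS]gtr0_norm ?invr_gt0// -ler_sqr ?nnegrE//.
rewrite !real_normK ?num_real//; apply: (le_trans h).
by rewrite exprVn lef_pV2 ?posrE ?den_gt0 ?exprn_gt0// lerDr sqr_ge0.
Qed.

Lemma Ka_bounded (x e y : R) : 0 < e -> `|Ka x e y| <= e^-1.
Proof. by move=> e0; exact: (kernel_bounded e0 (Qk_sqr _ e0)). Qed.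

Lemma Kb_bounded (x e y : R) : 0 < e -> `|Kb x e y| <= e^-1.
Proof. by move=> e0; rewrite /Kb normrN; exact: (kernel_bounded e0 (Pk_sqr _ e0)). Qed.

(* With [K y = pi^-1 / (z - y)]: [(K y - K y') / (pi (y - y')) = K y * K y']. *)
Lemma Ka_resolvent (x e y y' d : R) : 0 < e -> 0 < d ->
  (Ka x e y - Ka x e y') * Qk d (y - y') =
  (1 - pi * d * Pk d (y - y')) * (Ka x e y * Ka x e y' + - Kb x e y * Kb x e y').
Proof.
move=> e0 d0; rewrite /Ka /Kb /Qk /Pk.
have h1 := den_gt0 (x - y) e0; have h2 := den_gt0 (x - y') e0.
have h3 := den_gt0 (y - y') d0; have p0 := pi_gt0 R.
move: (pi : R) p0 => p p0; field; rewrite !gt_eqF//.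
Qed.

Lemma Kb_resolvent (x e y y' d : R) : 0 < e -> 0 < d ->
  (Kb x e y - Kb x e y') * Qk d (y - y') =
  (1 - pi * d * Pk d (y - y')) * (Kb x e y * Ka x e y' + Ka x e y * Kb x e y').
Proof.
move=> e0 d0; rewrite /Ka /Kb /Qk /Pk.
have h1 := den_gt0 (x - y) e0; have h2 := den_gt0 (x - y') e0.
have h3 := den_gt0 (y - y') d0; have p0 := pi_gt0 R.
move: (pi : R) p0 => p p0; field; rewrite !gt_eqF//.
Qed.

Lemma eq0_of_sqrt_bound (v c1 c2 : R) :
  (forall d, 0 < d -> `|v| <= c1 * Num.sqrt d + c2 * d) -> v = 0.
Proof.
move=> h; apply/eqP; rewrite -normr_le0.
have c : (fun d : R => c1 * Num.sqrt d + c2 * d) @ 0^'+ --> c1 * Num.sqrt 0 + c2 * 0.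
  apply: cvgD; (apply: cvgM; first exact: cvg_cst); apply: cvg_at_right_filter.
    exact: sqrt_continuous.
  exact: cvg_id.
rewrite sqrtr0 !mulr0 addr0 in c.
rewrite -(cvg_lim _ c)//; apply: limr_ge; first by apply/cvg_ex; eexists; exact: c.
near=> d; apply: h; near: d; exact: nbhs_right_gt.
Unshelve. all: by end_near. Qed.

(** Replacing [hilbert f] by its regularisation at height [d] turns the left side into a double
    integral with the odd kernel [Qk d (y - y')]. Exchanging the variables replaces [k y] by
    [k y - k y'], and the resolvent identity [res] factors the integrand into products of functions
    of [y] and of [y'], up to a defect that vanishes with [d]. *)
Lemma hilbert_product H f (x e : R) (k k1 k2 : R -> R) (C : R) : holder H f -> 0 < e ->
  measurable_fun setT k -> measurable_fun setT k1 -> measurable_fun setT k2 ->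
  itg (fun y => k y ^+ 2) -> itg (fun y => k1 y ^+ 2) -> itg (fun y => k2 y ^+ 2) ->
  (forall y, `|k y| <= C) ->
  (forall y y' d, 0 < d -> (k y - k y') * Qk d (y - y') =
    (1 - pi * d * Pk d (y - y')) * (k1 y * Ka x e y' + k2 y * Kb x e y')) ->
  2 * RI (fun y => f y * hilbert f y * k y) =
    RI (fun y => f y * k1 y) * CA f x e + RI (fun y => f y * k2 y) * CB f x e.
Proof.
move=> hf e0 mk mk1 mk2 i k1i k2i kC res.
have mf := holder_measurable hf; have [cf f2 _] := hf.
have [Cf fC] := holder_bounded hf.
have Cf0 : 0 <= Cf := le_trans (normr_ge0 _) (fC 0).
have mh := measurable_hilbert hf.
have ifk := itg_mul mf mk f2 i.
have ifk1 := itg_mul mf mk1 f2 k1i; have ifk2 := itg_mul mf mk2 f2 k2i.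
have ifa := itg_mul mf (measurable_Ka x e0) f2 (itg_Ka2 x e0).
have ifb := itg_mul mf (measurable_Kb x e0) f2 (itg_Kb2 x e0).
have p0 := pi_gt0 R; have ei0 : 0 < e^-1 by rewrite invr_gt0.
have hCA y d : 0 < d -> `|CA f y d - hilbert f y| <= H * (Num.sqrt d * vk_mass R).
  by move=> d0; exact: CA_hilbert.
have CA1 y : `|CA f y 1| <= (RI (fun y => f y ^+ 2) + RI (fun s => Qk 1 s ^+ 2)) / 2.
  apply: le_trans (conv_bound y mf f2 (measurable_Qk (@ltr01 R)) (itg_Qk2 (@ltr01 R))).
  apply: le_normr_Rintegral; first exact: measurableT.
  exact: (itg_conv y mf f2 (measurable_Qk (@ltr01 R)) (itg_Qk2 (@ltr01 R))).
have EA := CAE x hf e0; have EB := CBE x hf e0.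
move: (hilbert f) mh hCA (CA f x e) (CB f x e) EA EB => h mh hCA A B EA EB.
have H0 := holder_ge0 hf; have v0 := vk_mass_ge0 R.
have ihk : itg (fun y => f y * h y * k y).
  set D := (_ / 2) in CA1.
  apply: (itg_le _ _ (itgZ (H * (Num.sqrt 1 * vk_mass R) + D) (itg_norm ifk))).
    by apply: measurable_funM => //; exact: measurable_funM.
  move=> y /=; rewrite mulrAC normrM mulrC ler_wpM2r//.
  have -> : h y = - (CA f y 1 - h y) + CA f y 1 by ring.
  by apply: (le_trans (ler_normD _ _)); rewrite normrN lerD// hCA.
clear CA1.
apply/eqP; rewrite -subr_eq0; apply/eqP.
pose L1 := RI (fun y => `|f y * k y|).
pose L2 := RI (fun y => `|f y * k1 y|) + RI (fun y => `|f y * k2 y|).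
(* The [sqrt d] error comes from replacing [hilbert f] by the Cauchy integral at height [d], the
   linear one from the factor [1 - pi d Pk d] of the resolvent identity. *)
apply: (@eq0_of_sqrt_bound _ (2 * (L1 * (H * vk_mass R))) (L2 * (Cf * e^-1 * pi))) => d d0.
have cE y : CA f y d = RI (fun y' => f y' * Qk d (y - y')) by rewrite (CAE _ hf).
have {}hCA y := hCA y d d0.
have [u [v [uE vE [g1 g2 gE]]]] : exists u v : R -> R,
  [/\ forall y, u y = RI (fun y' => f y' * Qk d (y - y')),
      forall y, v y = RI (fun y' => f y' * k y' * Qk d (y' - y)) &
      [/\ itg (fun y => f y * k y * u y), itg (fun y => f y * v y) &
          RI (fun y => f y * k y * u y) = RI (fun y => f y * v y)]].
  have hQ := RI_fubini ifk mf f2 (measurable_Qk d0) (itg_Qk2 d0)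
    (fun s => kernel_bounded d0 (Qk_sqr s d0)).
  by do 2 eexists; split; [| |exact: hQ].
have {}hCA y : `|u y - h y| <= H * (Num.sqrt d * vk_mass R) by rewrite uE -cE.
clear cE.
have J1 : `|RI (fun y => f y * h y * k y) - RI (fun y => f y * k y * u y)| <= L1 * (H * (Num.sqrt d * vk_mass R)).
  rewrite -(RI_B ihk g1) mulrC -RI_Z; last exact: itg_norm.
  apply: RI_norm; [|by apply: itgZ; exact: itg_norm|].
    by apply: measurable_funB; [exact: itg_measurable|exact: (itg_measurable g1)].
  move=> y /=; rewrite mulrAC -mulrBr normrM mulrC ler_wpM2r// distrC; exact: hCA.
have conv1 y : itg (fun y' => f y' * Qk d (y - y')).
  apply: itg_mul => //; first by apply: (measurable_shift y); exact: measurable_Qk.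
  exact: (itg_shift y (itg_Qk2 d0)).
have conv2 y : itg (fun y' => f y' * k y' * Qk d (y - y')).
  apply: (itg_le _ _ (itgZ d^-1 (itg_norm ifk))).
    apply: measurable_funM; first exact: measurable_funM.
    by apply: (measurable_shift y); exact: measurable_Qk.
  move=> y' /=; rewrite normrM mulrC ler_wpM2r//; exact: (kernel_bounded d0 (Qk_sqr _ d0)).
(* [T y] is the inner integral after symmetrisation; without the factor [1 - pi d Pk d] it would be
   [k1 y * A + k2 y * B]. *)
have [T TE0] : exists T : R -> R, forall y, T y =
  RI (fun y' => f y' * (1 - pi * d * Pk d (y - y')) * (k1 y * Ka x e y' + k2 y * Kb x e y')).
  by eexists.
have TE y : f y * T y = f y * k y * u y + f y * v y.
  rewrite -mulrA -mulrDr; congr (_ * _).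
  rewrite vE [X in _ + X](_ : _ = - RI (fun y' => f y' * k y' * Qk d (y - y'))); last first.
    rewrite -(RI_N (conv2 y)); apply: eq_Rintegral => y' _.
    by rewrite -opprB QkN mulrN.
  rewrite uE TE0 -(RI_Z _ (conv1 y)) -(RI_B (itgZ (k y) (conv1 y)) (conv2 y)).
  apply: eq_Rintegral => y' _; rewrite -mulrA -res; last exact: d0.
  by ring.
have J2 : 2 * RI (fun y => f y * k y * u y) = RI (fun y => f y * T y).
  rewrite [RHS](_ : _ = RI (fun y => f y * k y * u y + f y * v y)); last first.
    by apply: eq_Rintegral => y _; exact: TE.
  by rewrite (RI_D g1 g2) -gE mulr_natl mulr2n.
have iT : itg (fun y => f y * T y).
  have := itgD g1 g2; congr integrable; apply/funext => y /=.
  by rewrite TE.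
have T0 y : RI (fun y' => f y' * (k1 y * Ka x e y' + k2 y * Kb x e y')) = k1 y * A + k2 y * B.
  rewrite EA EB -(RI_Z _ ifa) -(RI_Z _ ifb) -(RI_D (itgZ (k1 y) ifa) (itgZ (k2 y) ifb)).
  by apply: eq_Rintegral => y' _; ring.
have iT0 y : itg (fun y' => f y' * (k1 y * Ka x e y' + k2 y * Kb x e y')).
  have := itgD (itgZ (k1 y) ifa) (itgZ (k2 y) ifb); congr integrable; apply/funext => y' /=.
  by congr EFin; ring.
(* The defect [pi d Pk d] is not uniformly small, but its integral is [pi d], while [f] and the
   Cauchy kernels at height [e] are bounded. *)
have T1 y : `|T y - (k1 y * A + k2 y * B)| <= (`|k1 y| + `|k2 y|) * (Cf * e^-1 * pi * d).
  pose E y' := f y' * (pi * d * Pk d (y - y')) * (k1 y * Ka x e y' + k2 y * Kb x e y').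
  pose D y' := (`|k1 y| + `|k2 y|) * (Cf * e^-1 * (pi * d)) * Pk d (y - y').
  have iD : itg D by apply: itgZ; exact: (itg_shift y (itg_Pk d0)).
  have mE : measurable_fun setT E.
    apply: measurable_funM.
      apply: (measurable_funM mf); apply: measurable_funM; first exact: measurable_cst.
      by apply: (measurable_shift y); exact: measurable_Pk.
    apply: measurable_funD; (apply: measurable_funM; first exact: measurable_cst);
      [exact: measurable_Ka|exact: measurable_Kb].
  have ED y' : `|E y'| <= D y'.
    have P0 : 0 <= Pk d (y - y') by apply: divr_ge0; apply/ltW; [exact: d0|exact: pi_den_gt0].
    have pd : 0 <= pi * d * Pk d (y - y') by apply: mulr_ge0; [apply: mulr_ge0; apply: ltW|].
    rewrite /E /D normrM normrM (ger0_norm pd).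
    have q1 : `|k1 y * Ka x e y' + k2 y * Kb x e y'| <= (`|k1 y| + `|k2 y|) * e^-1.
      apply: (le_trans (ler_normD _ _)); rewrite (normrM (k1 y)) (normrM (k2 y)) mulrDl.
      by apply: lerD; apply: ler_wpM2l; rewrite ?normr_ge0//; [exact: Ka_bounded|exact: Kb_bounded].
    apply: (@le_trans _ _ (Cf * (pi * d * Pk d (y - y')) * ((`|k1 y| + `|k2 y|) * e^-1))).
      apply: ler_pM; [by rewrite mulr_ge0|exact: normr_ge0| |exact: q1].
      exact: (ler_wpM2r pd (fC y')).
    by rewrite le_eqVlt; apply/orP; left; apply/eqP; ring.
  have iE := itg_le mE ED iD.
  have iTy : itg (fun y' => f y' * (1 - pi * d * Pk d (y - y')) * (k1 y * Ka x e y' + k2 y * Kb x e y')).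
    have := itgB (iT0 y) iE; congr integrable; apply/funext => y' /=.
    by congr EFin; rewrite /E; ring.
  have -> : T y - (k1 y * A + k2 y * B) = - RI E.
    rewrite -T0 TE0 -(RI_B iTy (iT0 y)) -(RI_N iE).
    by apply: eq_Rintegral => y' _; rewrite /E; ring.
  rewrite normrN; apply: (le_trans (RI_norm mE iD ED)).
  rewrite RI_Z; last exact: (itg_shift y (itg_Pk d0)).
  by rewrite (RI_shift y (itg_Pk d0)) RI_Pk// mulr1 !mulrA.
clear TE0 T0 iT0 conv1 conv2 EA EB uE vE.
have J3 : `|RI (fun y => f y * T y) - (RI (fun y => f y * k1 y) * A + RI (fun y => f y * k2 y) * B)|
   <= L2 * (Cf * e^-1 * pi * d).
  have ic := itgD (itgZ A ifk1) (itgZ B ifk2).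
  have -> : RI (fun y => f y * k1 y) * A + RI (fun y => f y * k2 y) * B =
     RI (fun y => A * (f y * k1 y) + B * (f y * k2 y)).
    by rewrite (RI_D (itgZ A ifk1) (itgZ B ifk2)) (RI_Z _ ifk1) (RI_Z _ ifk2) [A * _]mulrC [B * _]mulrC.
  have iN := itgD (itg_norm ifk1) (itg_norm ifk2).
  rewrite -(RI_B iT ic) /L2 -(RI_D (itg_norm ifk1) (itg_norm ifk2)).
  rewrite mulrC -(RI_Z _ iN); apply: RI_norm; [|exact: itgZ|].
    by apply: measurable_funB; [exact: itg_measurable|exact: (itg_measurable ic)].
  move=> y /=.
  have -> : f y * T y - (A * (f y * k1 y) + B * (f y * k2 y)) =
     f y * (T y - (k1 y * A + k2 y * B)) by ring.
  rewrite !normrM -mulrDr mulrCA; apply: ler_wpM2l; first exact: normr_ge0.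
  by rewrite [leRHS]mulrC; exact: T1.
set a := RI _ in J1 *; set b := RI (fun y => f y * k y * u y) in J1 J2.
set c := RI (fun y => f y * T y) in J2 J3.
set c' := (_ + _ * B) in J3 *.
move: a b c c' J1 J2 J3 => a b c c' J1 J2 J3.
have -> : 2 * a - c' = 2 * (a - b) + (c - c') by rewrite -J2; ring.
apply: (le_trans (ler_normD _ _)); apply: lerD.
  rewrite normrM gtr0_norm// -[leRHS]mulrA ler_pM2l//; apply: (le_trans J1).
  by rewrite le_eqVlt; apply/orP; left; apply/eqP; ring.
by apply: (le_trans J3); rewrite !mulrA.
Qed.

(** Together with [hilbert_product_im] this says that the Cauchy integral of [f * hilbert f] is
    [F^2 / 2], with [F = CA + i CB]. *)
Lemma hilbert_product_re H f (x e : R) : holder H f -> 0 < e ->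
  RI (fun y => f y * hilbert f y * Ka x e y) = (CA f x e ^+ 2 - CB f x e ^+ 2) / 2.
Proof.
move=> hf e0; have mf := holder_measurable hf; have [cf f2 _] := hf.
have ma := measurable_Ka x e0; have mb := measurable_Kb x e0.
have ia := itg_Ka2 x e0; have ib := itg_Kb2 x e0.
have ib' : itg (fun y => (- Kb x e y) ^+ 2).
  by move: ib; congr integrable; apply/funext => y /=; rewrite (sqrrN (Kb x e y)).
have := hilbert_product hf e0 ma ma (measurable_funN mb) ia ia ib' (fun y => Ka_bounded x y e0)
  (fun y y' d d0 => Ka_resolvent x y y' e0 d0).
rewrite -(CAE _ hf)//.
have -> : RI (fun y => f y * - Kb x e y) = - CB f x e.
  rewrite (CBE _ hf)// -RI_N; last exact: itg_mul.
  by apply: eq_Rintegral => y _; rewrite mulrN.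
lra.
Qed.

Lemma hilbert_product_im H f (x e : R) : holder H f -> 0 < e ->
  RI (fun y => f y * hilbert f y * Kb x e y) = CA f x e * CB f x e.
Proof.
move=> hf e0; have mf := holder_measurable hf; have [cf f2 _] := hf.
have ma := measurable_Ka x e0; have mb := measurable_Kb x e0.
have ia := itg_Ka2 x e0; have ib := itg_Kb2 x e0.
have := hilbert_product hf e0 mb mb ma ib ib ia (fun y => Kb_bounded x y e0)
  (fun y y' d d0 => Kb_resolvent x y y' e0 d0).
rewrite -(CAE _ hf)// -(CBE _ hf)//.
lra.
Qed.

End ProductIdentity.

(** * Comparison along characteristics *)

Section Comparison.
Variable R : realType.

Lemma within_continuous_precomp (T U W : topologicalType) (A : set T) (B : set U) (f : U -> W) (g : T -> U) :
  {within B, continuous f} -> continuous g -> (forall x, A x -> B (g x)) ->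
  {within A, continuous (f \o g)}.
Proof.
move=> /subspace_continuousP cf cg AB; apply/subspace_continuousP => x Ax.
have h : g @ within A (nbhs x) --> within B (nbhs (g x)).
  move=> P /= hP; have := cg x _ hP; rewrite /nbhs/= /within/=.
  by apply: filterS => y hy Ay; apply: hy; exact: AB.
exact: (cvg_comp _ _ h (cf _ (AB _ Ax))).
Qed.

Lemma within_continuous_seq (V : R -> R -> R) (u t : nat -> R) (x tau : R) :
  {within [set p : R * R | 0 <= p.2], continuous (fun p : R * R => V p.1 p.2)} ->
  0 <= tau -> (forall n, 0 <= t n) -> u @ \oo --> x -> t @ \oo --> tau ->
  (fun n => V (u n) (t n)) @ \oo --> V x tau.
Proof.
move=> /subspace_continuousP cV t0 tn ux tt.
have h : (fun n => (u n, t n)) @ \oo --> within [set p : R * R | 0 <= p.2] (nbhs (x, tau)).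
  move=> P /= hP; have c2 : (fun n => (u n, t n)) @ \oo --> (x, tau) by apply: (@cvg_pair _ _ _ _ (nbhs x) (nbhs tau)).
  have := c2 _ hP; rewrite /nbhs/=; apply: filterS => n; apply; exact: tn.
exact: (cvg_comp _ _ h (cV (x, tau) t0)).
Qed.

(** One-sided, because the maximum over a space-time box may sit on its final time. *)
Lemma derive1_left_max (f : R -> R) (a c : R) : a < c -> derivable f c 1 ->
  (forall t, a < t -> t < c -> f t <= f c) -> 0 <= derive1 f c.
Proof.
move=> ac df fmax; rewrite derive1E ['D_1 f c]cvg_at_leftE; last exact: df.
apply: limr_ge.
  rewrite -(cvg_at_leftE (fun h => h^-1 *: ((f \o shift c) _ - f c))) //.
  apply: cvg_trans df; apply: cvg_app.
  move=> A [e egt0 Ae]; exists e => // x xe xgt0; apply: Ae => //.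
  exact/ltr0_neq0.
near=> h; apply: mulr_le0.
  by rewrite invr_le0; apply: ltW; near: h; exists 1 => /=.
rewrite subr_le0 [_%:A]mulr1; apply: fmax; near: h.
  exists (c - a); first by rewrite /= subr_gt0.
  move=> h; rewrite /= distrC subr0.
  by move=> /ltr_normlP [h1 h2] _; lra.
exists 1 => //= h _ h0; rewrite /shift/=; lra.
Unshelve. all: by end_near. Qed.

Lemma is_derive_expR_half (s : R) :
  is_derive s 1 (fun u => expR (- (u / 2))) (- 2^-1 * expR (- (s / 2))).
Proof.
have h : is_derive s 1 (fun u : R => - (u / 2)) (- 2^-1).
  have -> : (fun u : R => - (u / 2)) = - 2^-1 *: (id : R -> R).
    by apply/funext => u; rewrite !fctE /GRing.scale/= mulNr mulrC.
  by apply: is_derive_eq; rewrite /GRing.scale/= mulr1.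
have := @is_derive1_comp _ expR (fun u : R => - (u / 2)) s _ _ (is_derive_expR _) h.
by move=> H; apply: (is_derive_eq H); rewrite mulrC.
Qed.

Lemma touching_derive_space (V : R -> R) (c K x E Y : R) : derivable V Y 1 ->
  is_derive Y 1 (fun X => V X - c - K * (X * E - x) ^+ 2)
    (derive1 V Y - 2 * K * (Y * E - x) * E).
Proof.
move=> dV; have hV : is_derive Y 1 V (derive1 V Y) by rewrite derive1E; exact: derivableP.
have -> : (fun X => V X - c - K * (X * E - x) ^+ 2) = (V - cst c) - K *: ((E *: (id : R -> R) - cst x) ^+ 2).
  by apply/funext => u; rewrite /GRing.scale/= !fctE /= -[X in _ = _ - K * X]/((E * u - x) * (E * u - x)) expr2 [u * E]mulrC.
by apply: is_derive_eq; rewrite !fctE /GRing.scale/= /GRing.scale/=; ring.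
Qed.

Lemma touching_derive_time (V : R -> R) (c t1 K X x tau : R) : derivable V tau 1 ->
  is_derive tau 1 (fun t => V t - c * (t - t1) - K * (X * expR (- (t / 2)) - x) ^+ 2)
    (derive1 V tau - c + K * (X * expR (- (tau / 2)) - x) * X * expR (- (tau / 2))).
Proof.
move=> dV; have hV : is_derive tau 1 V (derive1 V tau) by rewrite derive1E; exact: derivableP.
have dq := is_derive_expR_half tau.
set q := (fun u => expR (- (u / 2))) in dq.
have -> : (fun t => V t - c * (t - t1) - K * (X * expR (- (t / 2)) - x) ^+ 2) =
  (V - c *: ((id : R -> R) - cst t1)) - K *: ((X *: q - cst x) ^+ 2).
  by apply/funext => u; rewrite /GRing.scale/= !fctE /= -[X0 in _ = _ - K * X0]/((X * q u - x) * (X * q u - x)) expr2.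
by apply: is_derive_eq; rewrite !fctE /GRing.scale/= /GRing.scale/= /q; field.
Qed.
Variable V : R -> R -> R.
Hypothesis cV : {within [set p : R * R | 0 <= p.2], continuous (fun p : R * R => V p.1 p.2)}.

(* Since only separate derivatives of [V] are available, the transport equation is integrated along
   the characteristic [X = exp(tau/2) x] by a maximum principle, touching [V] from above by the
   functions [(G + eta) (tau - t1) + K (X exp(-tau/2) - x)^2]. *)
Lemma characteristic_le (x t1 t2 r G : R) : 0 <= t1 -> t1 < t2 -> 0 < r ->
  (forall X tau, t1 < tau -> tau <= t2 -> `|X * expR (- (tau / 2)) - x| < r ->
    [/\ derivable (V X) tau 1, derivable (V ^~ tau) X 1 &
        derive1 (V X) tau + 2^-1 * X * derive1 (V ^~ tau) X <= G]) ->
  V (expR (t2 / 2) * x) t2 - V (expR (t1 / 2) * x) t1 <= G * (t2 - t1).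
Proof.
move=> t10 t12 r0 pde.
pose r' := r / 2; have r'0 : 0 < r' by rewrite divr_gt0.
have r'r : r' < r by rewrite /r'; lra.
(* Coordinates that straighten the characteristics: [p.1] is the offset of the starting point from
   [x], constant along each characteristic. *)
pose Phi (p : R * R) := (expR (p.2 / 2) * (x + p.1), p.2).
have cPhi : continuous Phi.
  move=> p; apply: (@cvg_pair _ _ _ _ (nbhs (Phi p).1) (nbhs (Phi p).2)); last exact: cvg_snd.
  apply: cvgM; last by apply: cvgD; [exact: cvg_cst|exact: cvg_fst].
  apply: continuous_cvg; first exact: continuous_expR.
  by apply: cvgM; [exact: cvg_snd|exact: cvg_cst].
pose box : set (R * R) := [set` `[- r', r']] `*` [set` `[t1, t2]].
have cbox : compact box by apply: compact_setX; exact: segment_compact.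
have box0 : box !=set0.
  by exists (0, t1); split => /=; rewrite in_itv/= ?lexx ?(ltW t12)// oppr_le0 (ltW r'0).
have cv : {within box, continuous ((fun p : R * R => V p.1 p.2) \o Phi)}.
  apply: (within_continuous_precomp cV cPhi) => p [_ /=]; rewrite in_itv/= => /andP[+ _].
  exact: le_trans.
set f0 := V (expR (t1 / 2) * x) t1.
have [pM pMb hM] := compact_EVT_max box0 cbox cv.
pose M := Num.max ((V (Phi pM).1 (Phi pM).2) - f0) 0.
have Mb p : box p -> V (Phi p).1 (Phi p).2 <= f0 + M.
  move=> bp; apply: (le_trans (hM p (mem_set bp))).
  by rewrite -lerBlDl le_max lexx.
have M0 : 0 <= M by rewrite le_max lexx orbT.
(* The margin [eta] makes the initial condition and the slope strict, so that a contact point is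
   contradictory; it is then sent to [0]. *)
suff key : forall eta, 0 < eta -> V (expR (t2 / 2) * x) t2 <= f0 + eta + (G + eta) * (t2 - t1).
  apply/ler_addgt0Pl => e e0.
  have d0 : 0 < 1 + (t2 - t1) by lra.
  have := key (e / (1 + (t2 - t1))) (divr_gt0 e0 d0).
  set q := e / _ => h; have qe : q * (1 + (t2 - t1)) = e by rewrite divfK ?gt_eqF.
  rewrite -subr_ge0 -qe; move: h; rewrite -subr_ge0; congr (_ <= _); ring.
move=> eta eta0; rewrite leNgt; apply/negP => contra.
have [d [d0 hd]] : exists d, 0 < d /\ forall rho, `|rho| < d -> V (expR (t1 / 2) * (x + rho)) t1 < f0 + eta.
  have c1 : continuous (fun rho : R => V (expR (t1 / 2) * (x + rho)) t1).
    apply/continuous_subspace_setT.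
    pose g (rho : R) := (expR (t1 / 2) * (x + rho), t1).
    apply: (within_continuous_precomp (A := setT) (g := g) cV) => //.
    move=> rho; apply: (@cvg_pair _ _ _ _ (nbhs (g rho).1) (nbhs (g rho).2)); last exact: cvg_cst.
    by apply: cvgM; [exact: cvg_cst|apply: cvgD; [exact: cvg_cst|exact: cvg_id]].
  have := c1 0; rewrite /continuous_at addr0 => /cvgrPdist_lt/(_ _ eta0)/nbhs_ballP[d /= d0 hd].
  exists d; split => // rho rd.
  have := hd rho; rewrite /ball/= sub0r normrN => /(_ rd).
  rewrite -/f0 ltr_norml; lra.
(* The penalty must beat the oscillation [M] at offsets beyond [d] on the initial face, and [M] plus
   the largest possible linear term at the lateral offset [r']. The three summands secure both. *)
pose K := M / d ^+ 2 + M / r' ^+ 2 + (`|G| + eta) * (t2 - t1) / r' ^+ 2.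
have g0 : 0 <= (`|G| + eta) * (t2 - t1) by apply: mulr_ge0; [rewrite addr_ge0// ltW|lra].
have d20 : 0 < d ^+ 2 by rewrite exprn_gt0.
have r20 : 0 < r' ^+ 2 by rewrite exprn_gt0.
have q1 : 0 <= M / d ^+ 2 by apply: divr_ge0; [exact: M0|exact: ltW].
have q2 : 0 <= M / r' ^+ 2 by apply: divr_ge0; [exact: M0|exact: ltW].
have q3 : 0 <= (`|G| + eta) * (t2 - t1) / r' ^+ 2 by apply: divr_ge0; [exact: g0|exact: ltW].
have K0 : 0 <= K by rewrite /K; lra.
have Kd : M <= K * d ^+ 2 by rewrite -ler_pdivrMr// /K; lra.
have Kr : M + (`|G| + eta) * (t2 - t1) <= K * r' ^+ 2 by rewrite -ler_pdivrMr// mulrDl /K; lra.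
pose W (X tau : R) := V X tau - (G + eta) * (tau - t1) - K * (X * expR (- (tau / 2)) - x) ^+ 2.
have ee (tau : R) : expR (tau / 2) * expR (- (tau / 2)) = 1 by rewrite -expRD subrr expR0.
pose Wb p := W (Phi p).1 (Phi p).2.
have rhoE p : (Phi p).1 * expR (- ((Phi p).2 / 2)) - x = p.1.
  by rewrite /Phi/= mulrAC ee mul1r addrC addKr.
have cW : {within box, continuous Wb}.
  have -> : Wb = (fun p => ((fun p : R * R => V p.1 p.2) \o Phi) p - ((G + eta) * (p.2 - t1) + K * p.1 ^+ 2)).
    by apply/funext => p; rewrite /Wb /W rhoE/=; ring.
  move/subspace_continuousP: cv => cv; apply/subspace_continuousP => p bp.
  apply: cvgB; first exact: cv.
  apply: cvg_within_filter; apply: cvgD.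
    apply: cvgM; first exact: cvg_cst.
    by apply: cvgB; [exact: cvg_snd|exact: cvg_cst].
  by apply: cvgM; [exact: cvg_cst|apply: cvgM; exact: cvg_fst].
have [p bp hp] := compact_EVT_max box0 cbox cW.
have {}bp : box p by move: bp; rewrite inE.
have b2 : box (0, t2).
  by split => /=; rewrite in_itv/= ?lexx ?(ltW t12)// oppr_le0 (ltW r'0).
have Wp : f0 + eta < Wb p.
  apply: lt_le_trans (hp (0, t2) (mem_set b2)).
  rewrite /Wb /W rhoE /Phi/= addr0 expr0n/= mulr0 subr0; lra.
have WbE : Wb p = V (Phi p).1 (Phi p).2 - (G + eta) * (p.2 - t1) - K * p.1 ^+ 2.
  by rewrite /Wb /W rhoE.
case: (bp) => /=; rewrite !in_itv/= => /andP[pr1 pr2] /andP[pt1 pt2].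
have hG : - (G + eta) * (p.2 - t1) <= (`|G| + eta) * (t2 - t1).
  apply: (@le_trans _ _ ((`|G| + eta) * (p.2 - t1))).
    apply: ler_wpM2r; first by rewrite subr_ge0.
    have := ler_norm (- G); rewrite normrN; lra.
  apply: ler_wpM2l; last by lra.
  by rewrite addr_ge0// ltW.
have hV := Mb p bp.
(* The maximum is not on the initial face: at offsets below [d] continuity keeps [V] under
   [f0 + eta], and beyond [d] the penalty does. *)
have pt1' : t1 < p.2.
  rewrite lt_neqAle pt1 andbT; apply/eqP => pe.
  move: Wp; rewrite WbE -pe subrr mulr0 subr0 {1}/Phi/= -pe => Wp.
  have [rd|rd] := ltP `|p.1| d.
    have := hd _ rd; have : 0 <= K * p.1 ^+ 2 by rewrite mulr_ge0 ?sqr_ge0.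
    lra.
  have : M <= K * p.1 ^+ 2.
    apply: (le_trans Kd); apply: ler_wpM2l => //.
    by rewrite -[leRHS]real_normK ?num_real// ler_sqr ?nnegrE ?(ltW d0).
  have : V (expR (t1 / 2) * (x + p.1)) t1 <= f0 + M by move: hV; rewrite /Phi/= -pe.
  lra.
have prr : `|p.1| < r'.
  rewrite ltNge; apply/negP => rd.
  have : K * r' ^+ 2 <= K * p.1 ^+ 2.
    apply: ler_wpM2l => //.
    by rewrite -[leRHS]real_normK ?num_real// ler_sqr ?nnegrE ?(ltW r'0).
  move: Wp; rewrite WbE; lra.
pose X := (Phi p).1; pose tau := p.2.
have rX : X * expR (- (tau / 2)) - x = p.1 by rewrite -(rhoE p).
have [dt dX le] := pde X tau pt1' pt2 (lt_trans (eq_ind_r (fun z => `|z| < r') prr rX) r'r).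
have inbox Y s : t1 <= s -> s <= t2 -> `|Y * expR (- (s / 2)) - x| <= r' -> W Y s <= W X tau.
  move=> s1 s2 hY; pose q : R * R := (Y * expR (- (s / 2)) - x, s).
  have bq : box q.
    split => /=; rewrite in_itv/= ?s1//.
    by rewrite -ler_norml.
  have := hp q (mem_set bq); rewrite /Wb /Phi /q/= [x + _]addrC subrK mulrCA ee mulr1.
  by apply: le_trans.
have e1 : derive1 (V ^~ tau) X = 2 * K * p.1 * expR (- (tau / 2)).
  have dW : forall Y : R, derivable (V ^~ tau) Y 1 ->
     is_derive Y (1:R) (W ^~ tau) (derive1 (V ^~ tau) Y - 2 * K * (Y * expR (- (tau / 2)) - x) * expR (- (tau / 2))).
    by move=> Y dY; exact: touching_derive_space.
  pose ew := r' - `|p.1|; have ew0 : 0 < ew by rewrite subr_gt0.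
  pose w := ew * expR (tau / 2); have w0 : 0 < w by rewrite mulr_gt0// expR_gt0.
  have near_box Y : `|Y - X| < w -> `|Y * expR (- (tau / 2)) - x| < r'.
    move=> hY; have -> : Y * expR (- (tau / 2)) - x = p.1 + (Y - X) * expR (- (tau / 2)) by rewrite -rX; ring.
    apply: (le_lt_trans (ler_normD _ _)).
    rewrite normrM (gtr0_norm (expR_gt0 _)).
    have : `|Y - X| * expR (- (tau / 2)) < w * expR (- (tau / 2)) by rewrite ltr_pM2r// expR_gt0.
    by rewrite /w -mulrA ee mulr1 /ew; lra.
  have inw Y : Y \in `](X - w), (X + w)[ -> `|Y - X| < w.
    by rewrite in_itv/= ltr_norml => /andP[h1 h2]; apply/andP; split; lra.
  have := @derive1_at_max R (W ^~ tau) (X - w) (X + w) X.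
  have h1 : X - w <= X + w by lra.
  have h2 : forall t, t \in `](X - w), (X + w)[ -> derivable (W ^~ tau) t 1.
    move=> t /inw /near_box ht; have [_ dt' _] := pde t tau pt1' pt2 (lt_trans ht r'r).
    by have [] := dW t dt'.
  have h3 : X \in `](X - w), (X + w)[ by rewrite in_itv/=; apply/andP; split; lra.
  have h4 : forall t, t \in `](X - w), (X + w)[ -> W t tau <= W X tau.
    by move=> t /inw /near_box ht; apply: inbox => //; exact: ltW.
  move=> /(_ h1 h2 h3 h4) [_ D0]; have [_ D1] := dW X dX.
  by move: D0; rewrite D1 rX => /eqP; rewrite subr_eq0 => /eqP.
have e2 : 0 <= derive1 (V X) tau - (G + eta) + K * p.1 * X * expR (- (tau / 2)).
  have dW : is_derive tau (1:R) (W X) (derive1 (V X) tau - (G + eta) + K * p.1 * X * expR (- (tau / 2))).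
    by rewrite -rX; exact: touching_derive_time.
  have [dW1 dW2] := dW.
  rewrite -dW2 -derive1E.
  have [a [a1 a2]] : exists a, a < tau /\ forall s, a < s -> s < tau -> `|X * expR (- (s / 2)) - x| < r' /\ t1 < s.
    have c1 : {for tau, continuous (fun s : R => `|X * expR (- (s / 2)) - x|)}.
      apply: cvg_norm; apply: cvgB; last exact: cvg_cst.
      apply: cvgM; first exact: cvg_cst.
      apply: continuous_cvg; first exact: continuous_expR.
      by apply: cvgN; apply: cvgM; [exact: cvg_id|exact: cvg_cst].
    have : \forall s \near tau, `|X * expR (- (s / 2)) - x| < r'.
      by apply: (cvgr_lt _ c1); rewrite rX.
    move=> /nbhs_ballP[dd /= dd0 hdd].
    exists (Num.max (tau - dd) t1); split; first by rewrite gt_max pt1' ltrBlDr ltrDl dd0.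
    move=> s; rewrite gt_max => /andP[s1 s2] s3; split => //.
    apply: hdd; rewrite /ball/= ltr_norml; apply/andP; split; lra.
  apply: (derive1_left_max a1) => // s s1 s2; have [s3 s4] := a2 s s1 s2.
  by apply: inbox; [exact: ltW|apply: ltW; exact: lt_le_trans s2 pt2|exact: ltW].
(* The penalty is constant along characteristics, so its contributions cancel and the two contact
   conditions give [G + eta <= G]. *)
move: le; rewrite e1; have : 2^-1 * X * (2 * K * p.1 * expR (- (tau / 2))) = K * p.1 * X * expR (- (tau / 2)) by field.
lra.
Qed.

End Comparison.

(** * Slopes, scaling laws and the Hoelder embedding *)

Section Scaling.
Variable R : realType.
Notation mu := (@lebesgue_measure R).
Implicit Types f : R -> R.

Lemma is_derive_slope f (g t0 : R) :
  (forall e, 0 < e -> exists2 d, 0 < d & forall t, `|t - t0| < d ->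
     `|f t - f t0 - g * (t - t0)| <= e * `|t - t0|) -> is_derive t0 1 f g.
Proof.
move=> hf.
have cv : (fun h => h^-1 *: ((f \o shift t0) (h *: 1) - f t0)) @ 0^' --> g.
  apply/cvgrPdist_le => e e0; have [d d0 hd] := hf e e0.
  near=> h.
  have h0 : h != 0 by near: h; exact: nbhs_dnbhs_neq.
  have hlt : `|h| < d.
    by near: h; exists d => // z; rewrite /= sub0r normrN.
  rewrite /= /GRing.scale/= mulr1.
  have := hd (h + t0); rewrite addrK => /(_ hlt) hh.
  have -> : g - h^-1 * (f (h + t0) - f t0) = - (h^-1 * (f (h + t0) - f t0 - g * h)).
    by field.
  by rewrite normrN normrM normfV mulrC ler_pdivrMr ?normr_gt0.
by apply: DeriveDef; [apply/cvg_ex; exists g|exact: (cvg_lim _ cv)].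
Unshelve. all: by end_near. Qed.

Lemma slope_of_is_derive f (g t0 e : R) : is_derive t0 1 f g -> 0 < e ->
  exists2 d, 0 < d & forall t, `|t - t0| < d -> `|f t - f t0 - g * (t - t0)| <= e * `|t - t0|.
Proof.
move=> [df dfE] e0.
have cv : (fun h => h^-1 *: ((f \o shift t0) (h *: 1) - f t0)) @ 0^' --> g.
  by rewrite -dfE; exact: df.
move/cvgrPdist_le: cv => /(_ e e0); rewrite /nbhs/= => -[d /= d0 hd].
exists d => // t ht; have [->|tt] := eqVneq t t0; first by rewrite !subrr normr0 !mulr0 subrr normr0.
have := hd (t - t0); rewrite /= sub0r normrN => /(_ ht).
rewrite subr_eq0 => /(_ tt); rewrite /GRing.scale/= mulr1 subrK.
have n0 : t - t0 != 0 by rewrite subr_eq0.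
have -> : g - (t - t0)^-1 * (f t - f t0) = - ((t - t0)^-1 * (f t - f t0 - g * (t - t0))) by field.
by rewrite normrN normrM normfV mulrC ler_pdivrMr ?normr_gt0.
Qed.

Lemma seq_continuous_eps (G : R -> R -> R) (a b x t0 : R) :
  (forall u t : nat -> R, (forall n, a <= t n <= b) -> u @ \oo --> x -> t @ \oo --> t0 ->
    (fun n => G (u n) (t n)) @ \oo --> G x t0) ->
  forall e, 0 < e -> exists2 r, 0 < r &
    forall y t, `|y - x| < r -> `|t - t0| < r -> a <= t <= b -> `|G y t - G x t0| < e.
Proof.
move=> hG e e0; apply: contrapT => nex.
have bad n : {p : R * R | [/\ `|p.1 - x| < n.+1%:R^-1, `|p.2 - t0| < n.+1%:R^-1, a <= p.2 <= b &
    e <= `|G p.1 p.2 - G x t0|]}.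
  apply: cid; apply: contrapT => h; apply: nex.
  exists n.+1%:R^-1; first by rewrite invr_gt0.
  move=> y t h1 h2 h3; rewrite ltNge; apply/negP => h4.
  by apply: h; exists (y, t).
pose p n := sval (bad n).
have hp n : [/\ `|(p n).1 - x| < n.+1%:R^-1, `|(p n).2 - t0| < n.+1%:R^-1, a <= (p n).2 <= b &
    e <= `|G (p n).1 (p n).2 - G x t0|] by exact: (svalP (bad n)).
have cv (q : nat -> R) y : (forall n, `|q n - y| < n.+1%:R^-1) -> q @ \oo --> y.
  move=> hq; apply/cvgrPdist_lt => d d0; near=> n.
  rewrite distrC; apply: (lt_trans (hq n)); near: n; exact: near_infty_natSinv_lt (PosNum d0).
have c1 : (fun n => (p n).1) @ \oo --> x by apply: cv => n; have [] := hp n.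
have c2 : (fun n => (p n).2) @ \oo --> t0 by apply: cv => n; have [] := hp n.
have := hG _ _ (fun n => let: And4 _ _ h _ := hp n in h) c1 c2.
move=> /cvgrPdist_lt/(_ e e0) [N _ hN].
have [_ _ _] := hp N; rewrite leNgt distrC => /negP; apply; exact: hN (leqnn N).
Unshelve. all: by end_near. Qed.

Lemma holder_scale H f (c k : R) : 0 < k -> holder H f ->
  holder (`|c| * H * Num.sqrt k) (fun x => c * f (k * x)).
Proof.
move=> k0 [cf f2 fH]; split.
- move=> x; apply: cvgM; first exact: cvg_cst.
  apply: continuous_cvg; first exact: cf.
  by apply: cvgM; [exact: cvg_cst|exact: cvg_id].
- have := itgZ (c ^+ 2) (itg_affine 0 (lt0r_neq0 k0) f2).
  by congr integrable; apply/funext => x /=; rewrite addr0 exprMn.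
- move=> x y; rewrite -mulrBr normrM -!mulrA ler_wpM2l//.
  rewrite -sqrtrM ?(ltW k0)//; apply: (le_trans (fH _ _)).
  by rewrite -mulrBr normrM (gtr0_norm k0).
Qed.

Lemma CA_scale H f (c k x e : R) : 0 < k -> 0 < e -> holder H f ->
  CA (fun x => c * f (k * x)) x e = c * CA f (k * x) (k * e).
Proof.
move=> k0 e0 hf; have mf := holder_measurable hf; have [_ f2 _] := hf.
have ke0 : 0 < k * e by rewrite mulr_gt0.
have i1 := itg_conv (k * x) mf f2 (measurable_Qk ke0) (itg_Qk2 ke0).
rewrite /CA (RI_affine 0 (lt0r_neq0 k0) i1) gtr0_norm//.
have i2 := itg_affine 0 (lt0r_neq0 k0) i1.
rewrite mulrA -RI_Z//; apply: eq_Rintegral => s _.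
have E : Qk e s = k * Qk (k * e) (k * s).
  rewrite /Qk.
  have -> : (k * s) ^+ 2 + (k * e) ^+ 2 = k ^+ 2 * (s ^+ 2 + e ^+ 2) by ring.
  have d0 := den_gt0 s e0; have p0 := pi_gt0 R; set d := _ + _ in d0 *.
  by move: (pi : R) p0 => p p0; field; rewrite !gt_eqF.
by rewrite addr0 mulrBr E; ring.
Qed.

Lemma CB_scale H f (c k x e : R) : 0 < k -> 0 < e -> holder H f ->
  CB (fun x => c * f (k * x)) x e = c * CB f (k * x) (k * e).
Proof.
move=> k0 e0 hf; have mf := holder_measurable hf; have [_ f2 _] := hf.
have ke0 : 0 < k * e by rewrite mulr_gt0.
have i1 := itg_conv (k * x) mf f2 (measurable_Pk ke0) (itg_Pk2 ke0).
rewrite /CB (RI_affine 0 (lt0r_neq0 k0) i1) gtr0_norm//.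
have i2 := itg_affine 0 (lt0r_neq0 k0) i1.
rewrite mulrN mulrA -RI_Z//; congr (- _); apply: eq_Rintegral => s _.
have E : Pk e s = k * Pk (k * e) (k * s).
  rewrite /Pk.
  have -> : (k * s) ^+ 2 + (k * e) ^+ 2 = k ^+ 2 * (s ^+ 2 + e ^+ 2) by ring.
  have d0 := den_gt0 s e0; have p0 := pi_gt0 R; set d := _ + _ in d0 *.
  by move: (pi : R) p0 => p p0; field; rewrite !gt_eqF.
by rewrite addr0 mulrBr E; ring.
Qed.

(** Both sides are compared with Cauchy integrals at matching heights, for which the scaling is an
    exact change of variables. *)
Lemma hilbert_scale H f (c k x : R) : 0 < k -> holder H f ->
  hilbert (fun x => c * f (k * x)) x = c * hilbert f (k * x).
Proof.
move=> k0 hf; apply/eqP; rewrite -subr_eq0; apply/eqP.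
apply: (@eq0_of_sqrt_bound _ _ (`|c| * H * Num.sqrt k * vk_mass R + `|c| * (H * (Num.sqrt k * vk_mass R))) 0) => d d0.
have h1 := CA_hilbert x (holder_scale c k0 hf) d0.
have h2 := CA_hilbert (k * x) hf (mulr_gt0 k0 d0).
rewrite (CA_scale c x k0 d0 hf) in h1; rewrite (sqrtrM d (ltW k0)) in h2.
set u := hilbert _ x in h1 *; set v := hilbert f _ in h2 *; set z := CA f _ _ in h1 h2.
have -> : u - c * v = - (c * z - u) + c * (z - v) by ring.
apply: (le_trans (ler_normD _ _)); rewrite normrN normrM mul0r addr0 mulrDl; apply: lerD.
  by apply: (le_trans h1); rewrite le_eqVlt; apply/orP; left; apply/eqP; ring.
apply: (@le_trans _ _ (`|c| * (H * (Num.sqrt k * Num.sqrt d * vk_mass R)))); first by rewrite ler_wpM2l.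
by rewrite le_eqVlt; apply/orP; left; apply/eqP; ring.
Qed.

(** The increment of [f] is the integral of its derivative against an indicator. Young's inequality
    with weight [sqrt (y - x)] balances the two terms and produces the exponent [1/2]. *)
Lemma H1_holder f : smooth f -> H1 f -> exists H, holder H f.
Proof.
move=> sf [[mf f2] [mf' f2']].
have df x : derivable f x 1 := sf 0 x.
have cf : continuous f by move=> x; apply/differentiable_continuous/derivable1_diffP.
have cf' : continuous (derive1 f).
  by move=> x; apply/differentiable_continuous/derivable1_diffP; exact: (sf 1).
pose D := RI (fun x => derive1 f x ^+ 2).
have D0 : 0 <= D by apply: RI_ge0 => x; exact: sqr_ge0.
exists ((D + 1) / 2); split => //.
suff main x y : x < y -> `|f x - f y| <= (D + 1) / 2 * Num.sqrt `|x - y|.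
  move=> x y; have [xy|xy|->] := ltgtP x y; first exact: main.
    by rewrite distrC [`|x - y|]distrC; exact: main.
  by rewrite !subrr normr0 sqrtr0 mulr0.
move=> xy.
pose I := [set` `[x, y]] : set R.
have mI : measurable I by exact: measurable_itv.
pose g := (\1_I : R -> R).
have mg : measurable_fun setT g by exact: measurable_indic.
have gE s : g s ^+ 2 = g s by rewrite /g indicE; case: (s \in I); rewrite ?expr1n ?expr0n.
have ig : itg g by exact: integrable_indic_itv.
have g2 : itg (fun s => g s ^+ 2) by move: ig; congr integrable; apply/funext => s /=; rewrite gE.
have Ig : RI (fun s => g s ^+ 2) = y - x.
  have -> : (fun s => g s ^+ 2) = g by apply/funext => s; rewrite gE.
  have ml : (mu I = (y - x)%:E)%E by rewrite lebesgue_measure_itv/= lte_fin xy.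
  transitivity (fine (mu I)); last by rewrite ml.
  rewrite /Rintegral integral_indic//; congr (fine (mu _)); exact: setIT.
have FTC : (\int[mu]_(s in I) (derive1 f s)%:E = (f y)%:E - (f x)%:E)%E.
  apply: continuous_FTC2; [exact: xy|exact: continuous_subspaceT| |by []].
  split => [z _||]; first exact: df.
    by apply: cvg_at_right_filter; exact: cf.
  by apply: cvg_at_left_filter; exact: cf.
have fE : f y - f x = RI (fun s => derive1 f s * g s).
  apply: EFin_inj; rewrite EFin_RI; last exact: itg_mul.
  rewrite EFinB -FTC integral_mkcond; apply: eq_integral => s _.
  by rewrite patchE /g indicE; case: ifP => _; rewrite ?mulr1 ?mulr0.
have xy0 : 0 <= y - x by rewrite subr_ge0 ltW.
rewrite distrC fE [`|x - y|]distrC (ger0_norm xy0).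
have q0 : 0 < Num.sqrt (y - x) by rewrite sqrtr_gt0 subr_gt0.
have qE : y - x = Num.sqrt (y - x) ^+ 2 by rewrite sqr_sqrtr// subr_ge0 ltW.
apply: (@le_trans _ _ (RI (fun s => `|derive1 f s * g s|))).
  by apply: le_normr_Rintegral => //; exact: itg_mul.
have := RI_amgm q0 mf' mg f2' g2; rewrite Ig -/D => /le_trans; apply.
set q := Num.sqrt _ in q0 qE *; rewrite qE.
rewrite le_eqVlt; apply/orP; left; apply/eqP; field; exact: lt0r_neq0.
Qed.

End Scaling.

(** * The evolution on intervals of uniform regularity *)

Section Flow.
Variable R : realType.
Notation mu := (@lebesgue_measure R).

Lemma is_derive_expRM (c t : R) : is_derive t 1 (fun u => expR (c * u)) (c * expR (c * t)).
Proof.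
have h : is_derive t 1 (fun u : R => c * u) c.
  have -> : (fun u : R => c * u) = c *: (id : R -> R) by apply/funext => u.
  by apply: is_derive_eq; rewrite /GRing.scale/= mulr1.
have := @is_derive1_comp _ expR (fun u : R => c * u) t _ _ (is_derive_expR _) h.
by move=> H; apply: (is_derive_eq H); rewrite mulrC.
Qed.

Lemma is_derive_mul_exp (phi : R -> R) (c t l : R) : is_derive t 1 phi l ->
  is_derive t 1 (fun u => phi u * expR (c * u)) ((l + c * phi t) * expR (c * t)).
Proof.
move=> h; have he := is_derive_expRM c t.
have -> : (fun u => phi u * expR (c * u)) = phi * (fun u => expR (c * u)) by [].
by apply: is_derive_eq; rewrite /GRing.scale/=; ring.
Qed.

(** The bound is on the size of the derivative, so the comparison runs both forward and backward in
    time. It serves for the growth of [w] and for the uniqueness behind the Moebius formula. *)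
Lemma gronwall (phi : R -> R) (a b m : R) :
  (forall t, a < t < b -> exists2 l, is_derive t 1 phi l & `|l| <= m * phi t) ->
  forall t t1, a < t < b -> a < t1 < b -> phi t <= expR (m * `|t - t1|) * phi t1.
Proof.
move=> H t t1 tab t1ab.
have [tt1|tt1] := leP t1 t.
  pose g u := phi u * expR (- m * u).
  have dg u : u \in `]a, b[ -> exists2 l, is_derive u 1 g l & l <= 0.
    rewrite in_itv/= => /H [l dl hl]; eexists; first exact: is_derive_mul_exp dl.
    by apply: mulr_le0_ge0; [move: (ler_norm l); lra|exact: expR_ge0].
  have := @ler0_derive1_le_oo _ g a b.
  have h1 : forall x, x \in `]a, b[ -> derivable g x 1 by move=> x /dg [l []].
  have h2 : forall x, x \in `]a, b[ -> derive1 g x <= 0.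
    by move=> x /dg [l [_ <-]]; rewrite derive1E.
  have h3 : {in `]a, b[%classic, continuous g}.
    by move=> x; rewrite inE => /h1 hx; apply/differentiable_continuous/derivable1_diffP.
  move=> /(_ h1 h2 h3 t t1); rewrite !in_itv/= tab t1ab => /(_ isT isT tt1).
  rewrite /g ger0_norm ?subr_ge0// => h.
  have -> : m * (t - t1) = - m * t1 + m * t by ring.
  rewrite expRD mulrAC [_ * phi t1]mulrC.
  apply: (@le_trans _ _ (phi t * expR (- m * t) * expR (m * t))).
    by rewrite -mulrA -expRD mulNr addNr expR0 mulr1.
  by apply: ler_wpM2r => //; exact: expR_ge0.
pose g u := phi u * expR (m * u).
have dg u : u \in `]a, b[ -> exists2 l, is_derive u 1 g l & 0 <= l.
  rewrite in_itv/= => /H [l dl hl]; eexists; first exact: is_derive_mul_exp dl.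
  by apply: mulr_ge0; [move: (ler_norm (- l)); rewrite normrN; lra|exact: expR_ge0].
have := @ger0_derive1_le_oo _ g a b.
have h1 : forall x, x \in `]a, b[ -> derivable g x 1 by move=> x /dg [l []].
have h2 : forall x, x \in `]a, b[ -> 0 <= derive1 g x.
  by move=> x /dg [l [_ <-]]; rewrite derive1E.
have h3 : {in `]a, b[%classic, continuous g}.
  by move=> x; rewrite inE => /h1 hx; apply/differentiable_continuous/derivable1_diffP.
move=> /(_ h1 h2 h3 t t1); rewrite !in_itv/= tab t1ab => /(_ isT isT (ltW tt1)).
rewrite /g distrC ger0_norm ?subr_ge0 ?(ltW tt1)// => h.
have -> : m * (t1 - t) = m * t1 + - m * t by ring.
rewrite expRD mulrAC [_ * phi t1]mulrC.
apply: (@le_trans _ _ (phi t * expR (m * t) * expR (- m * t))).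
  by rewrite -mulrA -expRD mulNr addrN expR0 mulr1.
by apply: ler_wpM2r => //; exact: expR_ge0.
Qed.

Variable w : R -> R -> R.
Notation h := (fun x t => hilbert (w ^~ t) x).
Hypothesis hold : forall t : R, 0 <= t -> exists H, holder H (w ^~ t).
Hypothesis cw : forall (u s : nat -> R) (x t : R), (forall n, 0 <= s n) -> 0 <= t ->
  u @ \oo --> x -> s @ \oo --> t -> (fun n => w (u n) (s n)) @ \oo --> w x t.
(* The transport equation has separate derivatives only, and becomes an ODE in time at fixed [x] once
   the Hilbert transform is known to be jointly continuous. *)
Hypothesis evol : forall a b : R, 0 <= a -> a < b ->
  (forall (u s : nat -> R) (x t : R), a <= t <= b -> (forall n, a <= s n <= b) ->
     u @ \oo --> x -> s @ \oo --> t -> (fun n => h (u n) (s n)) @ \oo --> h x t) ->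
  forall x t : R, a < t < b -> is_derive t 1 (w x) (expR (- t) * h x t * w x t).

Notation A := (fun x e t => CA (w ^~ t) x e).
Notation B := (fun x e t => CB (w ^~ t) x e).
Notation E2 := (fun t => RI (fun y => w y t ^+ 2)).

(* Every time is regular for some [m] and each class is closed in time; on an interval of uniformly
   regular times, [hilbert (w ^~ t) x] is jointly continuous. *)
Definition regular (m t : R) := [/\ 0 <= t, E2 t <= m,
  forall x e, 0 < e <= 1 -> `|A x e t| <= m /\ `|B x e t| <= m &
  forall x e e', 0 < e' -> e' <= e -> e <= 1 ->
    `|A x e t - A x e' t| <= m * Num.sqrt e /\ `|B x e t - B x e' t| <= m * Num.sqrt e].

Lemma regular_mono (m m' t : R) : m <= m' -> regular m t -> regular m' t.
Proof.
move=> mm' [t0 h1 h2 h3]; split => //; first exact: le_trans mm'.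
- by move=> x e /(h2 x)[g1 g2]; split; [exact: le_trans mm'|exact: le_trans mm'].
- move=> x e e' e0 ee' e1; have [g1 g2] := h3 x e e' e0 ee' e1.
  by split; [apply: (le_trans g1)|apply: (le_trans g2)]; rewrite ler_wpM2r ?sqrtr_ge0.
Qed.

Lemma holder_E2 t : 0 <= t -> itg (fun y => w y t ^+ 2).
Proof. by move=> /hold[H []]. Qed.

Lemma measurable_w t : 0 <= t -> measurable_fun setT (w ^~ t).
Proof. by move=> /hold[H]; exact: holder_measurable. Qed.

Lemma CB_diff H (f : R -> R) (x e e' : R) : holder H f -> 0 < e' -> e' <= e ->
  `|CB f x e - CB f x e'| <= 2 * (H * (Num.sqrt e * vk_mass R)).
Proof.
move=> hf e'0 ee'; have e0 := lt_le_trans e'0 ee'.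
have h1 := CB_bound x hf e0; have h2 := CB_bound x hf e'0.
have H0 := holder_ge0 hf; have v0 := vk_mass_ge0 R.
have h3 : H * (Num.sqrt e' * vk_mass R) <= H * (Num.sqrt e * vk_mass R).
  by apply: ler_wpM2l => //; apply: ler_wpM2r => //; rewrite ler_wsqrtr.
have -> : CB f x e - CB f x e' = (CB f x e + f x) - (CB f x e' + f x) by ring.
apply: (le_trans (ler_normB _ _)); rewrite mulr2n mulrDl mul1r.
by apply: lerD => //; exact: le_trans h3.
Qed.

(** Height [1] is controlled by the L^2 norm and every smaller height by the Hoelder modulus. An
    integer bound is produced so that countably many classes cover all times. *)
Lemma regular_exists t : 0 <= t -> exists m : nat, regular m%:R t.
Proof.
move=> t0; have [H hf] := hold t0; have [_ f2 _] := hf; have mf := holder_measurable hf.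
have H0 := holder_ge0 hf; have v0 := vk_mass_ge0 R.
pose c := 2 * (H * vk_mass R); have c0 : 0 <= c by rewrite /c !mulr_ge0.
have [E2q E2p] : itg (fun s => Qk (1:R) s ^+ 2) /\ itg (fun s => Pk (1:R) s ^+ 2).
  by split; [exact: itg_Qk2|exact: itg_Pk2].
have opaque (k : R -> R) : exists2 v, 0 <= v & RI (fun s => k s ^+ 2) = v.
  by eexists; last reflexivity; apply: RI_ge0 => y; exact: sqr_ge0.
have [e2 e20 e2E] := opaque (w ^~ t); have [q2 q20 q2E] := opaque (Qk 1).
have [p2 p20 p2E] := opaque (Pk 1).
pose D := (e2 + q2) / 2 + (e2 + p2) / 2.
have A1 x : `|A x 1 t| <= (e2 + q2) / 2.
  rewrite -e2E -q2E; apply: le_trans (conv_bound x mf f2 (measurable_Qk (@ltr01 R)) E2q).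
  apply: le_normr_Rintegral; first exact: measurableT.
  exact: (itg_conv x mf f2 (measurable_Qk (@ltr01 R)) E2q).
have B1 x : `|B x 1 t| <= (e2 + p2) / 2.
  rewrite -e2E -p2E /CB normrN; apply: le_trans (conv_bound x mf f2 (measurable_Pk (@ltr01 R)) E2p).
  apply: le_normr_Rintegral; first exact: measurableT.
  exact: (itg_conv x mf f2 (measurable_Pk (@ltr01 R)) E2p).
have dA x e e' : 0 < e' -> e' <= e -> `|A x e t - A x e' t| <= c * Num.sqrt e.
  move=> e'0 ee'; apply: (le_trans (CA_diff x hf e'0 ee')).
  have : 0 <= H * (Num.sqrt e * vk_mass R) by rewrite !mulr_ge0// sqrtr_ge0.
  by rewrite /c; lra.
have dB x e e' : 0 < e' -> e' <= e -> `|B x e t - B x e' t| <= c * Num.sqrt e.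
  move=> e'0 ee'; apply: (le_trans (CB_diff x hf e'0 ee')).
  by rewrite le_eqVlt; apply/orP; left; apply/eqP; rewrite /c; ring.
have [m hm] : exists m : nat, c + e2 + D <= m%:R.
  have pos : 0 <= c + e2 + D by rewrite /D; clear - c0 e20 q20 p20; lra.
  by exists (Num.bound (c + e2 + D)); apply/ltW/archi_boundP.
have hD1 : c + (e2 + q2) / 2 <= m%:R by apply: le_trans hm; rewrite /D; clear - c0 e20 q20 p20; lra.
have hD2 : c + (e2 + p2) / 2 <= m%:R by apply: le_trans hm; rewrite /D; clear - c0 e20 q20 p20; lra.
exists m; split => //.
- by rewrite e2E; apply: le_trans hm; rewrite /D; clear - c0 e20 q20 p20; lra.
- move=> x e /andP[e0 e1].
  have s1 : c * Num.sqrt 1 = c by rewrite sqrtr1 mulr1.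
  have h1 := dA x 1 e e0 e1; have h2 := dB x 1 e e0 e1; rewrite s1 in h1 h2.
  split.
    have -> : A x e t = A x 1 t - (A x 1 t - A x e t) by ring.
    by apply: (le_trans (ler_normB _ _)); apply: le_trans hD1; rewrite addrC lerD.
  have -> : B x e t = B x 1 t - (B x 1 t - B x e t) by ring.
  by apply: (le_trans (ler_normB _ _)); apply: le_trans hD2; rewrite addrC lerD.
- move=> x e e' e'0 ee' e1.
  have cm : c <= m%:R by apply: le_trans hD1; clear - e20 q20; lra.
  by split; [apply: (le_trans (dA x e e' e'0 ee'))|apply: (le_trans (dB x e e' e'0 ee'))];
    rewrite ler_wpM2r ?sqrtr_ge0.
Qed.

(** A uniform L^2 bound along the times [s n], with pointwise convergence of [w], gives weak
    convergence. *)
Lemma conv_time_cvg (k : R -> R) (u s : nat -> R) (x t m : R) :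
  measurable_fun setT k -> itg (fun y => k y ^+ 2) ->
  (forall n, 0 <= s n) -> 0 <= t -> (forall n, E2 (s n) <= m) ->
  u @ \oo --> x -> s @ \oo --> t ->
  (fun n => RI (fun y => w (u n - y) (s n) * k y)) @ \oo --> RI (fun y => w (x - y) t * k y).
Proof.
move=> mk k2 s0 t0 sm ux st; apply: (RI_weak_cvg (C := m)) => //.
- by move=> n; exact: (measurable_shift (u n) (measurable_w (s0 n))).
- by move=> n; exact: (itg_shift (u n) (holder_E2 (s0 n))).
- by move=> n; rewrite (RI_shift (u n) (holder_E2 (s0 n))); exact: sm.
- by move=> y; apply: cw => //; apply: cvgB => //; exact: cvg_cst.
Qed.

Lemma CA_time_cvg (u s : nat -> R) (x t m e : R) : 0 < e ->
  (forall n, 0 <= s n) -> 0 <= t -> (forall n, E2 (s n) <= m) ->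
  u @ \oo --> x -> s @ \oo --> t -> (fun n => A (u n) e (s n)) @ \oo --> A x e t.
Proof.
move=> e0 s0 t0 sm ux st; apply: (conv_time_cvg (measurable_Qk e0) (itg_Qk2 e0) s0 t0 sm ux st).
Qed.

Lemma CB_time_cvg (u s : nat -> R) (x t m e : R) : 0 < e ->
  (forall n, 0 <= s n) -> 0 <= t -> (forall n, E2 (s n) <= m) ->
  u @ \oo --> x -> s @ \oo --> t -> (fun n => B (u n) e (s n)) @ \oo --> B x e t.
Proof.
move=> e0 s0 t0 sm ux st; apply: cvgN.
exact: (conv_time_cvg (measurable_Pk e0) (itg_Pk2 e0) s0 t0 sm ux st).
Qed.

Lemma cvg_norm_le (u : nat -> R) (l c : R) : u @ \oo --> l -> (forall n, `|u n| <= c) -> `|l| <= c.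
Proof.
move=> /cvg_norm ul uc; rewrite -(cvg_lim _ ul)//; apply: limr_le.
  by apply/cvg_ex; exists `|l|.
by apply: nearW => n; exact: uc.
Qed.

(** The L^2 clause passes to the limit by Fatou's lemma. The others concern positive heights only,
    where [CA] and [CB] are pairings with square integrable kernels and follow the weak limit. *)
Lemma regular_closed (s : nat -> R) (t m : R) : s @ \oo --> t -> (forall n, regular m (s n)) -> regular m t.
Proof.
move=> st rs.
have s0 n : 0 <= s n by have [] := rs n.
have sm n : E2 (s n) <= m by have [] := rs n.
have t0 : 0 <= t.
  rewrite -(cvg_lim _ st)//; apply: limr_ge; first by apply/cvg_ex; exists t.
  exact: nearW.
have cst_cvg (y : R) : (fun _ : nat => y) @ \oo --> y by exact: cvg_cst.
have cA x e : 0 < e -> (fun n => A x e (s n)) @ \oo --> A x e t.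
  by move=> e0; exact: (CA_time_cvg (u := fun=> x) e0 s0 t0 sm (cst_cvg x) st).
have cB x e : 0 < e -> (fun n => B x e (s n)) @ \oo --> B x e t.
  by move=> e0; exact: (CB_time_cvg (u := fun=> x) e0 s0 t0 sm (cst_cvg x) st).
split => //.
- have [] // := @RI_fatou R (fun n y => w y (s n) ^+ 2) (fun y => w y t ^+ 2) m.
  + by move=> n; exact: holder_E2.
  + by move=> n y; exact: sqr_ge0.
  + move=> y; have cy := cw (u := fun=> y) s0 t0 (cst_cvg y) st.
    exact: (cvgM cy cy).
- move=> x e /andP[e0 e1]; split.
    by apply: (cvg_norm_le (cA x e e0)) => n; have [_ _ h1 _] := rs n; have [] := h1 x e; rewrite ?e0.
  by apply: (cvg_norm_le (cB x e e0)) => n; have [_ _ h1 _] := rs n; have [] := h1 x e; rewrite ?e0.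
- move=> x e e' e'0 ee' e1; have e0 := lt_le_trans e'0 ee'; split.
    by apply: (cvg_norm_le (cvgB (cA x e e0) (cA x e' e'0))) => n; have [_ _ _ h1] := rs n; have [] := h1 x e e' e'0 ee' e1.
  by apply: (cvg_norm_le (cvgB (cB x e e0) (cB x e' e'0))) => n; have [_ _ _ h1] := rs n; have [] := h1 x e e' e'0 ee' e1.
Qed.

Lemma at_right0_norm_le (f : R -> R) (l c : R) : f @ 0^'+ --> l ->
  (\forall e \near 0^'+, `|f e| <= c) -> `|l| <= c.
Proof.
move=> /cvg_norm fl fc; rewrite -(cvg_lim _ fl)//; apply: limr_le => //.
by apply/cvg_ex; exists `|l|.
Qed.

Lemma regular_boundary (m t x : R) : regular m t ->
  [/\ `|h x t| <= m, `|w x t| <= m,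
   forall e, 0 < e <= 1 -> `|A x e t - h x t| <= m * Num.sqrt e &
   forall e, 0 < e <= 1 -> `|B x e t + w x t| <= m * Num.sqrt e].
Proof.
move=> [t0 _ hb hd]; have [H hf] := hold t0.
have cA := CA_cvg (x := x) hf; have cB := CB_cvg (x := x) hf.
have near01 (e : R) : 0 < e -> \forall d \near (0:R)^'+, 0 < d /\ d <= e.
  by move=> e0; near=> d; split; [near: d; exact: nbhs_right_gt|near: d; exact: nbhs_right_le].
split.
- apply: (at_right0_norm_le cA); apply: filterS (near01 1 ltr01) => e [e0 e1].
  by have [] := hb x e; rewrite ?e0.
- rewrite -normrN; apply: (at_right0_norm_le cB); apply: filterS (near01 1 ltr01) => e [e0 e1].
  by have [] := hb x e; rewrite ?e0.
- move=> e /andP[e0 e1]; apply: (@at_right0_norm_le (fun d => A x e t - A x d t)).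
    by apply: cvgB; [exact: cvg_cst|exact: cA].
  by apply: filterS (near01 e e0) => d [d0 de]; have [] := hd x e d d0 de e1.
- move=> e /andP[e0 e1]; rewrite -[w x t]opprK.
  apply: (@at_right0_norm_le (fun d => B x e t - B x d t)).
    by apply: cvgB; [exact: cvg_cst|exact: cB].
  by apply: filterS (near01 e e0) => d [d0 de]; have [] := hd x e d d0 de e1.
Unshelve. all: by end_near. Qed.

(** The Cauchy integral approximates [hilbert] at rate [m * sqrt e] uniformly in space and over the
    class, and at a fixed height it is continuous in space and time. *)
Lemma regular_hilbert_cvg (m : R) (u s : nat -> R) (x t : R) :
  regular m t -> (forall n, regular m (s n)) -> u @ \oo --> x -> s @ \oo --> t ->
  (fun n => h (u n) (s n)) @ \oo --> h x t.
Proof.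
move=> rt rs ux st.
have s0 n : 0 <= s n by have [] := rs n.
have sm n : E2 (s n) <= m by have [] := rs n.
have t0 : 0 <= t by have [] := rt.
have m0 : 0 <= m by have [_ h1 _ _] := rt; apply: le_trans h1; apply: RI_ge0 => y; exact: sqr_ge0.
apply/cvgrPdist_lt => d d0.
(* This height makes [m * sqrt e] at most [d / 4]; the cap [1] is the range of heights covered by
   [regular]. *)
pose e := Num.min 1 ((d / (4 * (m + 1))) ^+ 2).
have dm : 0 < d / (4 * (m + 1)) by rewrite divr_gt0//; lra.
have e0 : 0 < e by rewrite lt_min ltr01 exprn_gt0.
have e1 : e <= 1 by rewrite ge_min lexx.
have me : m * Num.sqrt e <= d / 4.
  apply: (@le_trans _ _ (m * (d / (4 * (m + 1))))).
    apply: ler_wpM2l => //; apply: (@le_trans _ _ (Num.sqrt ((d / (4 * (m + 1))) ^+ 2))).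
      by rewrite ler_wsqrtr// ge_min lexx orbT.
    by rewrite sqrtr_sqr gtr0_norm.
  rewrite mulrA ler_pdivrMr; last by lra.
  have : 0 <= m * d by rewrite mulr_ge0// ltW.
  lra.
have e01 : 0 < e <= 1 by rewrite e0 e1.
have := CA_time_cvg e0 s0 t0 sm ux st.
move=> /cvgrPdist_lt/(_ (d / 4)); have d4 : 0 < d / 4 by lra.
move=> /(_ d4); apply: filterS => n hn.
have [_ _ h1 _] := regular_boundary x rt; have [_ _ h2 _] := regular_boundary (u n) (rs n).
have {}h1 := h1 e e01; have {}h2 := h2 e e01.
move: (h x t) (h (u n) (s n)) (A x e t) (A (u n) e (s n)) h1 h2 hn => h1 h2 a1 a2 hh1 hh2 hn.
clear - hh1 hh2 hn me d0.
have -> : h1 - h2 = - (a1 - h1) + ((a1 - a2) + (a2 - h2)) by ring.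
apply: (le_lt_trans (ler_normD _ _)); rewrite normrN.
have := ler_normD (a1 - a2) (a2 - h2); lra.
Qed.

End Flow.

(** * Algebra of the Moebius relation *)

Section Moebius.
Variable R : realType.
Implicit Types a b s : R.

(* The real and imaginary parts of [F (2 - s F1) = 2 F1], with [F = a + i b] and [F1 = a1 + i b1]. *)
Definition moebius s a1 b1 a b : Prop :=
  a * (2 - s * a1) + s * b * b1 = 2 * a1 /\ b * (2 - s * a1) - s * a * b1 = 2 * b1.

(** The squared modulus of [2 - s F1]. *)
Definition mden s a1 b1 : R := (2 - s * a1) ^+ 2 + (s * b1) ^+ 2.

(** For nonzero [F] and [F1] the relation reads [1/F1 - 1/F = s/2], so exchanging the two times
    changes the sign of [s]. *)
Lemma moebius_sym s a1 b1 a b : moebius s a1 b1 a b -> moebius (- s) a b a1 b1.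
Proof. by move=> [h1 h2]; split; lra. Qed.

Lemma moebius_im s a1 b1 a b : moebius s a1 b1 a b -> b * mden s a1 b1 = 4 * b1.
Proof.
move=> [h1 h2]; rewrite /mden.
have -> : b * ((2 - s * a1) ^+ 2 + (s * b1) ^+ 2) =
  (b * (2 - s * a1) - s * a * b1) * (2 - s * a1) + (a * (2 - s * a1) + s * b * b1) * (s * b1) by ring.
by rewrite h1 h2; ring.
Qed.

Lemma moebius_re s a1 b1 a b : moebius s a1 b1 a b ->
  a * mden s a1 b1 = 2 * (a1 * (2 - s * a1) - s * b1 ^+ 2).
Proof.
move=> [h1 h2]; rewrite /mden.
have -> : a * ((2 - s * a1) ^+ 2 + (s * b1) ^+ 2) =
  (a * (2 - s * a1) + s * b * b1) * (2 - s * a1) - (b * (2 - s * a1) - s * a * b1) * (s * b1) by ring.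
by rewrite h1 h2; ring.
Qed.

Lemma moebius_sqr s a1 b1 a b : moebius s a1 b1 a b ->
  (a ^+ 2 + b ^+ 2) * mden s a1 b1 = 4 * (a1 ^+ 2 + b1 ^+ 2).
Proof.
move=> [h1 h2]; rewrite /mden.
have -> : (a ^+ 2 + b ^+ 2) * ((2 - s * a1) ^+ 2 + (s * b1) ^+ 2) =
  (a * (2 - s * a1) + s * b * b1) ^+ 2 + (b * (2 - s * a1) - s * a * b1) ^+ 2 by ring.
by rewrite h1 h2; ring.
Qed.

(** The modulus of [F - F' = 4 (F1 - F1') / ((2 - s F1) (2 - s F1'))]. It transports a modulus of
    continuity in the height from one time to another. *)
Lemma moebius_diff s a1 b1 a b a1' b1' a' b' :
  moebius s a1 b1 a b -> moebius s a1' b1' a' b' ->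
  ((a - a') ^+ 2 + (b - b') ^+ 2) * mden s a1 b1 * mden s a1' b1' =
    16 * ((a1 - a1') ^+ 2 + (b1 - b1') ^+ 2).
Proof.
move=> [h1 h2] [h1' h2']; rewrite /mden.
set X := a * (2 - s * a1) + s * b * b1 in h1; set Y := b * (2 - s * a1) - s * a * b1 in h2.
set X' := a' * (2 - s * a1') + s * b' * b1' in h1'; set Y' := b' * (2 - s * a1') - s * a' * b1' in h2'.
have -> : ((a - a') ^+ 2 + (b - b') ^+ 2) * ((2 - s * a1) ^+ 2 + (s * b1) ^+ 2) * ((2 - s * a1') ^+ 2 + (s * b1') ^+ 2)
  = (X * (2 - s * a1') + Y * (s * b1') - X' * (2 - s * a1) - Y' * (s * b1)) ^+ 2
  + (Y * (2 - s * a1') - X * (s * b1') - Y' * (2 - s * a1) + X' * (s * b1)) ^+ 2.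
  by rewrite /X /Y /X' /Y'; ring.
by rewrite h1 h2 h1' h2'; ring.
Qed.

Lemma mden_ge1 s a1 b1 : `|s * a1| <= 1 -> 1 <= mden s a1 b1.
Proof.
rewrite ler_norml /mden => /andP[h1 h2].
have : 1 <= (2 - s * a1) ^+ 2 by rewrite expr2; nra.
by have := sqr_ge0 (s * b1); lra.
Qed.

(** If [2 - s F1] were zero, the relation would force [F1 = 0], and then [2 - s F1 = 2]. *)
Lemma mden_gt0 s a1 b1 a b : moebius s a1 b1 a b -> 0 < mden s a1 b1.
Proof.
move=> [h1 h2]; rewrite lt_neqAle addr_ge0 ?sqr_ge0// andbT eq_sym.
apply/eqP => /eqP; rewrite /mden paddr_eq0 ?sqr_ge0// !sqrf_eq0 => /andP[/eqP z1 /eqP z2].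
have z3 : s * b * b1 = 0 by rewrite mulrAC z2 mul0r.
have : a1 = 0 by move: h1; rewrite z1 z3; lra.
by move=> a10; move: z1; rewrite a10; lra.
Qed.

Lemma moebius_im_le s a1 b1 a b : moebius s a1 b1 a b -> `|s * a1| <= 1 -> `|b| <= 4 * `|b1|.
Proof.
move=> /moebius_im h /(@mden_ge1 _ _ b1) d1.
have -> : 4 * `|b1| = `|b| * mden s a1 b1.
  by rewrite -[X in X * `|b1|](@ger0_norm R 4)// -normrM -h normrM (@ger0_norm _ (mden _ _ _))//; lra.
by rewrite ler_peMr.
Qed.

Lemma cvg_eq (u v : nat -> R) (l l' : R) : u @ \oo --> l -> v @ \oo --> l' ->
  (forall n, u n = v n) -> l = l'.
Proof.
move=> ul vl uv; have e : u = v by apply/funext.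
by rewrite -(cvg_lim _ ul)// -(cvg_lim _ vl)// e.
Qed.

Lemma moebius_cvg (s a1 b1 a b : nat -> R) (s' a1' b1' a' b' : R) :
  s @ \oo --> s' -> a1 @ \oo --> a1' -> b1 @ \oo --> b1' -> a @ \oo --> a' -> b @ \oo --> b' ->
  (forall n, moebius (s n) (a1 n) (b1 n) (a n) (b n)) -> moebius s' a1' b1' a' b'.
Proof.
move=> cs ca1 cb1 ca cb H.
have c2 : (fun n => 2 - s n * a1 n) @ \oo --> 2 - s' * a1'.
  by apply: cvgB; [exact: cvg_cst|exact: cvgM].
have cm (c : R) (u : nat -> R) (l : R) : u @ \oo --> l -> (fun n => c * u n) @ \oo --> c * l.
  by move=> ul; apply: cvgM => //; exact: cvg_cst.
split.
  have c1 : (fun n => a n * (2 - s n * a1 n) + s n * b n * b1 n) @ \oo -->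
      a' * (2 - s' * a1') + s' * b' * b1'.
    by apply: cvgD; [exact: cvgM|apply: cvgM => //; exact: cvgM].
  by apply: (cvg_eq c1 (cm 2 _ _ ca1)) => n; have [h _] := H n.
have c1 : (fun n => b n * (2 - s n * a1 n) - s n * a n * b1 n) @ \oo -->
    b' * (2 - s' * a1') - s' * a' * b1'.
  by apply: cvgB; [exact: cvgM|apply: cvgM => //; exact: cvgM].
by apply: (cvg_eq c1 (cm 2 _ _ cb1)) => n; have [_ h] := H n.
Qed.

Lemma expRN_diff (p t : R) : 0 <= p -> 0 <= t -> `|expR (- p) - expR (- t)| <= `|p - t|.
Proof.
wlog pt : p t / p <= t.
  move=> H p0 t0; have [pt|/ltW tp] := leP p t; first exact: H.
  by rewrite distrC [`|p - t|]distrC; exact: H.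
move=> p0 t0.
have h1 : expR (- t) <= expR (- p) by rewrite ler_expR lerN2.
have e1 : expR (- p) <= 1 by rewrite -expR0 ler_expR oppr_le0.
rewrite ger0_norm ?subr_ge0// distrC ger0_norm ?subr_ge0//.
have -> : expR (- t) = expR (- p) * expR (- (t - p)) by rewrite -expRD; congr expR; ring.
have h2 := expR_ge1Dx (- (t - p)).
have ep := expR_ge0 (- p).
set u := expR (- p) in e1 ep *; set v := expR _ in h2 *.
have h3 : 0 <= u * (v - (1 + - (t - p))) by rewrite mulr_ge0// subr_ge0.
have h4 : 0 <= (1 - u) * (t - p) by rewrite mulr_ge0 ?subr_ge0.
lra.
Qed.

End Moebius.

Section FlowRegular.
Variable R : realType.
Notation mu := (@lebesgue_measure R).
Variable w : R -> R -> R.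
Notation h := (fun x t => hilbert (w ^~ t) x).
Hypothesis hold : forall t : R, 0 <= t -> exists H, holder H (w ^~ t).
Hypothesis cw : forall (u s : nat -> R) (x t : R), (forall n, 0 <= s n) -> 0 <= t ->
  u @ \oo --> x -> s @ \oo --> t -> (fun n => w (u n) (s n)) @ \oo --> w x t.
Hypothesis evol : forall a b : R, 0 <= a -> a < b ->
  (forall (u s : nat -> R) (x t : R), a <= t <= b -> (forall n, a <= s n <= b) ->
     u @ \oo --> x -> s @ \oo --> t -> (fun n => h (u n) (s n)) @ \oo --> h x t) ->
  forall x t : R, a < t < b -> is_derive t 1 (w x) (expR (- t) * h x t * w x t).
Notation A := (fun x e t => CA (w ^~ t) x e).
Notation B := (fun x e t => CB (w ^~ t) x e).
Notation E2 := (fun t => RI (fun y => w y t ^+ 2)).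

Section Interval.
Variables a b m : R.
Hypotheses (a0 : 0 <= a) (ab : a < b).
Hypothesis reg : forall t, a <= t <= b -> regular w m t.

Let oo_cc (t : R) : a < t < b -> a <= t <= b.
Proof. by move=> /andP[h1 h2]; rewrite !ltW. Qed.

Let ge0 (t : R) : a < t < b -> 0 <= t.
Proof. by move=> /andP[h1 _]; exact: le_trans (ltW h1). Qed.

Lemma flow_derive (x t : R) : a < t < b -> is_derive t 1 (w x) (expR (- t) * h x t * w x t).
Proof.
apply: (evol a0 ab) => u s {}x {}t tab sab ux st.
by apply: (regular_hilbert_cvg hold cw) ux st => //; [exact: reg|move=> n; exact: reg].
Qed.

Lemma flow_rate (x t : R) : a < t < b -> `|expR (- t) * h x t| <= m.
Proof.
move=> tab; have [h1 _ _ _] := regular_boundary hold x (reg (oo_cc tab)).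
rewrite normrM ger0_norm ?expR_ge0//; apply: le_trans h1.
by rewrite ler_piMl// -expR0 ler_expR oppr_le0; exact: ge0 tab.
Qed.

(** The growth rate of [w] is at most [m] uniformly in [x]. All times of the interval are thus
    dominated by a multiple of one single time, which is what differentiation under the integral
    asks for. *)
Lemma flow_growth (x t t1 : R) : a < t < b -> a < t1 < b -> `|w x t| <= expR (m * `|t - t1|) * `|w x t1|.
Proof.
move=> tab t1ab.
have := @gronwall R (fun t => w x t ^+ 2) a b (2 * m) _ t t1 tab t1ab.
have H : forall t : R, a < t < b -> exists2 l, is_derive t 1 (fun t => w x t ^+ 2) l & `|l| <= 2 * m * w x t ^+ 2.
  move=> {}t {}tab; have dw := flow_derive x tab; exists (2 * (expR (- t) * h x t) * w x t ^+ 2).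
    have -> : (fun t => w x t ^+ 2) = (w x) ^+ 2 by apply/funext => u.
    by apply: is_derive_eq; rewrite /GRing.scale/=; ring.
  rewrite normrM (ger0_norm (sqr_ge0 _)) ler_wpM2r ?sqr_ge0// normrM ger0_norm//.
  by rewrite ler_pM2l//; exact: flow_rate.
move=> /(_ H) h2.
have -> : expR (m * `|t - t1|) * `|w x t1| = `|expR (m * `|t - t1|) * w x t1|.
  by rewrite normrM (ger0_norm (expR_ge0 _)).
rewrite -ler_sqr ?nnegrE// !real_normK ?num_real//; apply: (le_trans h2).
rewrite exprMn ler_wpM2r ?sqr_ge0// expr2 -expRD ler_expR le_eqVlt; apply/orP; left; apply/eqP; ring.
Qed.

Let dist_lt (s t : R) : a < s < b -> a < t < b -> `|s - t| <= b - a.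
Proof. by move=> /andP[h1 h2] /andP[h3 h4]; rewrite ler_norml; apply/andP; split; lra. Qed.

Lemma flow_integral_derive (k : R -> R) (t : R) : measurable_fun setT k -> itg (fun y => k y ^+ 2) ->
  a < t < b -> is_derive t 1 (fun s => RI (fun y => w y s * k y))
     (expR (- t) * RI (fun y => w y t * h y t * k y)).
Proof.
move=> mk k2 tab.
have iwk (s : R) : a < s < b -> itg (fun y => w y s * k y).
  by move=> /ge0 s0; apply: itg_mul => //; [exact: (measurable_w hold)|exact: (holder_E2 hold)].
have m0 : 0 <= m by apply: le_trans (flow_rate 0 tab).
pose f s y := w y s * k y.
(* One factor [m] bounds the rate [exp(-s) * hilbert (w ^~ s) y], and the exponential is the growth
   over the whole length of the interval. *)
pose G y := m * expR (m * (b - a)) * `|w y t * k y|.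
have df (s y : R) : a < s < b -> is_derive s 1 (f ^~ y) (expR (- s) * h y s * w y s * k y).
  move=> sab; have dw := flow_derive y sab.
  have -> : f ^~ y = k y *: w y by apply/funext => u; rewrite /f mulrC.
  by apply: is_derive_eq; rewrite /GRing.scale/= mulrC.
have p1 (s y : R) : a < s < b -> partial1of2 f s y = expR (- s) * h y s * w y s * k y.
  by move=> sab; rewrite partial1of2E; have [_ ->] := df s y sab.
have It : [set` `]a, b[] t by rewrite /= in_itv.
have H1 (s : R) : [set` `]a, b[] s -> itg (f s) by rewrite /= in_itv; exact: iwk.
have H2 (s y : R) : [set` `]a, b[] s -> setT y -> derivable (f ^~ y) s 1.
  by rewrite /= in_itv => sab _; have [] := df s y sab.
have G0 y : 0 <= G y by rewrite /G !mulr_ge0// expR_ge0.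
have iG : itg G by apply: itgZ; apply: itg_norm; exact: iwk.
have H3 (s y : R) : [set` `]a, b[] s -> setT y -> `|partial1of2 f s y| <= G y.
  rewrite /= in_itv => sab _; rewrite p1// -mulrA normrM /G -mulrA.
  apply: ler_pM => //; first exact: flow_rate.
  rewrite !normrM mulrA ler_wpM2r//; apply: (le_trans (flow_growth y sab tab)).
  rewrite ler_wpM2r// ler_expR ler_wpM2l//.
  exact: dist_lt.
have D1 := @derivable_under_integral R _ (measurableTypeR R) mu f setT measurableT t a b It H1 H2 G G0 iG H3.
have D2 := @differentiation_under_integral R _ (measurableTypeR R) mu f setT measurableT t a b It H1 H2 G G0 iG H3.
apply: DeriveDef; first exact: D1.
rewrite -derive1E; apply: (etrans D2).
have ih : itg (fun y => w y t * h y t * k y).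
  apply: (itg_le _ _ (itgZ m (itg_norm (iwk t tab)))).
    apply: measurable_funM => //; apply: measurable_funM; first exact: (measurable_w hold (ge0 tab)).
    by have [H hf] := hold (ge0 tab); exact: (measurable_hilbert hf).
  move=> y /=; have [h1 _ _ _] := regular_boundary hold y (reg (oo_cc tab)).
  by rewrite mulrAC normrM mulrC ler_wpM2r.
rewrite -RI_Z//; apply: eq_Rintegral => y _; rewrite p1//; ring.
Qed.

Lemma is_derive_near (f g : R -> R) (l t : R) : is_derive t 1 g l ->
  (exists2 d, 0 < d & forall s, `|s - t| < d -> f s = g s) -> is_derive t 1 f l.
Proof.
move=> dg [d d0 fg]; apply: is_derive_slope => e e0.
have [d' d'0 hd'] := slope_of_is_derive dg e0.
exists (Num.min d d'); first by rewrite lt_min d0.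
move=> s; rewrite lt_min => /andP[s1 s2]; rewrite !fg ?subrr ?normr0//; exact: hd'.
Qed.

Let near_oo (t : R) : a < t < b -> exists2 d, 0 < d & forall s : R, `|s - t| < d -> a < s < b.
Proof.
move=> /andP[h1 h2]; exists (Num.min (t - a) (b - t)); first by rewrite lt_min !subr_gt0 h1.
by move=> s; rewrite lt_min !ltr_norml => /andP[/andP[q1 q2] /andP[q3 q4]]; apply/andP; split; lra.
Qed.

(** Testing the evolution against [Ka] produces the integral of [w * hilbert w] against [Ka], which
    the product identity evaluates; [Kb] gives the imaginary part in the same way. *)
Lemma flow_CA_derive (x e t : R) : 0 < e -> a < t < b ->
  is_derive t 1 (A x e) (expR (- t) * ((A x e t ^+ 2 - B x e t ^+ 2) / 2)).
Proof.
move=> e0 tab; have [H hf] := hold (ge0 tab).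
rewrite -(hilbert_product_re x hf e0).
apply: is_derive_near (flow_integral_derive (measurable_Ka x e0) (itg_Ka2 x e0) tab) _.
have [d d0 hd] := near_oo tab; exists d => // s /hd sab.
have [H' hf'] := hold (ge0 sab); exact: (CAE x hf' e0).
Qed.

Lemma flow_CB_derive (x e t : R) : 0 < e -> a < t < b ->
  is_derive t 1 (B x e) (expR (- t) * (A x e t * B x e t)).
Proof.
move=> e0 tab; have [H hf] := hold (ge0 tab).
rewrite -(hilbert_product_im x hf e0).
apply: is_derive_near (flow_integral_derive (measurable_Kb x e0) (itg_Kb2 x e0) tab) _.
have [d d0 hd] := near_oo tab; exists d => // s /hd sab.
have [H' hf'] := hold (ge0 sab); exact: (CBE x hf' e0).
Qed.

End Interval.
End FlowRegular.

(** * The Moebius formula between locally regular times *)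

Section FlowMoebius.
Variable R : realType.
Notation mu := (@lebesgue_measure R).

Lemma is_derive_expRN (t : R) : is_derive t 1 (fun u => expR (- u)) (- expR (- t)).
Proof.
have := is_derive_expRM (-1) t; rewrite !mulN1r.
by rewrite (_ : (fun u => expR (-1 * u)) = fun u => expR (- u))//; apply/funext => u; rewrite mulN1r.
Qed.

Lemma bilinear_derive (f g S : R -> R) (a b c t lf lg lS : R) :
  is_derive t 1 f lf -> is_derive t 1 g lg -> is_derive t 1 S lS ->
  is_derive t 1 (fun u => f u * (2 - S u * a) + S u * g u * b - c)
    (lf * (2 - S t * a) - f t * (lS * a) + (lS * g t + S t * lg) * b).
Proof.
move=> df dg dS.
have e : (fun u => f u * (2 - S u * a) + S u * g u * b - c) =
  2 *: f - a *: (f * S) + b *: (S * g) - cst c.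
  by apply/funext => u; rewrite !fctE /GRing.scale/=; ring.
have d1 := is_deriveZ 2 df; have d2 := is_deriveZ a (is_deriveM df dS).
have d3 := is_deriveZ b (is_deriveM dS dg).
have d := is_deriveB (is_deriveD (is_deriveB d1 d2) d3) (is_derive_cst c t 1).
rewrite e; apply: (is_derive_eq d); rewrite /GRing.scale/=; clear.
by move: (f t) (g t) (S t) => x y z; ring.
Qed.

Lemma sum_sqr_derive (f g : R -> R) (t lf lg : R) :
  is_derive t 1 f lf -> is_derive t 1 g lg ->
  is_derive t 1 (fun u => f u ^+ 2 + g u ^+ 2) (2 * (f t * lf + g t * lg)).
Proof.
move=> df dg; have -> : (fun u => f u ^+ 2 + g u ^+ 2) = f * f + g * g.
  by apply/funext => u; rewrite !fctE !expr2.
apply: (is_derive_eq (is_deriveD (is_deriveM df df) (is_deriveM dg dg))).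
by rewrite /GRing.scale/=; clear; move: (f t) (g t) => x y; ring.
Qed.

(** The residual [r = F (2 - s F1) - 2 F1] satisfies [r' = exp(-t) (F / 2) r] whenever [F] solves
    the Riccati equation, and [N] is its squared modulus. Uniqueness is thus reduced to a linear
    inequality, without dividing by [F] or by [2 - s F1]. *)
Lemma moebius_residual_derive (fA fB : R -> R) (a1 b1 c t : R) :
  is_derive t 1 fA (expR (- t) * ((fA t ^+ 2 - fB t ^+ 2) / 2)) ->
  is_derive t 1 fB (expR (- t) * (fA t * fB t)) ->
  let s u := c - expR (- u) in
  let N u := (fA u * (2 - s u * a1) + s u * fB u * b1 - 2 * a1) ^+ 2 +
             (fB u * (2 - s u * a1) + s u * fA u * (- b1) - 2 * b1) ^+ 2 in
  is_derive t 1 N (expR (- t) * fA t * N t).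
Proof.
move=> dA dB s N; have dq := is_derive_expRN t.
have ds : is_derive t 1 s (expR (- t)).
  have -> : s = cst c - (fun u => expR (- u)) by apply/funext.
  by apply: is_derive_eq; rewrite sub0r opprK.
have d1 := bilinear_derive a1 b1 (2 * a1) dA dB ds.
have d2 := bilinear_derive a1 (- b1) (2 * b1) dB dA ds.
have d3 := sum_sqr_derive d1 d2.
apply: (is_derive_eq d3); rewrite /N.
by move: (fA t) (fB t) (s t) (expR (- t)) => a b S E; field.
Qed.

Variable w : R -> R -> R.
Notation h := (fun x t => hilbert (w ^~ t) x).
Hypothesis hold : forall t : R, 0 <= t -> exists H, holder H (w ^~ t).
Hypothesis cw : forall (u s : nat -> R) (x t : R), (forall n, 0 <= s n) -> 0 <= t ->
  u @ \oo --> x -> s @ \oo --> t -> (fun n => w (u n) (s n)) @ \oo --> w x t.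
Hypothesis evol : forall a b : R, 0 <= a -> a < b ->
  (forall (u s : nat -> R) (x t : R), a <= t <= b -> (forall n, a <= s n <= b) ->
     u @ \oo --> x -> s @ \oo --> t -> (fun n => h (u n) (s n)) @ \oo --> h x t) ->
  forall x t : R, a < t < b -> is_derive t 1 (w x) (expR (- t) * h x t * w x t).
Notation A := (fun x e t => CA (w ^~ t) x e).
Notation B := (fun x e t => CB (w ^~ t) x e).
Notation E2 := (fun t => RI (fun y => w y t ^+ 2)).

(** Heights stop at [1] because [regular] controls the Cauchy integrals only there. *)
Definition linked (t1 t : R) : Prop := forall x e, 0 < e <= 1 ->
  moebius (expR (- t1) - expR (- t)) (A x e t1) (B x e t1) (A x e t) (B x e t).

Lemma linked_oo (a b m t t1 : R) : 0 <= a -> a < b ->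
  (forall t, a <= t <= b -> regular w m t) -> a < t < b -> a < t1 < b -> linked t1 t.
Proof.
move=> a0 ab reg tab t1ab x e /andP[e0 e1].
pose N u := (A x e u * (2 - (expR (- t1) - expR (- u)) * A x e t1) + (expR (- t1) - expR (- u)) * B x e u * B x e t1 - 2 * A x e t1) ^+ 2 +
             (B x e u * (2 - (expR (- t1) - expR (- u)) * A x e t1) + (expR (- t1) - expR (- u)) * A x e u * (- B x e t1) - 2 * B x e t1) ^+ 2.
have N0 u : 0 <= N u by rewrite addr_ge0 ?sqr_ge0.
have H : forall u : R, a < u < b -> exists2 l, is_derive u 1 N l & `|l| <= m * N u.
  move=> u uab; have d1 := flow_CA_derive hold cw evol a0 ab reg x e0 uab.
  have d2 := flow_CB_derive hold cw evol a0 ab reg x e0 uab.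
  eexists; first exact: (moebius_residual_derive (A x e t1) (B x e t1) (expR (- t1)) d1 d2).
  rewrite normrM (ger0_norm (N0 u)) ler_wpM2r// normrM ger0_norm ?expR_ge0//.
  move: uab => /andP[/ltW au /ltW ub].
  have [_ _ hb _] := reg u (introT andP (conj au ub)).
  have [hA _] := hb x e (introT andP (conj e0 e1)).
  apply: le_trans hA; rewrite ler_piMl// -expR0 ler_expR oppr_le0; exact: le_trans au.
have := gronwall H tab t1ab.
have -> : N t1 = 0 by rewrite /N subrr !mul0r !subr0 !addr0 [A x e t1 * 2]mulrC [B x e t1 * 2]mulrC !subrr expr0n addr0.
rewrite mulr0 => N1.
have : N t = 0 by apply/eqP; rewrite eq_le N1 N0.
move=> /eqP; rewrite paddr_eq0 ?sqr_ge0// !sqrf_eq0 !subr_eq0 => /andP[/eqP h1 /eqP h2].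
by split; [exact: h1|move: h2; rewrite mulrN].
Qed.

(** Weak convergence at each fixed height is enough, so bounded L^2 norms along the sequences let
    the formula reach limit times at which no local uniformity is known. *)
Lemma linked_cvg (s1 s : nat -> R) (t1 t m : R) : (forall n, 0 <= s1 n) -> (forall n, 0 <= s n) ->
  0 <= t1 -> 0 <= t -> (forall n, E2 (s1 n) <= m) -> (forall n, E2 (s n) <= m) ->
  s1 @ \oo --> t1 -> s @ \oo --> t -> (forall n, linked (s1 n) (s n)) -> linked t1 t.
Proof.
move=> s10 s0 t10 t0 m1 m2 c1 c2 H x e e01; have /andP[e0 e1] := e01.
have cx : (fun _ : nat => x) @ \oo --> x by exact: cvg_cst.
have cE (u : nat -> R) (l : R) : u @ \oo --> l -> (fun n => expR (- u n)) @ \oo --> expR (- l).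
  by move=> ul; apply: continuous_cvg; [exact: continuous_expR|exact: cvgN].
apply: (@moebius_cvg R (fun n => expR (- s1 n) - expR (- s n)) (fun n => A x e (s1 n))
  (fun n => B x e (s1 n)) (fun n => A x e (s n)) (fun n => B x e (s n))).
- by apply: cvgB; exact: cE.
- exact: (CA_time_cvg hold cw (u := fun=> x) e0 s10 t10 m1 cx c1).
- exact: (CB_time_cvg hold cw (u := fun=> x) e0 s10 t10 m1 cx c1).
- exact: (CA_time_cvg hold cw (u := fun=> x) e0 s0 t0 m2 cx c2).
- exact: (CB_time_cvg hold cw (u := fun=> x) e0 s0 t0 m2 cx c2).
- by move=> n; exact: H.
Qed.

Lemma interior_seq (a b t : R) : a < b -> a <= t <= b ->
  exists2 s : nat -> R, s @ \oo --> t & forall n, a < s n < b.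
Proof.
(* From [t] towards the midpoint: a weight [1/(n+2)] strictly between [0] and [1] keeps the points
   interior even when [t] is an endpoint. *)
move=> ab /andP[at_ tb]; exists (fun n => t + ((a + b) / 2 - t) / n.+2%:R).
  rewrite [X in _ --> X](_ : _ = t + ((a + b) / 2 - t) * 0); last by rewrite mulr0 addr0.
  apply: cvgD; first exact: cvg_cst.
  apply: cvgM; first exact: cvg_cst.
  rewrite (cvg_shiftS (fun n => n.+1%:R^-1 : R)); exact: cvg_harmonic.
move=> n; have n0 : 0 < n.+2%:R^-1 :> R by rewrite invr_gt0.
have n1 : n.+2%:R^-1 < 1 :> R by rewrite invf_lt1 ?ltr1n ?ltr0n.
move: (n.+2%:R^-1) n0 n1 => v v0 v1; apply/andP; split; nra.
Qed.

Lemma linked_cc (a b m t t1 : R) : 0 <= a -> a < b ->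
  (forall t, a <= t <= b -> regular w m t) -> a <= t <= b -> a <= t1 <= b -> linked t1 t.
Proof.
move=> a0 ab reg tab t1ab.
have [s cs sab] := interior_seq ab tab; have [s1 cs1 s1ab] := interior_seq ab t1ab.
have cc (u : R) : a < u < b -> a <= u <= b by move=> /andP[h1 h2]; rewrite !ltW.
have r0 u : a <= u <= b -> 0 <= u /\ E2 u <= m by move=> /reg [].
apply: (@linked_cvg s1 s t1 t m) => //.
- by move=> n; have [] := r0 _ (cc _ (s1ab n)).
- by move=> n; have [] := r0 _ (cc _ (sab n)).
- by have [] := r0 _ t1ab.
- by have [] := r0 _ tab.
- by move=> n; have [] := r0 _ (cc _ (s1ab n)).
- by move=> n; have [] := r0 _ (cc _ (sab n)).
- by move=> n; exact: (linked_oo a0 ab reg).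
Qed.

(** One class on a neighbourhood relative to [[0, +oo[], so that the initial time is treated like
    any other. *)
Definition locally_regular (t : R) := 0 <= t /\
  exists m, exists2 d, 0 < d & forall s, 0 <= s -> `|s - t| < d -> regular w m s.

Lemma locally_regular_compact (c d : R) : 0 <= c ->
  (forall t, c <= t <= d -> locally_regular t) ->
  exists m, forall t, c <= t <= d -> regular w m t.
Proof.
move=> c0 H.
have := (compact_near_coveringP _).1 (@segment_compact R c d).
move=> /(_ nat \oo (fun n t => c <= t <= d -> regular w n%:R t) _).
have K : forall x, [set` `[c, d]] x -> \forall x' \near x & i \near \oo, c <= x' <= d -> regular w i%:R x'.
  move=> x; rewrite /= in_itv/= => xcd; have [x0 [m [e e0 he]]] := H x xcd.
  exists (ball x e, [set i | (Num.bound `|m| <= i)%N]).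
    by split; [exact: nbhsx_ballx|exact: nbhs_infty_ge].
  move=> [x' i] /= [hx hi] /andP[x'c x'd].
  apply: (@regular_mono _ _ m).
    apply: (le_trans (ler_norm m)); apply/ltW; apply: (lt_le_trans (archi_boundP (normr_ge0 m))).
    by rewrite ler_nat.
  apply: he; first exact: le_trans x'c.
  by rewrite distrC; exact: hx.
move=> /(_ K) [N _ hN]; exists N%:R => t tcd.
by apply: (hN N (leqnn N)) => //=; rewrite in_itv.
Qed.

Lemma locally_regular_linked (t1 t : R) : (forall u, Num.min t1 t <= u <= Num.max t1 t -> locally_regular u) ->
  linked t1 t.
Proof.
move=> H.
have [e|ne] := eqVneq t1 t.
  move=> x e' e01; rewrite e subrr; split; ring.
have lt : Num.min t1 t < Num.max t1 t by case: (ltgtP t1 t) ne.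
have [c0 _] : locally_regular (Num.min t1 t) by apply: H; rewrite lexx ltW.
have [m hm] := locally_regular_compact c0 H.
by apply: (linked_cc c0 lt hm); rewrite ?ge_min ?le_max lexx ?orbT.
Qed.

Lemma linked_boundary (t1 t x : R) : 0 <= t1 -> 0 <= t -> linked t1 t ->
  moebius (expR (- t1) - expR (- t)) (h x t1) (- w x t1) (h x t) (- w x t).
Proof.
move=> t10 t0 H; have [H1 hf1] := hold t10; have [H2 hf2] := hold t0.
have sq (f : R -> R) (l : R) : f @ 0^'+ --> l -> (fun n : nat => f n.+1%:R^-1) @ \oo --> l.
  move=> /cvg_at_rightP; apply; split => [n|]; first by rewrite invr_gt0.
  exact: cvg_harmonic.
apply: (@moebius_cvg R (fun=> expR (- t1) - expR (- t)) (fun n => A x n.+1%:R^-1 t1)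
  (fun n => B x n.+1%:R^-1 t1) (fun n => A x n.+1%:R^-1 t) (fun n => B x n.+1%:R^-1 t)).
- exact: cvg_cst.
- by apply: (sq (fun e => A x e t1)); exact: CA_cvg hf1.
- by apply: (sq (fun e => B x e t1)); exact: CB_cvg hf1.
- by apply: (sq (fun e => A x e t)); exact: CA_cvg hf2.
- by apply: (sq (fun e => B x e t)); exact: CB_cvg hf2.
- by move=> n; apply: H; rewrite invr_gt0 ltr0n/= invf_le1 ?ler1n ?ltr0n.
Qed.

End FlowMoebius.

(** * Regularity of all times *)

Section HilbertVanish.
Variable R : realType.
Notation mu := (@lebesgue_measure R).

Lemma Qk_le (e s c : R) : 0 < c -> c^-1 <= `|s| -> `|Qk e s| <= c.
Proof.
move=> c0 cs; have s0 : 0 < `|s| by apply: lt_le_trans cs; rewrite invr_gt0.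
have p1 := pi_ge1 R; have p0 : 0 < (pi : R) by exact: lt_le_trans p1.
rewrite /Qk normrM normfV normrM (ger0_norm (ltW p0)) (@ger0_norm _ (s ^+ 2 + e ^+ 2)) ?addr_ge0 ?sqr_ge0//.
have d1 : `|s| ^+ 2 <= pi * (s ^+ 2 + e ^+ 2).
  rewrite -normrX (ger0_norm (sqr_ge0 s)).
  have := sqr_ge0 s; have := sqr_ge0 e; move: (s ^+ 2) (e ^+ 2) (pi : R) p1 => u v p p1 v0 u0; nra.
have d0 : 0 < pi * (s ^+ 2 + e ^+ 2) by apply: lt_le_trans d1; rewrite exprn_gt0.
rewrite ler_pdivrMr//; apply: (@le_trans _ _ (c * `|s| ^+ 2)); last by rewrite ler_wpM2l ?(ltW c0).
have : 1 <= c * `|s| by rewrite -ler_pdivrMl// mulr1.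
by clear -s0; move: `|s| s0 => u u0; rewrite expr2; nra.
Qed.

(** The roles in the weak convergence are exchanged: the translated kernels have constant L^2 norm
    and tend to [0] pointwise, and [f] is the test function. *)
Lemma CA_vanish H (f : R -> R) (e : R) (x : nat -> R) : holder H f -> 0 < e ->
  (forall n, n%:R <= `|x n|) -> (fun n => CA f (x n) e) @ \oo --> (0 : R).
Proof.
move=> hf e0 xn; have mf := holder_measurable hf; have [_ f2 _] := hf.
have cQ := continuous_Qk e0.
have mQ : measurable_fun setT (Qk e) by exact: continuous_measurable_fun.
have E n : CA f (x n) e = RI (fun y => Qk e (x n - y) * f y).
  have i : itg (fun y => f y * Qk e (x n - y)).
    have j := itg_conv (x n) mf f2 mQ (itg_Qk2 e0).
    have k := itg_shift (x n) j.
    have sE : (fun y => f y * Qk e (x n - y)) = (fun s => f (x n - (x n - s)) * Qk e (x n - s)).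
      by apply/funext => y; rewrite subKr.
    by rewrite sE.
  rewrite /CA; transitivity (RI (fun y => f y * Qk e (x n - y))).
    rewrite -[RHS](RI_shift (x n) i); congr Rintegral; apply/funext => y.
    by rewrite subKr.
  by congr Rintegral; apply/funext => y; rewrite mulrC.
have -> : (fun n => CA f (x n) e) = (fun n => RI (fun y => Qk e (x n - y) * f y)) by apply/funext.
have -> : (0:R) = RI (fun y => cst (0:R) y * f y).
  have -> : (fun y => cst (0:R) y * f y) = cst 0 by apply/funext => y; rewrite /= mul0r.
  by rewrite /Rintegral integral0.
apply: (@RI_weak_cvg R (fun n y => Qk e (x n - y)) (cst 0) f (RI (fun s => Qk e s ^+ 2))) => //.
- by move=> n; exact: measurable_shift.
- by move=> n; exact: (@itg_shift R (fun s => Qk e s ^+ 2) (x n) (itg_Qk2 e0)).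
- by move=> n; rewrite (@RI_shift R (fun s => Qk e s ^+ 2) (x n) (itg_Qk2 e0)).
move=> y; apply/cvgrPdist_le => d d0; near=> n.
rewrite sub0r normrN; apply: Qk_le => //.
have h := xn n.
have : `|y| + d^-1 <= n%:R.
  by near: n; apply: nbhs_infty_ger.
have := lerB_dist (x n) y.
by clear -h; move: `|x n| `|y| `|x n - y| (n%:R) h => a b c k; lra.
Unshelve. all: by end_near. Qed.

(** [CA_hilbert] is uniform in [x], so the decay at one small fixed height passes to the real
    line. *)
Lemma hilbert_vanish H (f : R -> R) (c : R) : holder H f -> 0 < c ->
  exists2 L, 0 < L & forall x, L <= `|x| -> `|hilbert f x| <= c.
Proof.
move=> hf c0; apply: contrapT => N.
have S n : exists x, n%:R <= `|x| /\ c < `|hilbert f x|.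
  apply: contrapT => N2; apply: N; exists n.+1%:R => // x nx.
  rewrite leNgt; apply/negP => cx; apply: N2; exists x; split => //.
  by apply: le_trans nx; rewrite ler_nat.
have [x hx] := choice S.
have [e e0 he] : exists2 e, 0 < e & H * (Num.sqrt e * vk_mass R) <= c / 2.
  have H0 := holder_ge0 hf; have v0 := vk_mass_ge0 R.
  pose k := H * vk_mass R + 1; have k0 : 0 < k by rewrite ltr_wpDl// mulr_ge0.
  exists ((c / 2 / k) ^+ 2); first by rewrite exprn_gt0// !divr_gt0.
  rewrite sqrtr_sqr ger0_norm; last by rewrite !divr_ge0 ?(ltW c0) ?(ltW k0).
  rewrite mulrCA mulrAC ler_pdivrMr// ler_wpM2l ?divr_ge0 ?(ltW c0)//.
  by rewrite /k lerDl.
have /cvgrPdist_lt /(_ (c/2)) := CA_vanish hf e0 (fun n => (hx n).1).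
move=> /(_ (divr_gt0 c0 (ltr0Sn R 1))) [n _ /(_ n (leqnn n))]; rewrite /= sub0r normrN => h1.
have h2 := CA_hilbert (x n) hf e0; have [_ h3] := hx n.
have h4 := ler_distD 0 (hilbert f (x n)) (CA f (x n) e).
have := le_trans h2 he; rewrite distrC => h5.
have := ler_dist_dist (hilbert f (x n)) (CA f (x n) e).
move: h1 h3 h5; clear.
move: (hilbert f (x n)) (CA f (x n) e) => a b h1 h3 h5 _.
have : `|a| <= `|a - b| + `|b| by rewrite -[in leLHS](subrK b a) ler_normD.
lra.
Qed.

End HilbertVanish.

Section RealBounds.
Variable R : realType.
Implicit Types a b c s m : R.

Lemma norm_le_sqrD a b c : 0 <= c -> a ^+ 2 + b ^+ 2 <= c ^+ 2 -> `|a| <= c /\ `|b| <= c.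
Proof.
have H (u v : R) : 0 <= c -> u ^+ 2 + v ^+ 2 <= c ^+ 2 -> `|u| <= c.
  move=> c0 uv; rewrite -(@ler_pXn2r _ 2%N) ?nnegrE ?normr_ge0// real_normK ?num_real//.
  by apply: le_trans uv; rewrite lerDl sqr_ge0.
move=> c0 ab; split; first exact: H ab.
by apply: (H b a) => //; rewrite addrC.
Qed.

Lemma sqr_le_norm a c : `|a| <= c -> a ^+ 2 <= c ^+ 2.
Proof.
move=> ac; rewrite -[a ^+ 2]real_normK ?num_real// lerXn2r ?nnegrE ?normr_ge0//.
exact: le_trans ac.
Qed.

(** With a denominator at least [1], [moebius_sqr] bounds [|F|^2] by [8 m^2]. The cruder constant
    [16] is shared with the L^2 norm and the modulus in the height, so that one factor serves every
    clause of [regular]. *)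
Lemma moebius_bound s a1 b1 a b m : moebius s a1 b1 a b -> `|s * a1| <= 1 ->
  `|a1| <= m -> `|b1| <= m -> `|a| <= 16 * m /\ `|b| <= 16 * m.
Proof.
move=> /moebius_sqr E /(mden_ge1 b1) D1 am bm.
have m0 : 0 <= m by apply: le_trans am.
apply: norm_le_sqrD; first by rewrite mulr_ge0.
have a2 := sqr_le_norm am; have b2 := sqr_le_norm bm.
have X0 := addr_ge0 (sqr_ge0 a) (sqr_ge0 b).
have h : a ^+ 2 + b ^+ 2 <= (a ^+ 2 + b ^+ 2) * mden s a1 b1 by rewrite ler_peMr.
apply: (le_trans h); rewrite E exprMn; have := sqr_ge0 m; lra.
Qed.

Lemma moebius_diff_bound s a1 b1 a b a1' b1' a' b' m :
  moebius s a1 b1 a b -> moebius s a1' b1' a' b' -> `|s * a1| <= 1 -> `|s * a1'| <= 1 ->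
  `|a1 - a1'| <= m -> `|b1 - b1'| <= m -> `|a - a'| <= 16 * m /\ `|b - b'| <= 16 * m.
Proof.
move=> M M' /(mden_ge1 b1) D1 /(mden_ge1 b1') D1' am bm.
have m0 : 0 <= m by apply: le_trans am.
have E := moebius_diff M M'.
apply: norm_le_sqrD; first by rewrite mulr_ge0.
have a2 := sqr_le_norm am; have b2 := sqr_le_norm bm.
have X0 := addr_ge0 (sqr_ge0 (a - a')) (sqr_ge0 (b - b')).
set X := _ + _ in E X0 *.
have h1 : X <= X * mden s a1 b1 by rewrite ler_peMr.
have h2 : X * mden s a1 b1 <= X * mden s a1 b1 * mden s a1' b1' by rewrite ler_peMr// (le_trans X0 h1).
apply: (le_trans h1); apply: (le_trans h2); rewrite E exprMn; have := sqr_ge0 m; lra.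
Qed.

End RealBounds.

Section FlowRegularity.
Variable R : realType.
Notation mu := (@lebesgue_measure R).
Variable w : R -> R -> R.
Notation h := (fun x t => hilbert (w ^~ t) x).
Hypothesis hold : forall t : R, 0 <= t -> exists H, holder H (w ^~ t).
Hypothesis cw : forall (u s : nat -> R) (x t : R), (forall n, 0 <= s n) -> 0 <= t ->
  u @ \oo --> x -> s @ \oo --> t -> (fun n => w (u n) (s n)) @ \oo --> w x t.
Hypothesis bw : forall L T : R, exists M, forall y t, `|y| <= L -> 0 <= t <= T -> `|w y t| <= M.
Hypothesis evol : forall a b : R, 0 <= a -> a < b ->
  (forall (u s : nat -> R) (x t : R), a <= t <= b -> (forall n, a <= s n <= b) ->
     u @ \oo --> x -> s @ \oo --> t -> (fun n => h (u n) (s n)) @ \oo --> h x t) ->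
  forall x t : R, a < t < b -> is_derive t 1 (w x) (expR (- t) * h x t * w x t).
Notation A := (fun x e t => CA (w ^~ t) x e).
Notation B := (fun x e t => CB (w ^~ t) x e).
Notation E2 := (fun t => RI (fun y => w y t ^+ 2)).

(* Far from the origin [hilbert (w ^~ t1)] is small, and the Moebius formula gives [`|w x t| <= 4 * `|w x t1|];
   elsewhere [w] is bounded. *)
Lemma linked_E2_bound (t1 T : R) : 0 <= t1 -> exists m, forall t, 0 <= t <= T ->
  linked w t1 t -> E2 t <= m.
Proof.
move=> t10; have [H1 hf1] := hold t10.
have [L L0 hL] := hilbert_vanish hf1 ltr01; have [M hM] := bw L T.
(* On [|x| <= L] the factor [pi (L^2 + 1) Pk 1 x] is at least [1], so the Poisson kernel provides an
   integrable majorant of [M^2] there. *)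
pose g x := 16 * w x t1 ^+ 2 + M ^+ 2 * (pi * (L ^+ 2 + 1)) * Pk 1 x.
have ig1 : itg (fun x => w x t1 ^+ 2) by have [] := hf1.
have ig : itg g by apply: itgD; apply: itgZ => //; exact: itg_Pk.
exists (RI g) => t /andP[t0 tT] lk; apply: RI_le => // [|x]; first exact: holder_E2 hold _ t0.
have P0 : 0 <= Pk 1 x by rewrite /Pk mul1r invr_ge0 ltW// pi_den_gt0.
have p0 : 0 < (pi : R) by exact: lt_le_trans (pi_ge1 R).
rewrite /g; have [Lx|xL] := leP L `|x|; last first.
  apply: (@le_trans _ _ (M ^+ 2)).
    have h1 := hM x t (ltW xL) (introT andP (conj t0 tT)).
    by rewrite -[w x t ^+ 2]real_normK ?num_real// lerXn2r ?nnegrE ?normr_ge0// (le_trans _ h1).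
  have h1 : x ^+ 2 <= L ^+ 2.
    by rewrite -[x ^+ 2]real_normK ?num_real// lerXn2r ?nnegrE ?normr_ge0// ltW.
  have h2 : 1 <= pi * (L ^+ 2 + 1) * Pk 1 x.
    rewrite /Pk mul1r ler_pdivlMr ?pi_den_gt0// mul1r ler_pM2l//.
    by rewrite expr1n lerD2r.
  apply: (@le_trans _ _ (M ^+ 2 * (pi * (L ^+ 2 + 1) * Pk 1 x))).
    by rewrite ler_peMr ?sqr_ge0.
  by rewrite mulrA lerDr mulr_ge0 ?sqr_ge0.
have mb := linked_boundary hold x t10 t0 lk.
have hh : `|(expR (- t1) - expR (- t)) * hilbert (w ^~ t1) x| <= 1.
  rewrite normrM; apply: mulr_ile1 => //; last exact: hL.
  have := expR_gt0 (- t1); have := expR_gt0 (- t).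
  have : expR (- t1) <= 1 by rewrite -expR0 ler_expR oppr_le0.
  have : expR (- t) <= 1 by rewrite -expR0 ler_expR oppr_le0.
  by move: (expR _) (expR _) => a b; rewrite ler_norml => *; apply/andP; split; lra.
have := moebius_im_le mb hh; rewrite !normrN => h1.
apply: (@le_trans _ _ (16 * w x t1 ^+ 2)); last first.
  have L2 : 0 <= L ^+ 2 + 1 by rewrite addr_ge0 ?sqr_ge0.
  rewrite lerDl; apply: mulr_ge0 P0; apply: mulr_ge0; first exact: sqr_ge0.
  by apply: mulr_ge0 L2; exact: ltW.
have -> : 16 * w x t1 ^+ 2 = (4 * `|w x t1|) ^+ 2 by rewrite exprMn real_normK ?num_real//; ring.
by rewrite -[w x t ^+ 2]real_normK ?num_real// lerXn2r ?nnegrE ?normr_ge0// mulr_ge0.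
Qed.

(** The time [p] is approached through locally regular times, all linked to the fixed time [t1].
    Seen from [t1] their L^2 norms are uniformly bounded, so the formula survives at [p]; the
    symmetry of the relation then exchanges the two times. *)
Lemma linked_endpoint (p t1 : R) : 0 <= p -> 0 <= t1 ->
  (forall u, Num.min p t1 <= u <= Num.max p t1 -> u != p -> locally_regular w u) ->
  linked w p t1.
Proof.
move=> p0 t10 lr; have [<-|ne] := eqVneq p t1.
  by move=> x e _; rewrite subrr; split; ring.
pose s n := p + (t1 - p) / n.+2%:R.
have cs : s @ \oo --> p.
  rewrite [X in _ --> X](_ : _ = p + (t1 - p) * 0); last by rewrite mulr0 addr0.
  apply: cvgD; first exact: cvg_cst.
  apply: cvgM; first exact: cvg_cst.
  by rewrite (cvg_shiftS (fun n => n.+1%:R^-1 : R)); exact: cvg_harmonic.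
have sb n : [/\ 0 <= s n, s n <= p + t1 & linked w t1 (s n)].
  have n0 : 0 < n.+2%:R^-1 :> R by rewrite invr_gt0.
  have n1 : n.+2%:R^-1 < 1 :> R by rewrite invf_lt1 ?ltr1n ?ltr0n.
  rewrite /s; move: (n.+2%:R^-1) n0 n1 => v v0 v1; split; [nra|nra|].
  apply: (locally_regular_linked hold cw evol) => u.
  move: lr ne; rewrite !minElt !maxElt.
  case: (ltgtP p t1) => [pt lr _|tp lr _|//].
    have pv : p < p + (t1 - p) * v by rewrite ltrDl mulr_gt0// subr_gt0.
    have vt : p + (t1 - p) * v < t1 by nra.
    rewrite ltNge (ltW vt)/= => /andP[h1 h2]; apply: lr.
      by rewrite h2 andbT; apply: le_trans h1; exact: ltW.
    by rewrite gt_eqF//; exact: lt_le_trans h1.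
  have pv : p + (t1 - p) * v < p by nra.
  have vt : t1 < p + (t1 - p) * v by nra.
  rewrite vt => /andP[h1 h2]; apply: lr.
    by rewrite h1/=; apply: (le_trans h2); exact: ltW.
  by rewrite lt_eqF//; exact: le_lt_trans pv.
(* [p + t1] is an upper bound for all the approximating times, whichever of [p] and [t1] comes
   first. *)
have [m hm] := linked_E2_bound (p + t1) t10.
have lk : linked w t1 p.
  apply: (@linked_cvg R w hold cw (fun=> t1) s t1 p (Num.max m (E2 t1))) => //.
  - by move=> n; have [] := sb n.
  - by move=> n; rewrite le_max lexx orbT.
  - by move=> n; have [? ? ?] := sb n; rewrite le_max hm//; apply/andP.
  - exact: cvg_cst.
  - by move=> n; have [] := sb n.
move=> x e /lk /moebius_sym; by rewrite opprB.
Qed.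

(** A short time lapse keeps the denominators at least [1], and the clauses of [regular] follow from
    the formulas for the imaginary part, the modulus and the differences. The class obtained depends
    on [m] only, not on what happens between the two times. *)
Lemma regular_endpoint (m p t1 : R) : 0 <= t1 -> regular w m p ->
  `|expR (- p) - expR (- t1)| * m <= 1 -> linked w p t1 -> regular w (16 * m) t1.
Proof.
move=> t10 rp sm lk; have [p0 E2p bp dp] := rp.
have m0 : 0 <= m by apply: le_trans E2p; apply: RI_ge0 => y; exact: sqr_ge0.
have small (a : R) : `|a| <= m -> `|(expR (- p) - expR (- t1)) * a| <= 1.
  by move=> am; rewrite normrM; apply: le_trans sm; rewrite ler_wpM2l.
split => //.
- apply: (@le_trans _ _ (RI (fun y => 16 * w y p ^+ 2))); last first.
    rewrite RI_Z; last exact: holder_E2 hold _ p0.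
    by rewrite ler_wpM2l.
  apply: RI_le => [||x]; [exact: holder_E2 hold _ t10|apply: itgZ; exact: holder_E2 hold _ p0|].
  have mb := linked_boundary hold x p0 t10 lk.
  have [hb _ _ _] := regular_boundary hold x rp.
  have := moebius_im_le mb (small _ hb); rewrite !normrN => h1.
  have := sqr_le_norm h1; rewrite exprMn real_normK ?num_real//.
  by rewrite -natrX.
- move=> x e e01; have [a1 b1] := bp x e e01; have mb := lk x e e01.
  exact: (moebius_bound mb (small _ a1) a1 b1).
move=> x e e' e0 ee' e1; have [a1 b1] := dp x e e' e0 ee' e1.
have e01 : 0 < e <= 1 by rewrite e1 andbT; exact: lt_le_trans ee'.
have e01' : 0 < e' <= 1 by rewrite e0; exact: le_trans e1.
have mb := lk x e e01; have mb' := lk x e' e01'.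
have [am bm] := bp x e e01; have [am' bm'] := bp x e' e01'.
by rewrite -mulrA; exact: (moebius_diff_bound mb mb' (small _ am) (small _ am') a1 b1).
Qed.

End FlowRegularity.

Section FlowGlobal.
Variable R : realType.
Notation mu := (@lebesgue_measure R).

Lemma segment_param (s th i d : R) : d != 0 -> 0 <= i -> th != i ->
  Num.min (s + i * d) s <= s + th * d <= Num.max (s + i * d) s -> 0 <= th < i.
Proof.
move=> d0 i0 ne; rewrite [_ < i]lt_neqAle ne/= minElt maxElt.
case: ifPn => c /andP[h1 h2].
  have dn : d < 0 by nra.
  apply/andP; split; nra.
rewrite -leNgt in c.
have [dp|dn|d00] := ltgtP 0 d.
- by apply/andP; split; nra.
- have i00 : i = 0 by nra.
  by move: h1 h2; rewrite i00 => h1 h2; apply/andP; split; nra.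
- by rewrite -d00 eqxx in d0.
Qed.

Variable w : R -> R -> R.
Notation h := (fun x t => hilbert (w ^~ t) x).
Hypothesis hold : forall t : R, 0 <= t -> exists H, holder H (w ^~ t).
Hypothesis cw : forall (u s : nat -> R) (x t : R), (forall n, 0 <= s n) -> 0 <= t ->
  u @ \oo --> x -> s @ \oo --> t -> (fun n => w (u n) (s n)) @ \oo --> w x t.
Hypothesis bw : forall L T : R, exists M, forall y t, `|y| <= L -> 0 <= t <= T -> `|w y t| <= M.
Hypothesis evol : forall a b : R, 0 <= a -> a < b ->
  (forall (u s : nat -> R) (x t : R), a <= t <= b -> (forall n, a <= s n <= b) ->
     u @ \oo --> x -> s @ \oo --> t -> (fun n => h (u n) (s n)) @ \oo --> h x t) ->
  forall x t : R, a < t < b -> is_derive t 1 (w x) (expR (- t) * h x t * w x t).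

Lemma not_regular_open (m q : R) : ~ regular w m q ->
  exists2 r, 0 < r & forall t, `|t - q| <= r -> ~ regular w m t.
Proof.
move=> nr; apply: contrapT => N; apply: nr.
have S (n : nat) : exists t, `|t - q| <= n.+1%:R^-1 /\ regular w m t.
  apply: contrapT => N2; apply: N; exists n.+1%:R^-1 => // t tq rt.
  by apply: N2; exists t.
have [s hs] := choice S.
apply: (regular_closed hold cw (s := s)) => [|n]; last exact: (hs n).2.
apply/cvgrPdist_le => d d0; have := near_infty_natSinv_lt (PosNum d0).
apply: filterS => n /= nd; rewrite distrC; apply: le_trans (hs n).1 _; exact: ltW.
Qed.

Lemma locally_regular_open (q : R) : locally_regular w q ->
  exists2 r, 0 < r & forall t, 0 <= t -> `|t - q| < r -> locally_regular w t.
Proof.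
move=> [q0 [m [d d0 hd]]]; exists d => // t t0 tq; split => //.
exists m, (d - `|t - q|); first by rewrite subr_gt0.
move=> s s0 st; apply: hd => //; apply: (le_lt_trans (ler_distD t s q)).
by rewrite -ltrBrDr.
Qed.

(** Walking from [s] to [q] along the segment, the infimum of the singular parameters is attained
    because local regularity is an open condition. The parametrisation treats both time directions
    at once. *)
Lemma nearest_singular (s q : R) : 0 <= s -> 0 <= q -> s != q -> ~ locally_regular w q ->
  exists p, [/\ 0 <= p, ~ locally_regular w p, `|p - s| <= `|q - s|, `|p - q| <= `|q - s| &
    forall u, Num.min p s <= u <= Num.max p s -> u != p -> locally_regular w u].
Proof.
move=> s0 q0 sq nq.
pose g th := s + th * (q - s).
have g0 th : 0 <= th <= 1 -> 0 <= g th.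
  move=> /andP[t0 t1]; have -> : g th = (1 - th) * s + th * q by rewrite /g; ring.
  by rewrite addr_ge0// mulr_ge0// subr_ge0.
pose T := [set th | 0 <= th <= 1 /\ ~ locally_regular w (g th)].
have T1 : T 1 by split; [rewrite ler01 lexx|rewrite /g mul1r addrC subrK].
have hT : has_inf T by split; [exists 1|exists 0 => x [/andP[]]].
have i0 : 0 <= inf T by apply: lb_le_inf; [exists 1|move=> x [/andP[]]].
have i1 : inf T <= 1 by apply: ge_inf; [exact: hT.2|].
have qs : 0 < `|q - s| by rewrite normr_gt0 subr_eq0 eq_sym.
have gi : ~ locally_regular w (g (inf T)).
  move=> /locally_regular_open[d d0 hd].
  have [th [th01 thT] hth] := inf_adherent (divr_gt0 d0 qs) hT.
  have ith : inf T <= th by apply: ge_inf; [exact: hT.2|split].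
  apply: thT; apply: hd; first exact: g0.
  have -> : g th - g (inf T) = (th - inf T) * (q - s) by rewrite /g; ring.
  rewrite -subr_ge0 in ith.
  by rewrite normrM -ltr_pdivlMr// (ger0_norm ith) ltrBlDl.
exists (g (inf T)); split => //.
- by apply: g0; rewrite i0.
- have -> : g (inf T) - s = inf T * (q - s) by rewrite /g; ring.
  by rewrite normrM (ger0_norm i0) ler_piMl.
- have -> : g (inf T) - q = - ((1 - inf T) * (q - s)) by rewrite /g; ring.
  by rewrite normrN normrM ler_piMl// ger0_norm ?subr_ge0// gerBl.
move=> u um up; apply: contrapT => nu.
have qs0 : q - s != 0 by rewrite subr_eq0 eq_sym.
pose th := (u - s) / (q - s).
have gth : g th = u by rewrite /g /th divfK// addrC subrK.
have nei : th != inf T by apply: contra_neq up => <-; rewrite gth.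
have /andP[th0 thi] : 0 <= th < inf T.
  by rewrite -gth in um; exact: (segment_param qs0 i0 nei um).
have : inf T <= th.
  apply: ge_inf; first exact: hT.2.
  split; last by rewrite gth.
  by rewrite th0/= (le_trans (ltW thi)).
by rewrite leNgt thi.
Qed.

(** Suppose all singular times near [q] were in class [n]. A regular time near [q] is linked to the
    first singular time met on the way to [q], hence belongs to class [16 n]; then one class would
    cover a neighbourhood of [q], and [q] would not be singular. *)
Lemma singular_not_uniform (n : nat) (q r : R) : 0 <= q -> ~ locally_regular w q -> 0 < r ->
  exists p, [/\ 0 <= p, ~ locally_regular w p, `|p - q| < r & ~ regular w n%:R p].
Proof.
move=> q0 nq r0; apply: contrapT => N.
have U p : 0 <= p -> ~ locally_regular w p -> `|p - q| < r -> regular w n%:R p.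
  by move=> p0 np pq; apply: contrapT => nr; apply: N; exists p.
apply: (nq); split => //; exists (16 * n%:R).
(* Within [1/(n+1)], the lapse times [n] is at most [1], as [regular_endpoint] requires. *)
exists (Num.min r n.+1%:R^-1); first by rewrite lt_min r0/= invr_gt0.
move=> s s0; rewrite lt_min => /andP[sr sn].
have mono : (n%:R : R) <= 16 * n%:R by rewrite ler_peMl// ler1n.
have [ls|ns] := pselect (locally_regular w s); last first.
  by apply: (regular_mono mono); exact: U.
have [esq|nsq] := eqVneq s q.
  by apply: (regular_mono mono); rewrite esq; apply: U => //; rewrite subrr normr0.
have [p [p0 np ps pq pu]] := nearest_singular s0 q0 nsq nq.
have rp : regular w n%:R p by apply: U => //; rewrite (le_lt_trans pq)// distrC.
apply: (regular_endpoint hold s0 rp); last exact: (linked_endpoint hold cw bw evol p0 s0).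
apply: (@le_trans _ _ (n.+1%:R^-1 * n.+1%:R)); last by rewrite mulVf.
apply: ler_pM => //; last by rewrite ler_nat.
apply: (le_trans (expRN_diff p0 s0)); apply: (le_trans ps); rewrite distrC; exact: ltW.
Qed.

(* Baire's argument: nested intervals centered at singular times escape every class [regular w n]. *)
Lemma locally_regular_all (t : R) : 0 <= t -> locally_regular w t.
Proof.
move=> t0; apply: contrapT => nt.
pose good (c : R * R) := [/\ 0 <= c.1, ~ locally_regular w c.1 & 0 < c.2].
have step (n : nat) (c : R * R) : exists c' : R * R, good c -> [/\ good c',
    (forall u, `|u - c'.1| <= c'.2 -> `|u - c.1| <= c.2) &
    (forall u, `|u - c'.1| <= c'.2 -> ~ regular w n%:R u)].
  have [gc|ngc] := pselect (good c); last by exists c.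
  have [c0 nc r0] := gc.
  have [p [p0 np pc nr]] := singular_not_uniform n c0 nc r0.
  have [d d0 hd] := not_regular_open nr.
  exists (p, Num.min d (c.2 - `|p - c.1|)) => _; split => /=.
  - by split => //=; rewrite lt_min d0/= subr_gt0.
  - move=> u; rewrite le_min => /andP[_ h1]; apply: (le_trans (ler_distD p u c.1)).
    by rewrite -lerBrDr.
  - by move=> u; rewrite le_min => /andP[h1 _]; exact: hd.
have [F hF] := choice (fun nc : nat * (R * R) => step nc.1 nc.2).
pose c := fix c (n : nat) : R * R := if n is m.+1 then F (m, c m) else (t, 1).
have gc n : good (c n).
  by elim: n => [|n IH]; [split|have [] := hF (n, c n) IH].
have nest n u : `|u - (c n.+1).1| <= (c n.+1).2 -> `|u - (c n).1| <= (c n).2.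
  by have [_ H _] := hF (n, c n) (gc n); exact: H.
have nestD n k u : `|u - (c (n + k)%N).1| <= (c (n + k)%N).2 -> `|u - (c n).1| <= (c n).2.
  by elim: k => [|k IH]; rewrite ?addn0// addnS => /nest /IH.
pose lo n := (c n).1 - (c n).2; pose hi n := (c n).1 + (c n).2.
have rad n : 0 < (c n).2 by have [] := gc n.
have lohi n m : lo n <= hi m.
  have [nm|/ltnW mn] := leqP n m.
    have := @nestD n (m - n)%N (c m).1; rewrite subnKC// subrr normr0 => /(_ (ltW (rad m))).
    by rewrite ler_distl => /andP[h1 _]; apply: (le_trans h1); rewrite /hi lerDl ltW.
  have := @nestD m (n - m)%N (c n).1; rewrite subnKC// subrr normr0 => /(_ (ltW (rad n))).
  by rewrite ler_distl => /andP[_ h1]; apply: le_trans h1; rewrite /lo gerBl ltW.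
pose S := range lo.
have hS : has_sup S.
  by split; [exists (lo 0%N); exists 0%N|exists (hi 0%N) => x [n _ <-]].
(* The nested intervals may extend below time [0]. Their centers are nonnegative, so the cut at [0]
   stays in each of them. *)
pose q := Num.max 0 (sup S).
have q0 : 0 <= q by rewrite le_max lexx.
have qc n : `|q - (c n).1| <= (c n).2.
  rewrite ler_distl le_max ge_max; apply/andP; split.
    by apply/orP; right; apply: ub_le_sup; [exact: hS.2|exists n].
  apply/andP; split; first by have [h1 _ /ltW h2] := gc n; exact: addr_ge0.
  by apply: ge_sup; [exact: hS.1|move=> x [m _ <-]; exact: lohi].
have [n rn] := regular_exists hold q0.
have [_ _ H] := hF (n, c n) (gc n).
by apply: (H q) rn; exact: (qc n.+1).
Qed.

Lemma flow_linked (t : R) : 0 <= t -> linked w 0 t.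
Proof.
move=> t0; apply: (locally_regular_linked hold cw evol) => u /andP[h1 _].
by apply: locally_regular_all; apply: le_trans h1; rewrite le_min lexx.
Qed.

Lemma flow_moebius (x t : R) : 0 <= t ->
  moebius (1 - expR (- t)) (h x 0) (- w x 0) (h x t) (- w x t).
Proof.
move=> t0; have := linked_boundary hold x (lexx 0) t0 (flow_linked t0).
by rewrite oppr0 expR0.
Qed.

End FlowGlobal.

(** * The solution in unscaled variables *)

Section SolutionFlow.
Variable R : realType.
Notation mu := (@lebesgue_measure R).
Variable Om : R -> R -> R.
Hypothesis sm : forall t : R, 0 <= t -> smooth (Om ^~ t) /\ H1 (Om ^~ t).
Hypothesis cOm : {within [set p : R * R | 0 <= p.2], continuous (fun p : R * R => Om p.1 p.2)}.
Hypothesis pde : forall X t : R, 0 < t -> derivable (Om X) t 1 /\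
  derive1 (Om X) t + 2^-1 * X * derive1 (fun Y => Om Y t) X =
    (-1 + hilbert (fun Y => Om Y t) X) * Om X t.

Definition unscaled (x t : R) : R := expR t * Om (expR (t / 2) * x) t.
Notation w := unscaled.
Notation h := (fun x t => hilbert (w ^~ t) x).

Lemma solution_holder (t : R) : 0 <= t -> exists H, holder H (Om ^~ t).
Proof. by move=> /sm[s1 s2]; exact: H1_holder. Qed.

Lemma unscaled_holder (t : R) : 0 <= t -> exists H, holder H (w ^~ t).
Proof.
move=> /solution_holder[H hf]; eexists; exact: (holder_scale (expR t) (expR_gt0 (t / 2)) hf).
Qed.

Lemma unscaled_hilbert (x t : R) : 0 <= t -> h x t = expR t * hilbert (Om ^~ t) (expR (t / 2) * x).
Proof.
by move=> /solution_holder[H hf]; exact: (hilbert_scale (expR t) x (expR_gt0 (t / 2)) hf).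
Qed.

Lemma expR_half_cvg (s : nat -> R) (t : R) : s @ \oo --> t ->
  (fun n => expR (s n / 2)) @ \oo --> expR (t / 2).
Proof.
move=> st; apply: continuous_cvg; first exact: continuous_expR.
by apply: cvgM => //; exact: cvg_cst.
Qed.

Lemma unscaled_cvg (u s : nat -> R) (x t : R) : (forall n, 0 <= s n) -> 0 <= t ->
  u @ \oo --> x -> s @ \oo --> t -> (fun n => w (u n) (s n)) @ \oo --> w x t.
Proof.
move=> s0 t0 ux st; apply: cvgM.
  by apply: continuous_cvg; [exact: continuous_expR|].
apply: (within_continuous_seq cOm t0 s0) => //.
by apply: cvgM => //; exact: expR_half_cvg.
Qed.

Lemma unscaled_bounded (L T : R) :
  exists M, forall y t, `|y| <= L -> 0 <= t <= T -> `|w y t| <= M.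
Proof.
pose Phi (p : R * R) := (expR (p.2 / 2) * p.1, p.2).
have cPhi : continuous Phi.
  move=> p; apply: (@cvg_pair _ _ _ _ (nbhs (Phi p).1) (nbhs (Phi p).2)); last exact: cvg_snd.
  apply: cvgM; last exact: cvg_fst.
  apply: continuous_cvg; first exact: continuous_expR.
  by apply: cvgM; [exact: cvg_snd|exact: cvg_cst].
pose box : set (R * R) := [set` `[- L, L]] `*` [set` `[0, T]].
have cbox : compact box by apply: compact_setX; exact: segment_compact.
have cv : {within box, continuous ((fun p : R * R => Om p.1 p.2) \o Phi)}.
  apply: (within_continuous_precomp cOm cPhi) => p [_ /=]; rewrite in_itv/= => /andP[h _].
  exact: h.
have inbox (y t : R) : `|y| <= L -> 0 <= t <= T -> box (y, t).
  by move=> yL tT; split => /=; rewrite in_itv/= -?ler_norml.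
have [box0|nbox] := pselect (box !=set0); last first.
  by exists 0 => y t yL tT; exfalso; apply: nbox; exists (y, t); exact: inbox.
have cn : {within box, continuous (fun p => `|((fun p : R * R => Om p.1 p.2) \o Phi) p|)}.
  by move=> p; apply: cvg_norm; exact: cv.
have [pM pMb hM] := compact_EVT_max box0 cbox cn.
exists (expR T * `|((fun p : R * R => Om p.1 p.2) \o Phi) pM|) => y t yL tT.
rewrite /w normrM (ger0_norm (expR_ge0 t)); apply: ler_pM; [exact: expR_ge0|exact: normr_ge0|by rewrite ler_expR; case/andP: tT|].
exact: (hM (y, t) (mem_set (inbox _ _ yL tT))).
Qed.

(** The one-sided comparison is applied to [Om] with slope [g + e] and to [- Om] with slope
    [- g + e]. *)
Lemma solution_slope (a b x t0 g e r s1 s2 : R) : 0 <= a -> 0 < r -> a <= s1 -> s1 < s2 -> s2 <= b ->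
  `|s1 - t0| < r -> `|s2 - t0| < r ->
  (forall y t, `|y - x| < r -> `|t - t0| < r -> a <= t <= b ->
     `|(-1 + expR (- t) * h y t) * (expR (- t) * w y t) - g| <= e) ->
  `|Om (expR (s2 / 2) * x) s2 - Om (expR (s1 / 2) * x) s1 - g * (s2 - s1)| <= e * (s2 - s1).
Proof.
move=> a0 r0 as1 s12 s2b s1r s2r H.
have s10 : 0 <= s1 by exact: le_trans as1.
have rhs (X t : R) : s1 < t -> t <= s2 -> `|X * expR (- (t / 2)) - x| < r ->
  [/\ derivable (Om X) t 1, derivable (Om ^~ t) X 1 &
   `|derive1 (Om X) t + 2^-1 * X * derive1 (Om ^~ t) X - g| <= e].
  move=> s1t ts2 yr; have t0' : 0 < t by exact: le_lt_trans s1t.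
  have [d1 E] := pde X t0'; have [smt _] := sm (ltW t0').
  split; [exact: d1|exact: (smt 0%N X)|].
  rewrite E; have yE : expR (t / 2) * (X * expR (- (t / 2))) = X.
    by rewrite mulrCA -expRD subrr expR0 mulr1.
  have tt0 : `|t - t0| < r.
    move: s1r s2r; rewrite !ltr_norml => /andP[h1 h2] /andP[h3 h4].
    by clear -h1 h4 s1t ts2 R; apply/andP; split; lra.
  have tab : a <= t <= b.
    by rewrite (le_trans as1 (ltW s1t)) (le_trans ts2 s2b).
  have := H _ _ yr tt0 tab; rewrite (unscaled_hilbert _ (ltW t0')) /w yE.
  have E2 (c : R) : expR (- t) * (expR t * c) = c.
    by rewrite mulrA -expRD addNr expR0 mul1r.
  by rewrite !E2.
have := @characteristic_le R Om cOm x s1 s2 r (g + e) s10 s12 r0.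
have cN : {within [set p : R * R | 0 <= p.2], continuous (fun p : R * R => - Om p.1 p.2)}.
  by move=> p; apply: cvgN; exact: cOm.
have := @characteristic_le R (fun X t => - Om X t) cN x s1 s2 r (- g + e) s10 s12 r0.
move=> h1 h2.
have {}h2 : Om (expR (s2 / 2) * x) s2 - Om (expR (s1 / 2) * x) s1 <= (g + e) * (s2 - s1).
  apply: h2 => X t u1 u2 u3; have [d1 d2 E] := rhs X t u1 u2 u3; split; [exact: d1|exact: d2|].
  by move: E; rewrite ler_distl => /andP[].
have {}h1 : - Om (expR (s2 / 2) * x) s2 - - Om (expR (s1 / 2) * x) s1 <= (- g + e) * (s2 - s1).
  apply: h1 => X t u1 u2 u3; have [d1 d2 E] := rhs X t u1 u2 u3; split.
  - exact: (derivableN d1).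
  - exact: (derivableN d2).
  - have -> : derive1 (fun t => - Om X t) t = - derive1 (Om X) t.
      by rewrite !derive1E (deriveN d1).
    have -> : derive1 (fun X => - Om X t) X = - derive1 (Om ^~ t) X.
      by rewrite !derive1E (deriveN d2).
    move: E; rewrite ler_distl => /andP[E _]; move: E.
    by move: (derive1 _ _) (derive1 _ _) => A B; clear; lra.
move: h1 h2; move: (Om _ s2) (Om _ s1) => A B; clear => h1 h2.
rewrite ler_norml; apply/andP; split; lra.
Qed.

(** When the Hilbert transform is jointly continuous, the right side of the equation is nearly
    constant around a point of a characteristic, so the difference quotients of [Om] along it
    converge. The factor [exp(t)] in [unscaled] then cancels the damping term. *)
Lemma unscaled_evol (a b : R) : 0 <= a -> a < b ->
  (forall (u s : nat -> R) (x t : R), a <= t <= b -> (forall n, a <= s n <= b) ->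
     u @ \oo --> x -> s @ \oo --> t -> (fun n => h (u n) (s n)) @ \oo --> h x t) ->
  forall x t : R, a < t < b -> is_derive t 1 (w x) (expR (- t) * h x t * w x t).
Proof.
move=> a0 ab hc x t0 /andP[at0 t0b].
have t00 : 0 < t0 by exact: le_lt_trans at0.
have atb : a <= t0 <= b by rewrite !ltW.
pose G y t := (-1 + expR (- t) * h y t) * (expR (- t) * w y t).
have cG : forall u t : nat -> R, (forall n, a <= t n <= b) -> u @ \oo --> x -> t @ \oo --> t0 ->
    (fun n => G (u n) (t n)) @ \oo --> G x t0.
  move=> u t tab ux tt.
  have t0n n : 0 <= t n by have /andP[h1 _] := tab n; exact: le_trans h1.
  have ce : (fun n => expR (- t n)) @ \oo --> expR (- t0).
    by apply: continuous_cvg; [exact: continuous_expR|exact: cvgN].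
  have ch := hc u t x t0 atb tab ux tt.
  have cw := unscaled_cvg t0n (ltW t00) ux tt.
  apply: cvgM; last exact: cvgM.
  by apply: cvgD; [exact: cvg_cst|exact: cvgM].
have dphi : is_derive t0 1 (fun t => Om (expR (t / 2) * x) t) (G x t0).
  apply: is_derive_slope => e e0.
  have [r r0 hr] := seq_continuous_eps cG e0.
  have hr' y t : `|y - x| < r -> `|t - t0| < r -> a <= t <= b -> `|G y t - G x t0| <= e.
    by move=> h1 h2 h3; apply: ltW; exact: hr.
  exists (Num.min r (Num.min (t0 - a) (b - t0))).
    by rewrite !lt_min r0 !subr_gt0 at0 t0b.
  move=> t; rewrite !lt_min => /and3P[tr ta tb].
  have ta' : a <= t by move: ta; rewrite ltr_norml; clear; move=> /andP[? ?]; lra.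
  have tb' : t <= b by move: tb; rewrite ltr_norml; clear; move=> /andP[? ?]; lra.
  have t0r : `|t0 - t0| < r by rewrite subrr normr0.
  have [tt|tt|->] := ltgtP t t0.
  - have := solution_slope a0 r0 ta' tt (ltW t0b) tr t0r hr'.
    rewrite distrC (distrC t) (gtr0_norm (_ : 0 < t0 - t)) ?subr_gt0//.
    by congr (_ <= _); congr (`|_|); ring.
  - have := solution_slope a0 r0 (ltW at0) tt tb' t0r tr hr'.
    by rewrite (gtr0_norm (_ : 0 < t - t0)) ?subr_gt0.
  - by rewrite !subrr mulr0 subr0 normr0 mulr0.
have := is_derive_mul_exp 1 dphi.
have -> : (fun u => Om (expR (u / 2) * x) u * expR (1 * u)) = w x.
  by apply/funext => u; rewrite mul1r /w mulrC.
move=> d; apply: (is_derive_eq d); rewrite /G /w !mul1r.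
have E : expR (- t0) * expR t0 = 1 by rewrite -expRD addNr expR0.
move: (expR _) (expR t0) (hilbert _ _) (Om _ _) E => p q H o E.
have -> : (-1 + p * H) * (p * (q * o)) + o = (-1 + p * H) * (p * q) * o + o by ring.
by rewrite E; ring.
Qed.

Lemma solution_moebius (x t : R) : 0 <= t ->
  moebius (1 - expR (- t)) (hilbert (Om ^~ 0) x) (- Om x 0)
    (expR t * hilbert (Om ^~ t) (expR (t / 2) * x)) (- (expR t * Om (expR (t / 2) * x) t)).
Proof.
move=> t0.
have := flow_moebius unscaled_holder unscaled_cvg unscaled_bounded unscaled_evol x t0.
rewrite !unscaled_hilbert// /w mul0r expR0 !mul1r.
by [].
Qed.

End SolutionFlow.

(** * Asymptotics of the solution *)

Section SecondOrder.
Variable R : realType.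
Implicit Types f g : R -> R.

Lemma deriv_bound f (df : R -> R) (x y K : R) :
  (forall z, Num.min x y <= z <= Num.max x y -> is_derive z 1 f (df z)) ->
  (forall z, Num.min x y <= z <= Num.max x y -> `|df z| <= K) ->
  `|f y - f x| <= K * `|y - x|.
Proof.
wlog xy : x y / x <= y.
  move=> H; have [xy|yx] := orP (le_total x y); first exact: H.
  move=> h1 h2; rewrite distrC [`|y - x|]distrC; apply: (H y x yx) => z; rewrite minC maxC.
    exact: h1.
  exact: h2.
rewrite minElt maxElt; move: xy; rewrite le_eqVlt => /orP[/eqP <- _ _|xy].
  by rewrite !subrr normr0 mulr0.
rewrite xy => d b.
have dz z : z \in `]x, y[%R -> x <= z <= y.
  by rewrite in_itv/= => /andP[h1 h2]; rewrite !ltW.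
have cf : {within `[x, y], continuous f}.
  apply: derivable_within_continuous => z; rewrite in_itv/= => zxy.
  exact: (@ex_derive _ _ _ _ _ _ _ (d z zxy)).
have [c cxy ->] := MVT xy (fun z h => d z (dz z h)) cf.
by rewrite normrM ler_wpM2r// b// dz.
Qed.

(* [f = a + v/2 y^2 + o(y^2)] near [0]. *)
Definition flat2 f (a v : R) := f 0 = a /\ exists g,
  [/\ \forall y \near (0:R), is_derive (y : R) 1 f (g y), g 0 = 0 & is_derive (0:R) 1 g v].

Lemma flat2_second f a v : flat2 f a v -> has_second_deriv f 0 v.
Proof.
move=> [_ [g [h1 _ h3]]]; split.
  by apply: filterS h1 => y d; exact: (@ex_derive _ _ _ _ _ _ _ d).
apply: (is_derive_near h3); have /nbhs_ballP[d d0 hd] := h1.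
exists d => // s; rewrite subr0 => sd; rewrite derive1E; apply: derive_val.
by apply: hd; rewrite /ball/= sub0r normrN.
Qed.

Lemma is_derive_even0 f (l : R) : (forall x, f (- x) = f x) -> is_derive (0:R) 1 f l -> l = 0.
Proof.
move=> ev d.
have dn : is_derive (0:R) 1 (fun x : R => - x) (- 1).
  have -> : (fun x : R => - x) = - (id : R -> R) by apply/funext.
  by apply: is_derive_eq.
have d' : is_derive (- 0 : R) 1 f l by rewrite oppr0.
have := @is_derive1_comp _ f (fun x : R => - x) 0 _ _ d' dn.
have -> : f \o (fun x : R => - x) = f by apply/funext => x /=; exact: ev.
move=> d2; have e1 := @derive_val _ _ _ _ _ _ _ d; have e2 := @derive_val _ _ _ _ _ _ _ d2.
move: e2; rewrite e1 => /eqP; rewrite mulrN1 -subr_eq0 opprK -mulr2n mulrn_eq0/=.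
by move/eqP.
Qed.

Lemma even_flat2 f v : (forall x, f (- x) = f x) -> has_second_deriv f 0 v -> flat2 f (f 0) v.
Proof.
move=> ev [h1 h2]; split => //; exists (derive1 f).
have D : \forall y \near (0:R), is_derive (y : R) 1 f (derive1 f y).
  by apply: filterS h1 => y dy; split => //; rewrite derive1E.
split => //; apply: (is_derive_even0 ev); exact: (nbhs_singleton D).
Qed.

Lemma flat2_cst (c : R) : flat2 (fun=> c) c 0.
Proof.
split => //; exists (fun=> 0); split => //; last exact: is_derive_cst.
by apply: (@nearW _ (nbhs (0:R))) => y; exact: is_derive_cst.
Qed.

Lemma flat2D f g a v b u : flat2 f a v -> flat2 g b u -> flat2 (fun y => f y + g y) (a + b) (v + u).
Proof.
move=> [fa [f' [f1 f2 f3]]] [gb [g' [g1 g2 g3]]]; split; first by rewrite fa gb.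
exists (f' + g'); split; last exact: is_deriveD.
  by apply: filterS2 f1 g1 => y d1 d2; exact: is_deriveD.
by rewrite fctE f2 g2 addr0.
Qed.

(** There is no cross term, since both first derivatives vanish at [0]. *)
Lemma flat2M f g a v b u : flat2 f a v -> flat2 g b u ->
  flat2 (fun y => f y * g y) (a * b) (a * u + b * v).
Proof.
move=> [fa [f' [f1 f2 f3]]] [gb [g' [g1 g2 g3]]]; split; first by rewrite fa gb.
have d1 := nbhs_singleton f1; have d2 := nbhs_singleton g1.
exists (f * g' + g * f'); split.
- by apply: filterS2 f1 g1 => y e1 e2; exact: is_deriveM.
- by rewrite !fctE f2 g2 !mulr0 addr0.
apply: (is_derive_eq (is_deriveD (is_deriveM d1 g3) (is_deriveM d2 f3))).
by rewrite f2 g2 fa gb /GRing.scale/= !mulr0 !addr0.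
Qed.

Lemma flat2V f a v : a != 0 -> flat2 f a v -> flat2 (fun y => (f y)^-1) a^-1 (- v / a ^+ 2).
Proof.
move=> a0 [fa [f' [f1 f2 f3]]]; split; first by rewrite fa.
have d0 := nbhs_singleton f1.
have dV (y l : R) : f y != 0 -> is_derive y 1 f l -> is_derive y 1 (fun y => (f y)^-1) (- (f y) ^- 2 * l).
  move=> fy dy; split; first by apply: derivableV => //; exact: (@ex_derive _ _ _ _ _ _ _ dy).
  by rewrite deriveV// (@derive_val _ _ _ _ _ _ _ dy).
have cf : {for 0, continuous f}.
  by apply/differentiable_continuous/derivable1_diffP; exact: (@ex_derive _ _ _ _ _ _ _ d0).
have fn0 : \forall y \near (0:R), f y != 0.
  have fa0 : 0 < `|f 0| by rewrite fa normr_gt0.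
  move/cvgrPdist_lt : cf => /(_ _ fa0); apply: filterS => y.
  by apply: contraTneq => ->; rewrite subr0 ltxx.
have dI := dV 0 0 (nbhs_singleton fn0).
rewrite f2 in d0; have {}dI := dI d0.
exists (- ((fun y => (f y)^-1) * (fun y => (f y)^-1) * f')); split.
- apply: filterS2 fn0 f1 => y fy dy; apply: (is_derive_eq (dV y _ fy dy)).
  by rewrite !fctE expr2 invfM mulNr.
- by rewrite !fctE f2 mulr0 oppr0.
apply: (is_derive_eq (is_deriveN (is_deriveM (is_deriveM dI dI) f3))).
by rewrite !fctE f2 fa /GRing.scale/= mul0r addr0 expr2 invfM; ring.
Qed.

Lemma flat2_scale f a v (k : R) : flat2 f a v -> flat2 (fun y => f (k * y)) a (v * k ^+ 2).
Proof.
move=> [fa [f' [f1 f2 f3]]]; split; first by rewrite mulr0.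
have dk (y : R) : is_derive y 1 (fun y : R => k * y) k.
  have -> : (fun y : R => k * y) = k *: (id : R -> R) by apply/funext.
  by apply: is_derive_eq; rewrite /GRing.scale/= mulr1.
have f3' : is_derive (k * 0) 1 f' v by rewrite mulr0.
have dc := @is_derive1_comp _ f' (fun y : R => k * y) 0 _ _ f3' (dk 0).
exists (k *: (f' \o (fun y => k * y))); split.
- have ck : (fun y : R => k * y) @ (0:R) --> (0:R).
    rewrite -[X in _ --> X](mulr0 k); apply: cvgM; [exact: cvg_cst|exact: cvg_id].
  have := ck _ f1; apply: (@filterS _ (nbhs (0:R))) => y dy.
  apply: (is_derive_eq (@is_derive1_comp _ f (fun y : R => k * y) y _ _ dy (dk y))).
  by rewrite !fctE /GRing.scale/= mulrC.
- by rewrite !fctE mulr0 f2 /GRing.scale/= mulr0.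
apply: (is_derive_eq (is_deriveZ k dc)).
by rewrite /GRing.scale/= expr2; ring.
Qed.

Lemma flat2_taylor f a v : flat2 f a v -> forall e, 0 < e -> exists2 d, 0 < d &
  forall y, `|y| < d -> `|f y - a - v / 2 * y ^+ 2| <= e * y ^+ 2.
Proof.
move=> [fa [f' [/nbhs_ballP[r r0 hr] f2 f3]]] e e0.
have [d d0 hd] := slope_of_is_derive f3 e0.
exists (Num.min r d); first by rewrite lt_min r0.
move=> y; rewrite lt_min => /andP[yr yd].
pose g := f - (v / 2) *: (id * id : R -> R).
have between (z : R) : Num.min 0 y <= z <= Num.max 0 y -> `|z| <= `|y|.
  have [y0|y0] := leP 0 y => /andP[h1 h2]; first by rewrite !ger0_norm.
  by rewrite !ler0_norm ?lerN2// ltW.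
have dg z : Num.min 0 y <= z <= Num.max 0 y -> is_derive z 1 g (f' z - v * z).
  move=> /between zy; have dz : is_derive z 1 f (f' z).
    by apply: hr; rewrite /ball/= sub0r normrN (le_lt_trans zy).
  have di : is_derive z 1 (id : R -> R) 1 by exact: is_derive_id.
  apply: (is_derive_eq (is_deriveB dz (is_deriveZ (v / 2) (is_deriveM di di)))).
  by rewrite /GRing.scale/= !mulr1; field.
have bg z : Num.min 0 y <= z <= Num.max 0 y -> `|f' z - v * z| <= e * `|y|.
  move=> /between zy; have := hd z; rewrite !subr0 f2 subr0 => /(_ (le_lt_trans zy yd)) h.
  by apply: (le_trans h); rewrite ler_wpM2l// ltW.
have := deriv_bound dg bg.
have -> : e * `|y| * `|y - 0| = e * y ^+ 2.
  by rewrite subr0 -mulrA -expr2 real_normK ?num_real.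
by rewrite /g !fctE /GRing.scale/= fa !mulr0 subr0 expr2 addrAC.
Qed.

End SecondOrder.

Section Parity.
Variable R : realType.
Notation mu := (@lebesgue_measure R).

Lemma CA_even H (f : R -> R) (x e : R) : holder H f -> (forall y, f (- y) = - f y) -> 0 < e ->
  CA f (- x) e = CA f x e.
Proof.
move=> hf od e0; have mf := holder_measurable hf; have [_ f2 _] := hf.
have mQ : measurable_fun setT (Qk e) by apply: continuous_measurable_fun; exact: continuous_Qk.
have i := itg_conv (- x) mf f2 mQ (itg_Qk2 e0).
have m1 : (-1 : R) != 0 by rewrite oppr_eq0 oner_eq0.
rewrite /CA (RI_affine 0 m1 i) normrN1 mul1r; congr Rintegral; apply/funext => s.
rewrite addr0 mulN1r opprK QkN; have -> : - x + s = - (x - s) by rewrite opprB addrC.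
by rewrite od mulrNN.
Qed.

Lemma hilbert_even H (f : R -> R) (x : R) : holder H f -> (forall y, f (- y) = - f y) ->
  hilbert f (- x) = hilbert f x.
Proof.
move=> hf od; have c1 := @CA_cvg _ _ _ (- x) hf; have c2 := @CA_cvg _ _ _ x hf.
have E : (fun e => CA f (- x) e) @ 0^'+ --> hilbert f x.
  apply: cvg_trans c2; apply: near_eq_cvg; near=> e.
  by rewrite (CA_even x hf od)//; near: e; exact: nbhs_right_gt.
by rewrite -(cvg_lim _ c1)// (cvg_lim _ E).
Unshelve. all: by end_near. Qed.

Lemma odd_at0 (f : R -> R) : (forall y, f (- y) = - f y) -> f 0 = 0.
Proof. by move=> od; have := od 0; rewrite oppr0; lra. Qed.

Lemma is_derive_derive1 (f : R -> R) (x : R) : derivable f x 1 -> is_derive x 1 f (derive1 f x).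
Proof. by move=> d; split; [exact: d|rewrite derive1E]. Qed.

Lemma derive1_odd (f : R -> R) (x : R) : (forall y, f (- y) = - f y) ->
  (forall y, derivable f y 1) -> derive1 f (- x) = derive1 f x.
Proof.
move=> od df.
have dn : is_derive x 1 (fun y : R => - y) (- 1).
  have -> : (fun y : R => - y) = - (id : R -> R) by apply/funext.
  by apply: is_derive_eq.
have d1 : is_derive (- x) 1 f (derive1 f (- x)) by exact: is_derive_derive1.
have d2 := @is_derive1_comp _ f (fun y : R => - y) x _ _ d1 dn.
have e : f \o (fun y : R => - y) = - f by apply/funext => y /=; rewrite od.
rewrite e in d2; have := @derive_val _ _ _ _ _ _ _ d2.
by rewrite deriveN// -derive1E mulrN1 => /oppr_inj ->.
Qed.

(** The derivative of an odd function is even, so the second derivative vanishes at [0]. *)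
Lemma smooth_odd_flat2 (f : R -> R) : smooth f -> (forall y, f (- y) = - f y) ->
  derive1 f 0 = 0 -> flat2 f 0 0.
Proof.
move=> sf od f'0; split; first exact: odd_at0.
have d1 y : derivable f y 1 by exact: (sf 0%N y).
have d2 y : derivable (derive1 f) y 1 by exact: (sf 1%N y).
exists (derive1 f); split => //.
  by apply: (@nearW _ (nbhs (0:R))) => y; exact: is_derive_derive1.
have D : is_derive (0:R) 1 (derive1 f) (derive1 (derive1 f) 0).
  exact: is_derive_derive1.
apply: (is_derive_eq D); apply: (is_derive_even0 _ D) => x; exact: derive1_odd.
Qed.

Lemma flat2_eq (f g : R -> R) (a v a' v' : R) : flat2 f a v -> (forall x, g x = f x) ->
  a = a' -> v = v' -> flat2 g a' v'.
Proof. by move=> h /funext -> <- <-. Qed.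

Lemma expR_half_sqr (t : R) : expR (- (t / 2)) ^+ 2 = expR (- t).
Proof. by rewrite expr2 -expRD; congr expR; field. Qed.

Lemma expR_half_vanish : (fun t : R => expR (- (t / 2))) @ +oo --> (0:R).
Proof.
apply: (cvg_comp (fun t : R => t / 2) (fun t => expR (- t))); last exact: cvgr_expR.
apply/cvgryPge => A; near=> t; rewrite ler_pdivlMr//; near: t; exact: nbhs_pinfty_ge.
Unshelve. all: by end_near. Qed.

(** The parabolic zoom: [exp(-t/2)] squared is the divisor [exp(-t)], so only the quadratic
    coefficient survives. *)
Lemma flat2_limit (f : R -> R) (a v X : R) : flat2 f a v ->
  (fun t => (f (expR (- (t / 2)) * X) - a) / expR (- t)) @ +oo --> v / 2 * X ^+ 2.
Proof.
move=> hf; apply/cvgrPdist_le => e e0.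
have X1 : 0 < X ^+ 2 + 1 by rewrite ltr_wpDl ?sqr_ge0.
have [d d0 hd] := flat2_taylor hf (divr_gt0 e0 X1).
have X0 : 0 < `|X| + 1 by rewrite ltr_wpDl.
have /cvgrPdist_lt /(_ _ (divr_gt0 d0 X0)) := expR_half_vanish.
apply: filterS => t /=; rewrite sub0r normrN ger0_norm ?expR_ge0// ltr_pdivlMr// => kd.
have k0 := expR_gt0 (- (t / 2)); rewrite -(expR_half_sqr t).
set k := expR _ in kd k0 *.
have kX : `|k * X| < d.
  by rewrite normrM (gtr0_norm k0); apply: le_lt_trans kd; rewrite ler_wpM2l ?(ltW k0)// lerDl.
have h := hd _ kX; have k2 : 0 < k ^+ 2 by rewrite exprn_gt0.
have -> : v / 2 * X ^+ 2 - (f (k * X) - a) / k ^+ 2 =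
  - ((f (k * X) - a - v / 2 * (k * X) ^+ 2) / k ^+ 2).
  by move: (f _) => F; field; rewrite gt_eqF.
rewrite normrN normrM normfV (gtr0_norm k2) ler_pdivrMr//; apply: (le_trans h).
rewrite exprMn mulrCA mulrC ler_wpM2r ?(ltW k2)// mulrAC ler_pdivrMr// ler_wpM2l ?(ltW e0)//.
by rewrite lerDl.
Qed.

End Parity.

Section Asymptotics.
Variable R : realType.
Variables (Om : R -> R -> R).
Hypothesis sm : forall t : R, 0 <= t -> smooth (Om ^~ t) /\ H1 (Om ^~ t).
Hypothesis cOm : {within [set p : R * R | 0 <= p.2], continuous (fun p : R * R => Om p.1 p.2)}.
Hypothesis pde : forall X t : R, 0 < t -> derivable (Om X) t 1 /\
  derive1 (Om X) t + 2^-1 * X * derive1 (fun Y => Om Y t) X =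
    (-1 + hilbert (fun Y => Om Y t) X) * Om X t.
Notation u0 := (hilbert (Om ^~ 0)).
Notation o0 := (Om ^~ 0).
Notation k t := (expR (- (t / 2))).

(** The Moebius relation solved for the two boundary values, at the foot [exp(-t/2) X] of the
    characteristic through [X]; [D] is the squared modulus of [2 - s F]. *)
Lemma solution_formula (X t : R) : 0 <= t ->
  let s := 1 - expR (- t) in let u := u0 (k t * X) in let o := o0 (k t * X) in
  let D := (2 - s * u) ^+ 2 + (s * o) ^+ 2 in
  [/\ D != 0, Om X t = 4 * expR (- t) * o / D &
    hilbert (Om ^~ t) X = 2 * expR (- t) * (u * (2 - s * u) - s * o ^+ 2) / D].
Proof.
move=> t0 s u o D; have M := solution_moebius sm cOm pde (k t * X) t0.
have XE : expR (t / 2) * (k t * X) = X by rewrite mulrA -expRD subrr expR0 mul1r.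
rewrite XE in M; have D0 := mden_gt0 M.
have DE : mden (1 - expR (- t)) (u0 (k t * X)) (- o0 (k t * X)) = D.
  by rewrite /mden mulrN sqrrN.
have im := moebius_im M; have re := moebius_re M; rewrite DE in D0 im re.
rewrite sqrrN in re.
have E : expR (- t) * expR t = 1 by rewrite -expRD addNr expR0.
split; first by rewrite gt_eqF.
  apply/(canRL (mulfK _)); first by rewrite gt_eqF.
  have -> : Om X t * D = expR (- t) * (expR t * Om X t * D) by rewrite !mulrA E mul1r.
  have -> : expR t * Om X t * D = 4 * o by move: im; rewrite mulNr mulrN => /oppr_inj.
  by ring.
apply/(canRL (mulfK _)); first by rewrite gt_eqF.
have -> : hilbert (Om ^~ t) X * D = expR (- t) * (expR t * hilbert (Om ^~ t) X * D).
  by rewrite !mulrA E mul1r.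
by rewrite re /s /u /o; ring.
Qed.

Hypothesis od0 : forall X, o0 (- X) = - o0 X.
Hypothesis d0 : derive1 o0 0 = 0.
Hypothesis h0 : u0 0 = 2.
Hypothesis h2 : has_second_deriv u0 0 4.

Lemma hilbert_flat2 : flat2 u0 2 4.
Proof.
have [H hf] := solution_holder sm (lexx 0).
rewrite -h0; apply: even_flat2; last exact: h2.
by move=> x; exact: hilbert_even hf od0.
Qed.

Lemma init_flat2 : flat2 o0 0 0.
Proof. by have [s1 _] := sm (lexx 0); exact: smooth_odd_flat2. Qed.

(** Computing with second-order expansions in the explicit formula reproduces the coefficients [2]
    and [4] at every time. The denominator is harmless, since it equals [4 exp(-2t)] at the
    origin. *)
Lemma hilbert_solution_flat2 (t : R) : 0 <= t -> flat2 (hilbert (Om ^~ t)) 2 4.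
Proof.
move=> t0; pose E := expR (- t); pose s := 1 - E.
have E0 : E != 0 by rewrite gt_eqF ?expR_gt0.
have kE : k t ^+ 2 = E by exact: expR_half_sqr.
pose u X := u0 (k t * X); pose o X := o0 (k t * X).
have fu : flat2 u 2 (4 * E) by rewrite -kE; exact: flat2_scale hilbert_flat2.
have fo : flat2 o 0 0.
  by apply: (flat2_eq (flat2_scale (k t) init_flat2)) => //; rewrite mul0r.
have fp : flat2 (fun X => 2 - s * u X) (2 * E) (- (4 * s * E)).
  apply: (flat2_eq (flat2D (flat2_cst 2) (flat2M (flat2_cst (- s)) fu))).
  - by move=> x; rewrite mulNr.
  - by rewrite /s; ring.
  - by ring.
have fn : flat2 (fun X => u X * (2 - s * u X) - s * o X ^+ 2) (4 * E) (8 * E ^+ 2 - 8 * s * E).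
  apply: (flat2_eq (flat2D (flat2M fu fp) (flat2M (flat2_cst (- s)) (flat2M fo fo)))).
  - by move=> x; rewrite mulNr expr2.
  - by ring.
  - by ring.
have fD : flat2 (fun X => (2 - s * u X) ^+ 2 + (s * o X) ^+ 2) (4 * E ^+ 2) (- (16 * s * E ^+ 2)).
  have so := flat2M (flat2_cst s) fo.
  apply: (flat2_eq (flat2D (flat2M fp fp) (flat2M so so))).
  - by move=> x; rewrite !expr2.
  - by ring.
  - by ring.
have D0 : 4 * E ^+ 2 != 0 by rewrite mulf_neq0 ?expf_neq0 ?pnatr_eq0.
apply: (flat2_eq (flat2M (flat2M (flat2_cst (2 * E)) fn) (flat2V D0 fD))).
- by move=> x; have [_ _ ->] := solution_formula x t0.
- by move: (E) E0 => e e0; field.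
- by rewrite /s; move: (E) E0 => e e0; field.
Qed.

(** Numerators and denominator of the formula have the common size [exp(-2t)], and dividing it out
    leaves limits. The rescaled denominator tends to [4 (1 - X^2)^2], which vanishes exactly at the
    excluded points. *)
Lemma solution_limits (X : R) : X != 1 -> X != -1 ->
  (Om X @ +oo --> 0) /\ (fun t => hilbert (Om ^~ t) X) @ +oo --> 2 / (1 - X ^+ 2).
Proof.
move=> X1 X2; have XN : 1 - X ^+ 2 != 0.
  by rewrite subr_eq0 eq_sym sqrf_eq1 negb_or X1.
pose p t : R := (u0 (k t * X) - 2) / expR (- t).
pose q t : R := (o0 (k t * X) - 0) / expR (- t).
have cp : p @ +oo --> 4 / 2 * X ^+ 2 by exact: flat2_limit hilbert_flat2.
have cq : q @ +oo --> (0 : R).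
  by have := @flat2_limit _ _ _ _ X init_flat2; rewrite !mul0r.
have cE : (fun t : R => expR (- t)) @ +oo --> (0:R) by exact: cvgr_expR.
have cs : (fun t : R => 1 - expR (- t)) @ +oo --> (1:R).
  by rewrite -[X in _ --> X]subr0; apply: cvgB => //; exact: cvg_cst.
have cc (c : R) : (fun _ : R => c) @ +oo --> c by exact: cvg_cst.
(* Since [u0 (k t * X) = 2 + exp(-t) * p t], the real part [2 - s u] equals [exp(-t) * P t]; [D]
   below is likewise the denominator divided by [exp(-2t)]. *)
pose P t : R := 2 - (1 - expR (- t)) * p t.
have cP : P @ +oo --> 2 - 1 * (4 / 2 * X ^+ 2) by apply: cvgB => //; exact: cvgM.
pose D t : R := P t * P t + (1 - expR (- t)) * q t * ((1 - expR (- t)) * q t).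
have csq : (fun t => (1 - expR (- t)) * q t) @ +oo --> 1 * (0:R) by exact: cvgM.
have cD : D @ +oo --> (2 - 1 * (4 / 2 * X ^+ 2)) * (2 - 1 * (4 / 2 * X ^+ 2)) + 1 * 0 * (1 * 0).
  by apply: cvgD; exact: cvgM.
have DE : (2 - 1 * (4 / 2 * X ^+ 2)) * (2 - 1 * (4 / 2 * X ^+ 2)) + 1 * 0 * (1 * 0) = 4 * (1 - X ^+ 2) ^+ 2.
  by field.
rewrite DE in cD.
have DN : 4 * (1 - X ^+ 2) ^+ 2 != 0 by rewrite mulf_neq0 ?expf_neq0 ?pnatr_eq0.
have cDV : (fun t => (D t)^-1) @ +oo --> (4 * (1 - X ^+ 2) ^+ 2)^-1 by exact: cvgV.
have F t : 0 <= t -> Om X t = 4 * q t / D t /\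
    hilbert (Om ^~ t) X = 2 * ((2 + expR (- t) * p t) * P t -
      (1 - expR (- t)) * q t * (q t * expR (- t))) / D t.
  move=> t0; have [] := solution_formula X t0; rewrite /D /P /p /q subr0.
  have := expR_gt0 (- t); move: (u0 _) (o0 _) (expR (- t)) => u o e e0 D0 -> ->.
  have en : e != 0 by rewrite gt_eqF.
  have E2 : 2 - (1 - e) * ((u - 2) / e) = (2 - (1 - e) * u) / e by field.
  have E3 : 2 + e * ((u - 2) / e) = u by field.
  rewrite E2 E3.
  have -> : (2 - (1 - e) * u) / e * ((2 - (1 - e) * u) / e) + (1 - e) * (o / e) * ((1 - e) * (o / e))
    = ((2 - (1 - e) * u) ^+ 2 + ((1 - e) * o) ^+ 2) / e ^+ 2 by field.
  move: ((2 - (1 - e) * u) ^+ 2 + ((1 - e) * o) ^+ 2) D0 => Z Z0.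
  by split; field; rewrite en Z0.
split.
  have c : (fun t => 4 * q t / D t) @ +oo --> 4 * 0 * (4 * (1 - X ^+ 2) ^+ 2)^-1.
    by apply: cvgM => //; exact: cvgM.
  rewrite mulr0 mul0r in c; apply: cvg_trans c; apply: near_eq_cvg; near=> t.
  by have [|-> _] := F t; first by near: t; exact: nbhs_pinfty_ge.
have c : (fun t => 2 * ((2 + expR (- t) * p t) * P t -
      (1 - expR (- t)) * q t * (q t * expR (- t))) / D t) @ +oo -->
   2 * ((2 + 0 * (4 / 2 * X ^+ 2)) * (2 - 1 * (4 / 2 * X ^+ 2)) - 1 * 0 * (0 * 0)) *
     (4 * (1 - X ^+ 2) ^+ 2)^-1.
  apply: cvgM => //; apply: cvgM => //; apply: cvgB.
    by apply: cvgM => //; apply: cvgD => //; exact: cvgM.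
  by apply: cvgM => //; exact: cvgM.
have -> : 2 / (1 - X ^+ 2) = 2 * ((2 + 0 * (4 / 2 * X ^+ 2)) * (2 - 1 * (4 / 2 * X ^+ 2)) - 1 * 0 * (0 * 0)) *
     (4 * (1 - X ^+ 2) ^+ 2)^-1 by field.
apply: cvg_trans c; apply: near_eq_cvg; near=> t.
by have [|_ ->] := F t; first by near: t; exact: nbhs_pinfty_ge.
Unshelve. all: by end_near. Qed.

End Asymptotics.

(** * Dividing an odd function by [y^2] *)

Section CubicVanishing.
Variable R : realType.
Notation mu := (@lebesgue_measure R).
Implicit Type f : R -> R.

Lemma sqrt_modulus_continuous (K : R) f :
  (forall x y, `|f x - f y| <= K * Num.sqrt `|x - y|) -> continuous f.
Proof.
move=> fK x; apply/cvgrPdist_lt => e e0.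
have K1 : 0 < `|K| + 1 by rewrite ltr_wpDl.
have d0 : 0 < (e / (`|K| + 1)) ^+ 2 by rewrite exprn_gt0// divr_gt0.
apply/nbhs_ballP; exists ((e / (`|K| + 1)) ^+ 2) => //= y; rewrite /ball/= => xy.
apply: (le_lt_trans (fK x y)).
have s1 : Num.sqrt `|x - y| < e / (`|K| + 1).
  have -> : e / (`|K| + 1) = Num.sqrt ((e / (`|K| + 1)) ^+ 2).
    by rewrite sqrtr_sqr (@gtr0_norm _ (e / _))// divr_gt0.
  by rewrite ltr_sqrt.
apply: (@le_lt_trans _ _ (`|K| * Num.sqrt `|x - y|)).
  by rewrite ler_wpM2r ?sqrtr_ge0// ler_norm.
apply: (@le_lt_trans _ _ ((`|K| + 1) * Num.sqrt `|x - y|)).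
  by rewrite ler_wpM2r ?sqrtr_ge0// lerDl.
by rewrite mulrC -ltr_pdivlMr.
Qed.

(** The function and its first two derivatives vanish at [0], so a bound on the third derivative is
    integrated up three times. *)
Lemma smooth_odd_cubic f : smooth f -> (forall y, f (- y) = - f y) -> derive1 f 0 = 0 ->
  exists2 C, 0 <= C & forall z, `|z| <= 1 -> `|derive1 f z| <= C * `|z| ^+ 2 /\ `|f z| <= C * `|z| ^+ 3.
Proof.
move=> sf od f'0.
have d1 y : derivable f y 1 by exact: (sf 0%N y).
have d2 y : derivable (derive1 f) y 1 by exact: (sf 1%N y).
have d3 y : derivable (derive1 (derive1 f)) y 1 by exact: (sf 2%N y).
have d4 y : derivable (derive1 (derive1 (derive1 f))) y 1 by exact: (sf 3%N y).
have f''0 : derive1 (derive1 f) 0 = 0.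
  by apply: (is_derive_even0 _ (is_derive_derive1 (d2 0))) => x; exact: derive1_odd.
have c3 : {within `[-1, 1], continuous (derive1 (derive1 (derive1 f)))}.
  by apply: derivable_within_continuous => x _; exact: d4.
have cn : {within `[-1, 1], continuous (fun x => `|derive1 (derive1 (derive1 f)) x|)}.
  by move=> p; apply: cvg_norm; exact: c3.
have [M M0 hM] : exists2 M, 0 <= M & forall x, `|x| <= 1 -> `|derive1 (derive1 (derive1 f)) x| <= M.
  have [c _ hc] := EVT_max (ltW (gtrN (ltr01 : 0 < 1 :> R))) cn.
  exists (`|derive1 (derive1 (derive1 f)) c|); first exact: normr_ge0.
  by move=> x x1; apply: hc; rewrite in_itv/= -ler_norml.
exists M; first exact: M0.
have between (z x : R) : `|z| <= 1 -> Num.min 0 z <= x <= Num.max 0 z -> `|x| <= `|z|.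
  move=> z1; have [y0|y0] := leP 0 z => /andP[h1 h2]; first by rewrite !ger0_norm.
  by rewrite !ler0_norm ?lerN2// ltW.
have b2 z : `|z| <= 1 -> `|derive1 (derive1 f) z| <= M * `|z|.
  move=> z1; have := @deriv_bound R (derive1 (derive1 f)) _ 0 z M
    (fun x _ => is_derive_derive1 (d3 x)) _.
  rewrite f''0 !subr0; apply => x xz.
  by apply: hM; rewrite (le_trans (between _ _ z1 xz)).
have b1 z : `|z| <= 1 -> `|derive1 f z| <= M * `|z| ^+ 2.
  move=> z1; have := @deriv_bound R (derive1 f) _ 0 z (M * `|z|)
    (fun x _ => is_derive_derive1 (d2 x)) _.
  rewrite f'0 !subr0 expr2 mulrA; apply => x xz.
  have xz' := between _ _ z1 xz; apply: (le_trans (b2 x (le_trans xz' z1))).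
  by rewrite ler_wpM2l.
move=> z z1; split; first exact: b1.
have := @deriv_bound R f _ 0 z (M * `|z| ^+ 2) (fun x _ => is_derive_derive1 (d1 x)) _.
have -> : M * `|z| ^+ 3 = M * `|z| ^+ 2 * `|z| by rewrite -mulrA -exprSr.
rewrite (odd_at0 od) !subr0; apply => x xz.
have xz' := between _ _ z1 xz; apply: (le_trans (b1 x (le_trans xz' z1))).
by rewrite ler_wpM2l// lerXn2r ?nnegrE.
Qed.

(** When the points are far apart relative to their distance from [0], each quotient is small by
    itself. Otherwise they have comparable size and the quotient rule applies, the division by [x^2]
    being paid for by the vanishing of [f] and of its derivative. *)
Lemma div_sqr_modulus f (C H : R) : 0 <= C -> 0 <= H -> (forall y, derivable f y 1) ->
  (forall z, `|z| <= 1 -> `|derive1 f z| <= C * `|z| ^+ 2) ->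
  (forall z, `|f z / z ^+ 2| <= C * `|z|) -> (forall z, `|f z / z ^+ 2| <= C) ->
  (forall x y, `|f x - f y| <= H * Num.sqrt `|x - y|) ->
  forall x y, `|f x / x ^+ 2 - f y / y ^+ 2| <= (12 * C + 4 * H) * Num.sqrt `|x - y|.
Proof.
move=> C0 H0 df f'b gb1 gb2 fH.
have gq z : `|f z / z ^+ 2| <= C * Num.sqrt `|z|.
  have [z1|z1] := leP `|z| 1.
    apply: (le_trans (gb1 z)); rewrite ler_wpM2l//.
    rewrite -[leLHS]sqr_sqrtr// expr2 ler_piMl ?sqrtr_ge0//.
    by rewrite -[leRHS]sqrtr1 ler_wsqrtr.
  apply: (le_trans (gb2 z)); rewrite ler_peMr// -[leLHS]sqrtr1 ler_wsqrtr//; exact: ltW.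
move=> x y; wlog xy : x y / `|x| <= `|y|.
  move=> W; have [h|h] := orP (le_total `|x| `|y|); first exact: W.
  by rewrite distrC [`|x - y|]distrC; exact: W.
set s := Num.sqrt `|x - y|; have s0 : 0 <= s by exact: sqrtr_ge0.
have ss : s ^+ 2 = `|x - y| by rewrite sqr_sqrtr.
set q := Num.sqrt `|y|; have q0 : 0 <= q by exact: sqrtr_ge0.
have qq : q ^+ 2 = `|y| by rewrite sqr_sqrtr.
(* In the second case [|x| >= |y| / 2], so [x^2] and [y^2] are comparable and neither is zero. *)
have [far|near] := leP `|y| (2 * `|x - y|).
  have qs : q <= 2 * s.
    rewrite -(@ler_pXn2r _ 2%N) ?nnegrE ?mulr_ge0// qq exprMn ss; apply: (le_trans far).
    by rewrite ler_wpM2r//; lra.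
  have h1 := gq y; have h2 := gq x; rewrite -/q in h1.
  have h3 : Num.sqrt `|x| <= q by rewrite ler_wsqrtr.
  apply: (le_trans (ler_normB _ _)).
  have : C * Num.sqrt `|x| <= C * q by rewrite ler_wpM2l.
  have : C * q <= C * (2 * s) by rewrite ler_wpM2l.
  have : 0 <= H * s by rewrite mulr_ge0.
  have : 0 <= C * s by rewrite mulr_ge0.
  move: h1 h2; move: (`|f x / _|) (`|f y / _|) (C * Num.sqrt `|x|) => a b c; clear; lra.
have y0 : 0 < `|y| by apply: le_lt_trans near; rewrite mulr_ge0.
have q0' : 0 < q by rewrite sqrtr_gt0.
have x2 : `|y| / 2 <= `|x|.
  have := ler_distD x y 0; rewrite !subr0 distrC; move: near; clear; lra.
have x0 : 0 < `|x| by apply: lt_le_trans x2; rewrite divr_gt0.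
have xn : x != 0 by rewrite -normr_gt0.
have yn : y != 0 by rewrite -normr_gt0.
have xx : y ^+ 2 / 4 <= x ^+ 2.
  rewrite -[y ^+ 2]real_normK ?num_real// -[x ^+ 2]real_normK ?num_real//.
  by rewrite (_ : `|y| ^+ 2 / 4 = (`|y| / 2) ^+ 2); [rewrite lerXn2r ?nnegrE ?divr_ge0|field].
have xx0 : 0 < x ^+ 2 by rewrite exprn_even_gt0.
have sq : s <= q.
  rewrite ler_wsqrtr//; move: near y0; clear; lra.
have -> : f x / x ^+ 2 - f y / y ^+ 2 = (f x - f y) / x ^+ 2 + f y / y ^+ 2 * ((y - x) * (y + x)) / x ^+ 2.
  by move: (f x) (f y) => u v; field; rewrite xn yn.
apply: (le_trans (ler_normD _ _)).
have second : `|f y / y ^+ 2 * ((y - x) * (y + x)) / x ^+ 2| <= 8 * (C * s).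
  rewrite normrM normfV (gtr0_norm xx0) ler_pdivrMr// !normrM.
  rewrite -normrM; have gy := gq y; rewrite -/q in gy.
  have yx2 : `|y + x| <= 2 * `|y|.
    by apply: (le_trans (ler_normD _ _)); move: xy; clear; lra.
  apply: (@le_trans _ _ (C * q * (s ^+ 2 * (2 * `|y|)))).
    by apply: ler_pM => //; rewrite ?mulr_ge0// ss distrC ler_wpM2l.
  apply: (@le_trans _ _ (8 * (C * s) * (y ^+ 2 / 4))); last first.
    by rewrite ler_wpM2l// !mulr_ge0.
  rewrite -[y ^+ 2]real_normK ?num_real// -qq.
  have -> : C * q * (s ^+ 2 * (2 * q ^+ 2)) = (2 * C * s * q ^+ 3) * s by ring.
  have -> : 8 * (C * s) * (q ^+ 2 ^+ 2 / 4) = (2 * C * s * q ^+ 3) * q by field.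
  by rewrite ler_wpM2l// !mulr_ge0// exprn_ge0.
have first : `|(f x - f y) / x ^+ 2| <= 4 * (C * s) + 4 * (H * s).
  rewrite normrM normfV (gtr0_norm xx0) ler_pdivrMr//.
  (* Near the origin the derivative bound gains the factor [y^2]; away from it [x^2 >= 1/4], and the
     modulus of [f] alone is enough. *)
  have [y1|y1] := leP `|y| 1; last first.
    apply: (le_trans (fH x y)); rewrite -/s.
    have x4 : 4^-1 <= x ^+ 2.
      apply: le_trans xx; rewrite ler_pdivlMr// mulVf// -[y ^+ 2]real_normK ?num_real//.
      by rewrite exprn_ege1// ltW.
    have h1 : 0 <= H * s by rewrite mulr_ge0.
    have h2 : 0 <= C * s by rewrite mulr_ge0.
    have h3 : 4 * (H * s) * 4^-1 <= 4 * (H * s) * x ^+ 2 by rewrite ler_wpM2l// mulr_ge0.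
    have h4 : 0 <= 4 * (C * s) * x ^+ 2 by apply: mulr_ge0 (ltW xx0); rewrite mulr_ge0.
    by rewrite mulrDl; move: h3 h4; move: (_ * x ^+ 2) (_ * x ^+ 2) => a b; move: (H * s) => c; clear; lra.
  have s1 : s <= 1 by apply: (le_trans sq); rewrite -sqrtr1 ler_wsqrtr.
  have zb z : Num.min y x <= z <= Num.max y x -> `|z| <= `|y|.
    have := ler_norm y; have := ler_norm (- y); rewrite normrN.
    move: xy; rewrite !ler_norml; have [yx|yx] := leP y x.
      by clear; move=> /andP[? ?] ? ? /andP[? ?]; apply/andP; split; lra.
    by clear; move=> /andP[? ?] ? ? /andP[? ?]; apply/andP; split; lra.
  have D : `|f x - f y| <= C * `|y| ^+ 2 * `|x - y|.
    apply: deriv_bound => z zxy; first exact: is_derive_derive1 (df z).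
    have zy := zb z zxy; apply: (le_trans (f'b z (le_trans zy y1))).
    by rewrite ler_wpM2l// lerXn2r ?nnegrE.
  apply: (le_trans D); rewrite real_normK ?num_real// -ss.
  apply: (@le_trans _ _ (4 * (C * s) * (y ^+ 2 / 4))).
    have -> : C * y ^+ 2 * s ^+ 2 = (C * y ^+ 2 * s) * s by ring.
    have -> : 4 * (C * s) * (y ^+ 2 / 4) = (C * y ^+ 2 * s) * 1 by field.
    by apply: ler_wpM2l s1; exact: (mulr_ge0 (mulr_ge0 C0 (sqr_ge0 y)) s0).
  apply: (@le_trans _ _ (4 * (C * s) * x ^+ 2)); first by rewrite ler_wpM2l// !mulr_ge0.
  by rewrite ler_wpM2r ?(ltW xx0)// lerDl !mulr_ge0.
apply: (le_trans (lerD first second)); rewrite le_eqVlt; apply/orP; left; apply/eqP; ring.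
Qed.

End CubicVanishing.

(** * The Hilbert transform of [y^2 f] *)

Section HilbertExpansion.
Variable R : realType.
Notation mu := (@lebesgue_measure R).
Implicit Type f : R -> R.

Lemma hilbert_continuous H f : holder H f -> continuous (hilbert f).
Proof.
move=> hf x; apply/cvgrPdist_le => d d0.
have [cf f2 _] := hf.
have [e e0 he] : exists2 e, 0 < e & H * (Num.sqrt e * vk_mass R) <= d / 3.
  have H0 := holder_ge0 hf; have v0 := vk_mass_ge0 R.
  pose k := H * vk_mass R + 1; have k0 : 0 < k by rewrite ltr_wpDl// mulr_ge0.
  exists ((d / 3 / k) ^+ 2); first by rewrite exprn_gt0// !divr_gt0.
  rewrite sqrtr_sqr ger0_norm; last by rewrite !divr_ge0 ?(ltW d0) ?(ltW k0).
  rewrite mulrCA mulrAC ler_pdivrMr// ler_wpM2l ?divr_ge0 ?(ltW d0)//.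
  by rewrite /k lerDl.
have mQ : measurable_fun setT (Qk e) by apply: continuous_measurable_fun; exact: continuous_Qk.
have cc := @conv_continuous R f (Qk e) cf f2 mQ (itg_Qk2 e0) x.
have /cvgrPdist_le /(_ _ (divr_gt0 d0 (ltr0Sn R 2))) := cc.
apply: filterS => y hy.
have h1 := le_trans (CA_hilbert x hf e0) he; have h2 := le_trans (CA_hilbert y hf e0) he.
rewrite -/(CA f x e) -/(CA f y e) in hy.
move: h1 h2 hy; move: (CA f x e) (CA f y e) (hilbert f x) (hilbert f y) => a b u v.
clear; rewrite !ler_norml => /andP[? ?] /andP[? ?] /andP[? ?]; apply/andP; split; lra.
Qed.

(** With [y = x - s], this combines [y^2 = x^2 - s (x + y)] with [s Qk e s = 1/pi - e Pk e s]:
    multiplication by [y^2] commutes with the Cauchy integral up to two moments and a Poisson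
    average. *)
Lemma CA_mul_sqr H1 H2 f (x e : R) : holder H1 f -> holder H2 (fun y => y ^+ 2 * f y) ->
  itg f -> itg (fun y => y * f y) -> 0 < e ->
  CA (fun y => y ^+ 2 * f y) x e = x ^+ 2 * CA f x e
    - (x * RI f + RI (fun y => y * f y)) / pi
    + e * RI (fun s => (x * f (x - s) + (x - s) * f (x - s)) * Pk e s).
Proof.
move=> hf hF i1 i2 e0; have mf := holder_measurable hf; have [_ f2 _] := hf.
have mF := holder_measurable hF; have [_ F2 _] := hF.
have mQ : measurable_fun setT (Qk e) by apply: continuous_measurable_fun; exact: continuous_Qk.
have mP : measurable_fun setT (Pk e) by apply: continuous_measurable_fun; exact: continuous_Pk.
pose G s := x * f (x - s) + (x - s) * f (x - s).
have iG : itg G.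
  by apply: itgD; [apply: itgZ; exact: itg_shift|exact: (@itg_shift R (fun y => y * f y) x i2)].
have GE : RI G = x * RI f + RI (fun y => y * f y).
  rewrite /G RI_D; last exact: (@itg_shift R (fun y => y * f y) x i2).
    rewrite RI_Z; last exact: itg_shift.
    by rewrite (RI_shift x i1) (@RI_shift R (fun y => y * f y) x i2).
  by apply: itgZ; exact: itg_shift.
have j1 : itg (fun s => (x - s) ^+ 2 * f (x - s) * Qk e s).
  exact: (@itg_conv R (fun y => y ^+ 2 * f y) (Qk e) x mF F2 mQ (itg_Qk2 e0)).
have j2 : itg (fun s => f (x - s) * Qk e s) by exact: itg_conv mf f2 mQ (itg_Qk2 e0).
have j2' := itgZ (x ^+ 2) j2; have j3 := itgZ pi^-1 iG.
have pe (s : R) : e * Pk e s = pi^-1 - s * Qk e s.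
  have := pi_den_gt0 s e0; rewrite /Pk /Qk; have : 0 < (pi : R) by exact: lt_le_trans (pi_ge1 R).
  move: (pi : R) => p p0 d0; field; rewrite !gt_eqF//.
  by move: d0; rewrite pmulr_rgt0.
have E s : (x - s) ^+ 2 * f (x - s) * Qk e s = x ^+ 2 * (f (x - s) * Qk e s)
    - pi^-1 * G s + G s * (e * Pk e s).
  by rewrite pe /G; move: (f _) (Qk e s) (pi^-1) => u q p; ring.
have j4 : itg (fun s => G s * (e * Pk e s)).
  have -> : (fun s => G s * (e * Pk e s)) =
     fun s => (x - s) ^+ 2 * f (x - s) * Qk e s - (x ^+ 2 * (f (x - s) * Qk e s) - pi^-1 * G s).
    by apply/funext => s; rewrite E; move: (pi^-1 * G s) => a; ring.
  by apply: itgB => //; exact: itgB.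
have E4 : RI (fun s => G s * (e * Pk e s)) = e * RI (fun s => G s * Pk e s).
  have j5 : itg (fun s => e^-1 * (G s * (e * Pk e s))) by exact: itgZ.
  have sE : (fun s => G s * Pk e s) = fun s => e^-1 * (G s * (e * Pk e s)).
    by apply/funext => s; move: (G s) (Pk e s) => a b; field; rewrite gt_eqF.
  by rewrite sE (RI_Z _ j4) mulrA divff ?mul1r// gt_eqF.
rewrite {1}/CA.
have -> : (fun s => (x - s) ^+ 2 * f (x - s) * Qk e s) = fun s => (x ^+ 2 * (f (x - s) * Qk e s)
    - pi^-1 * G s) + G s * (e * Pk e s) by apply/funext.
rewrite (RI_D (itgB j2' j3) j4) (RI_B j2' j3) (RI_Z _ j2) (RI_Z _ iG) E4 GE.
by rewrite [pi^-1 * _]mulrC.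
Qed.

(** The Poisson average of a bounded function is bounded, so its factor [e] removes it in the
    limit. *)
Lemma hilbert_mul_sqr H1 H2 f (B x : R) : holder H1 f -> holder H2 (fun y => y ^+ 2 * f y) ->
  itg f -> itg (fun y => y * f y) -> (forall y, `|f y| <= B) -> (forall y, `|y * f y| <= B) ->
  hilbert (fun y => y ^+ 2 * f y) x = x ^+ 2 * hilbert f x
    - (x * RI f + RI (fun y => y * f y)) / pi.
Proof.
move=> hf hF i1 i2 b1 b2; have cF := @CA_cvg _ _ _ x hF; have cf := @CA_cvg _ _ _ x hf.
have mf := holder_measurable hf.
have c1 : (fun e => x ^+ 2 * CA f x e - (x * RI f + RI (fun y => y * f y)) / pi) @ 0^'+ -->
    x ^+ 2 * hilbert f x - (x * RI f + RI (fun y => y * f y)) / pi.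
  by apply: cvgB; [apply: cvgM => //; exact: cvg_cst|exact: cvg_cst].
have c2 : (fun e => CA (fun y => y ^+ 2 * f y) x e) @ 0^'+ -->
    x ^+ 2 * hilbert f x - (x * RI f + RI (fun y => y * f y)) / pi.
  have B0 : 0 <= B by apply: le_trans (b1 0).
  pose K := `|x| * B + B; have K0 : 0 <= K by rewrite addr_ge0// mulr_ge0.
  apply/cvgrPdist_le => d d0; have d2 : 0 < d / 2 by rewrite divr_gt0.
  have K1 : 0 < K + 1 by rewrite ltr_wpDl.
  have /cvgrPdist_le /(_ _ d2) h1 := c1.
  have e1 : \forall e \near (0:R)^'+, e < d / 2 / (K + 1) by apply: nbhs_right_lt; rewrite divr_gt0.
  have e2 : \forall e \near (0:R)^'+, 0 < e by exact: nbhs_right_gt.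
  near=> e; have e0 : 0 < e by near: e.
  have e1' : e < d / 2 / (K + 1) by near: e.
  have : `|x ^+ 2 * hilbert f x - (x * RI f + RI (fun y => y * f y)) / pi -
    (x ^+ 2 * CA f x e - (x * RI f + RI (fun y => y * f y)) / pi)| <= d / 2 by near: e.
  rewrite (CA_mul_sqr x hf hF i1 i2 e0).
  set G := RI (fun s => _ * Pk e s).
  have Gb : `|G| <= K.
    rewrite -[K]mulr1 -(RI_Pk e0) -RI_Z; last exact: itg_Pk.
    apply: RI_norm => [||s].
    - apply: measurable_funM; last by apply: continuous_measurable_fun; exact: continuous_Pk.
      apply: measurable_funD.
        by apply: measurable_funM; [exact: measurable_cst|exact: measurable_shift].
      apply: measurable_funM; last exact: measurable_shift.
      by apply: measurable_funB => //; exact: measurable_cst.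
    - by apply: itgZ; exact: itg_Pk.
    - have P0 : 0 <= Pk e s.
        by rewrite /Pk; apply: divr_ge0; apply: ltW => //; exact: pi_den_gt0.
      rewrite (normrM _ (Pk e s)) (ger0_norm P0) ler_wpM2r//.
      apply: (le_trans (ler_normD _ _)); rewrite /K; apply: lerD; last exact: b2.
      by rewrite normrM ler_wpM2l.
  have eG : `|e * G| <= d / 2.
    rewrite normrM (gtr0_norm e0); apply: (@le_trans _ _ (e * (K + 1))).
      by rewrite ler_wpM2l ?(ltW e0)// (le_trans Gb)// lerDl.
    by rewrite -ler_pdivlMr//; exact: ltW e1'.
  move: eG; move: (e * G) (x ^+ 2 * CA f x e) (x ^+ 2 * hilbert f x) (_ / pi) => g a u v.
  clear; rewrite !ler_norml => /andP[? ?] /andP[? ?]; apply/andP; split; lra.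
by rewrite -(cvg_lim _ cF)// (cvg_lim _ c2).
Unshelve. all: by end_near. Qed.

End HilbertExpansion.

(** * Mass and moments of the density [- f / (pi y)] *)

Section CauchyMass.
Variable R : realType.
Notation mu := (@lebesgue_measure R).
Variables (f : R -> R) (H : R).
Hypothesis hf : holder H f.
Hypothesis od : forall y, f (- y) = - f y.
Hypothesis neg : forall y, 0 < y -> f y < 0.

Definition cauchy_density (y : R) : R := - (f y / (pi * y)).
Notation m := cauchy_density.

Lemma cauchy_density_ge0 y : 0 <= m y.
Proof.
have p0 : 0 < (pi : R) by exact: lt_le_trans (pi_ge1 R).
rewrite /m -mulNr; have [y0|y0|<-] := ltgtP 0 y; last by rewrite mulr0 invr0 mulr0.
  by apply: divr_ge0; [rewrite oppr_ge0 ltW// neg|rewrite mulr_ge0// ltW].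
have ny : 0 < - y by rewrite oppr_gt0.
have -> : - f y / (pi * y) = - f (- y) / (pi * - y) by rewrite od opprK mulrN invrN mulrN mulNr.
by apply: divr_ge0; [rewrite oppr_ge0 ltW// neg|apply: mulr_ge0; exact: ltW].
Qed.

Lemma cauchy_density_even y : m (- y) = m y.
Proof. by rewrite /m od mulrN invrN mulrNN. Qed.

Lemma measurable_cauchy_density : measurable_fun setT m.
Proof.
have mf := holder_measurable hf.
apply: measurable_funN; apply: measurable_funM => //.
apply: measurable_funV; apply: measurable_funM => //; exact: measurable_cst.
Qed.

Lemma CA0_kernel (e s : R) : 0 < e -> f (0 - s) * Qk e s = m s - e ^+ 2 * (m s / (s ^+ 2 + e ^+ 2)).
Proof.
move=> e0; have p0 : 0 < (pi : R) by exact: lt_le_trans (pi_ge1 R).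
rewrite sub0r od /m /Qk; have [->|s0] := eqVneq s 0.
  by rewrite !(mulr0, mul0r, invr0, oppr0, subr0).
have d0 : s ^+ 2 + e ^+ 2 != 0 by rewrite gt_eqF// ltr_wpDl ?sqr_ge0// exprn_gt0.
by move: (f s) (pi : R) p0 => u p p0; field; rewrite s0 d0 gt_eqF.
Qed.

(** At the origin the regularised integrand is the density times [s^2 / (s^2 + e^2)], a factor
    between [0] and [1]. Positivity lets Fatou's lemma yield integrability; the density itself then
    dominates, and the integrals converge. *)
Lemma cauchy_mass : itg m /\ RI m = hilbert f 0.
Proof.
have mf := holder_measurable hf; have [_ f2 _] := hf.
pose e (n : nat) : R := n.+1%:R^-1.
have e0 n : 0 < e n by rewrite invr_gt0.
have e1 n : e n <= 1 by rewrite invf_le1 ?ler1n ?ltr0n.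
pose F n s := f (0 - s) * Qk (e n) s.
have mQ n : measurable_fun setT (Qk (e n)) by apply: continuous_measurable_fun; exact: continuous_Qk.
have iF n : itg (F n) by exact: itg_conv mf f2 (mQ n) (itg_Qk2 (e0 n)).
have FE n s : F n s = m s * (s ^+ 2 / (s ^+ 2 + e n ^+ 2)).
  rewrite /F CA0_kernel//.
  have d0 : s ^+ 2 + e n ^+ 2 != 0 by rewrite gt_eqF// ltr_wpDl ?sqr_ge0// exprn_gt0.
  by move: (m s) (e n) d0 => u d d0; field.
have q01 n (s : R) : 0 <= s ^+ 2 / (s ^+ 2 + e n ^+ 2) <= 1.
  have d0 : 0 < s ^+ 2 + e n ^+ 2 by rewrite ltr_wpDl ?sqr_ge0// exprn_gt0.
  by rewrite divr_ge0 ?sqr_ge0 ?(ltW d0)//= ler_pdivrMr// mul1r lerDl sqr_ge0.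
have F0 n s : 0 <= F n s.
  by rewrite FE; apply: mulr_ge0; [exact: cauchy_density_ge0|have /andP[] := q01 n s].
have ce : e @ \oo --> (0:R) by exact: cvg_harmonic.
have cF s : F ^~ s @ \oo --> m s.
  have -> : F ^~ s = fun n => m s - e n * e n * (m s / (s ^+ 2 + e n * e n)).
    by apply/funext => n; rewrite /F CA0_kernel// expr2.
  have [->|s0] := eqVneq s 0.
    have -> : m 0 = 0 by rewrite /m !(mulr0, invr0, oppr0).
    have -> : (fun n => 0 - e n * e n * (0 / (0 ^+ 2 + e n * e n))) = fun n => 0.
      by apply/funext => n; rewrite mul0r mulr0 subr0.
    exact: cvg_cst.
  have cee : (fun n => e n * e n) @ \oo --> 0 * (0:R) by exact: cvgM.
  rewrite mulr0 in cee.
  have s2 : s ^+ 2 + 0 != 0 by rewrite addr0 sqrf_eq0.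
  have cst_cvg (y : R) : (fun _ : nat => y) @ \oo --> y by exact: cvg_cst.
  have cd : (fun n => s ^+ 2 + e n * e n) @ \oo --> s ^+ 2 + 0 by apply: cvgD.
  have cV : (fun n => (s ^+ 2 + e n * e n)^-1) @ \oo --> (s ^+ 2 + 0)^-1 by exact: cvgV.
  have c : (fun n => m s - e n * e n * (m s / (s ^+ 2 + e n * e n))) @ \oo -->
     m s - 0 * (m s * (s ^+ 2 + 0)^-1).
    by apply: cvgB => //; apply: cvgM => //; exact: cvgM.
  by rewrite mul0r subr0 in c.
have cCA : (fun n => RI (F n)) @ \oo --> hilbert f 0.
  have := CA_cvg (x := 0) hf => /cvg_at_rightP; apply; split => // n; exact: e0.
have bF n : RI (F n) <= `|hilbert f 0| + H * vk_mass R.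
  have := CA_hilbert 0 hf (e0 n); rewrite -/(F n) => h1.
  have h2 : H * (Num.sqrt (e n) * vk_mass R) <= H * vk_mass R.
    rewrite ler_wpM2l ?(holder_ge0 hf)// ler_piMl ?vk_mass_ge0//.
    by rewrite -[leRHS]sqrtr1 ler_wsqrtr.
  have := le_trans h1 h2; rewrite /CA -/(F n); have := ler_norm (hilbert f 0).
  move: (RI _) (hilbert f 0) (H * _) => a b c; clear; rewrite ler_norml => ? /andP[? ?].
  lra.
have [im _] := RI_fatou iF F0 cF bF.
split=> //.
have [_ c] : itg m /\ (fun n => RI (F n)) @ \oo --> RI m.
  apply: (itg_dominated _ cF im) => [n|n s].
    by apply: measurable_funM; [exact: measurable_shift|exact: mQ].
  rewrite ger0_norm// FE; have /andP[_ q1] := q01 n s.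
  by rewrite ler_piMr// cauchy_density_ge0.
by rewrite -(cvg_lim _ c)// (cvg_lim _ cCA).
Qed.

(** By [CA0_kernel], subtracting the regularised integrand from the density leaves exactly [e^2]
    times this weight. *)
Lemma cauchy_moment (e : R) : 0 < e -> itg (fun y => m y / (y ^+ 2 + e ^+ 2)) /\
  RI (fun y => m y / (y ^+ 2 + e ^+ 2)) = (hilbert f 0 - CA f 0 e) / e ^+ 2.
Proof.
move=> e0; have [im mE] := cauchy_mass; have e2 : e ^+ 2 != 0 by rewrite gt_eqF ?exprn_gt0.
have mf := holder_measurable hf; have [_ f2 _] := hf.
have mQ : measurable_fun setT (Qk e) by apply: continuous_measurable_fun; exact: continuous_Qk.
have iF : itg (fun s => f (0 - s) * Qk e s) by exact: itg_conv mf f2 mQ (itg_Qk2 e0).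
have E : (fun y => m y / (y ^+ 2 + e ^+ 2)) = fun y => (e ^+ 2)^-1 * (m y - f (0 - y) * Qk e y).
  apply/funext => y; rewrite CA0_kernel//.
  have d0 : y ^+ 2 + e ^+ 2 != 0 by rewrite gt_eqF// ltr_wpDl ?sqr_ge0// exprn_gt0.
  by move: (m y) => u; field; rewrite d0 gt_eqF.
have iD := itgB im iF.
split; first by rewrite E; exact: itgZ.
by rewrite E (RI_Z _ iD) (RI_B im iF) mE mulrC.
Qed.

End CauchyMass.

Section HilbertTaylor.
Variable R : realType.
Notation mu := (@lebesgue_measure R).

Lemma RI_odd (f : R -> R) : itg f -> (forall y, f (- y) = - f y) -> RI f = 0.
Proof.
move=> i od; have m1 : (-1 : R) != 0 by rewrite oppr_eq0 oner_eq0.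
have := RI_affine 0 m1 i; rewrite normrN1 mul1r.
have -> : (fun s => f (-1 * s + 0)) = fun s => -1 * f s.
  by apply/funext => s; rewrite addr0 !mulN1r od.
by rewrite (RI_Z _ i); move: (RI f) => v; lra.
Qed.

(* [f / y^2] is Hoelder and [hilbert f x = x^2 * hilbert (f / y^2) x + hilbert f 0], so both the second
   derivative along the real axis and the limit along the imaginary axis compute [hilbert (f / y^2) 0]. *)
Lemma CA_second_order (f : R -> R) (H : R) : smooth f -> holder H f ->
  (forall y, f (- y) = - f y) -> derive1 f 0 = 0 -> (forall y, 0 < y -> f y < 0) ->
  hilbert f 0 = 2 -> has_second_deriv (hilbert f) 0 4 ->
  (fun e => (2 - CA f 0 e) / e ^+ 2) @ 0^'+ --> (2 : R).
Proof.
move=> sf hf od f'0 neg h0 h2.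
have p0 : 0 < (pi : R) by exact: lt_le_trans (pi_ge1 R).
have [C1 C10 c1] := smooth_odd_cubic sf od f'0.
have [C2 c2] := holder_bounded hf.
pose C := Num.max C1 C2; have C0 : 0 <= C by rewrite le_max C10.
have f00 := odd_at0 od.
have b2 z : `|f z| <= C by rewrite (le_trans (c2 z))// le_max lexx orbT.
have b1 z : `|z| <= 1 -> `|f z| <= C * `|z| ^+ 3.
  by move=> /c1[_ h]; apply: (le_trans h); rewrite ler_wpM2r// le_max lexx.
pose g z := f z / z ^+ 2.
have gE z : z != 0 -> `|g z| * `|z| ^+ 2 = `|f z|.
  by move=> z0; rewrite -normrX -normrM /g divfK// sqrf_eq0.
have g0 : g 0 = 0 by rewrite /g f00 mul0r.
have gb1 z : `|g z| <= C * `|z|.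
  have [->|z0] := eqVneq z 0; first by rewrite g0 !normr0 mulr0.
  have zp : 0 < `|z| by rewrite normr_gt0.
  rewrite -(@ler_pM2r _ (`|z| ^+ 2)) ?exprn_gt0// gE// -mulrA -exprS.
  have [z1|z1] := leP `|z| 1; first exact: b1.
  apply: (le_trans (b2 z)); rewrite ler_peMr// exprn_ege1// ltW//.
have gb2 z : `|g z| <= C.
  have [z1|z1] := leP `|z| 1.
    by apply: (le_trans (gb1 z)); rewrite ler_piMr.
  have zn : z != 0 by rewrite -normr_gt0 (lt_trans ltr01).
  rewrite -(@ler_pM2r _ (`|z| ^+ 2)) ?exprn_gt0 ?normr_gt0// gE//.
  by apply: (le_trans (b2 z)); rewrite ler_peMr// exprn_ege1// ltW.
have gb3 z : `|z * g z| <= C.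
  have [->|z0] := eqVneq z 0; first by rewrite mul0r normr0.
  have zp : 0 < `|z| by rewrite normr_gt0.
  have [z1|z1] := leP `|z| 1.
    by rewrite normrM mulrC; apply: (le_trans _ (gb2 z)); rewrite ler_piMr.
  rewrite -(@ler_pM2r _ `|z|)// normrM mulrC mulrA -expr2 mulrC gE//.
  by apply: (le_trans (b2 z)); rewrite ler_peMr// ltW.
have gmod := div_sqr_modulus C0 (holder_ge0 hf) (fun y => sf 0%N y)
  (fun z h => le_trans (c1 z h).1 (ler_wpM2r (exprn_ge0 2 (normr_ge0 z)) (_ : C1 <= C))) gb1 gb2.
have {}gmod : forall x y, `|g x - g y| <= (12 * C + 4 * H) * Num.sqrt `|x - y|.
  by apply: gmod => [|x y]; [rewrite le_max lexx|have [_ _ h] := hf; exact: h].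
have cg := sqrt_modulus_continuous gmod.
have mg : measurable_fun setT g by exact: continuous_measurable_fun.
(* The quotient [g] is bounded by [C] everywhere and by [C / z^2] far out; a multiple of the Poisson
   kernel dominates both bounds, which makes [g] integrable. *)
have Pk1 (z : R) : C <= C * 2 * pi * Pk 1 z \/ 1 < `|z| /\ C / z ^+ 2 <= C * 2 * pi * Pk 1 z.
  have PE : C * 2 * pi * Pk 1 z = C * (2 / (z ^+ 2 + 1)).
    rewrite /Pk expr1n; have : z ^+ 2 + 1 != 0 by rewrite gt_eqF// ltr_wpDl ?sqr_ge0.
    by move: (pi : R) p0 => p p0 d0; field; rewrite d0 gt_eqF.
  have d0 : 0 < z ^+ 2 + 1 by rewrite ltr_wpDl ?sqr_ge0.
  rewrite PE; have [z1|z1] := leP `|z| 1.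
    left; rewrite ler_peMr// ler_pdivlMr// mul1r.
    have : z ^+ 2 <= 1 by rewrite -[z ^+ 2]real_normK ?num_real// exprn_ile1.
    lra.
  right; split => //; rewrite ler_wpM2l//.
  have z2 : 1 <= z ^+ 2 by rewrite -[z ^+ 2]real_normK ?num_real// exprn_ege1// ltW.
  have z20 : 0 < z ^+ 2 by exact: lt_le_trans z2.
  by rewrite ler_pdivlMr// mulrC ler_pdivrMr//; lra.
have gP z : `|g z| <= C * 2 * pi * Pk 1 z.
  have [h|[z1 h]] := Pk1 z; first exact: le_trans h.
  apply: le_trans h; have zn : z != 0 by rewrite -normr_gt0 (lt_trans ltr01).
  by rewrite ler_pdivlMr ?exprn_even_gt0// -[z ^+ 2]real_normK ?num_real// gE.
have iP : itg (fun z => C * 2 * pi * Pk 1 z) by apply: itgZ; exact: itg_Pk.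
have ig : itg g by exact: itg_le mg gP iP.
have ig2 : itg (fun z => g z ^+ 2).
  apply: (@itg_le R _ (fun z => C * (C * 2 * pi * Pk 1 z))).
  - by under eq_fun do rewrite expr2; exact: measurable_funM.
  - by move=> z; rewrite normrX expr2; apply: ler_pM.
  - exact: itgZ.
have hg : holder (12 * C + 4 * H) g by split.
have od_g z : g (- z) = - g z by rewrite /g od sqrrN mulNr.
have yyg : (fun y => y ^+ 2 * g y) = f.
  apply/funext => y; have [->|y0] := eqVneq y 0; first by rewrite f00 expr0n mul0r.
  by rewrite /g mulrC divfK// sqrf_eq0.
have [im mE] := cauchy_mass hf od neg.
have ygE : (fun y => y * g y) = fun y => - pi * cauchy_density f y.
  apply/funext => y; rewrite /g /cauchy_density.
  have [->|y0] := eqVneq y 0; first by rewrite !(mul0r, mulr0, invr0, oppr0).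
  by move: (f y) (pi : R) p0 => u p pp; field; rewrite y0 gt_eqF.
have iyg : itg (fun y => y * g y) by rewrite ygE; exact: itgZ.
have Ryg : RI (fun y => y * g y) = - (pi * 2) by rewrite ygE (RI_Z _ im) mE h0 mulNr.
have hF : holder H (fun y => y ^+ 2 * g y) by rewrite yyg.
have Rg := RI_odd ig od_g.
have pn : (pi : R) != 0 by rewrite gt_eqF.
have HE x : hilbert f x = x ^+ 2 * hilbert g x + 2.
  rewrite -{1}yyg (hilbert_mul_sqr x hg hF ig iyg gb2 gb3) Rg Ryg mulr0 add0r mulNr opprK.
  by rewrite [pi * 2]mulrC mulfK.
(* Dividing the expansion [2 + 2 x^2 + o(x^2)] of [hilbert f] by [x^2] gives the limit of
   [hilbert g] at [0], and continuity makes it the value. The point [x] is half of the smaller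
   admissible radius. *)
have hg0 : hilbert g 0 = 2.
  apply/eqP; rewrite -subr_eq0 -normr_le0; apply/ler_addgt0Pl => e e0; rewrite addr0.
  have e2 : 0 < e / 2 by rewrite divr_gt0.
  have hev : forall x, hilbert f (- x) = hilbert f x by move=> x; exact: hilbert_even hf od.
  have [d d0 hd] := flat2_taylor (even_flat2 hev h2) e2.
  have ch : hilbert g @ (0:R) --> hilbert g 0 by exact: (@hilbert_continuous R _ g hg 0).
  have /cvgrPdist_lt /(_ _ e2) /nbhs_ballP[r r0 hr] := ch.
  pose x := Num.min d r / 2.
  have x0 : 0 < x by rewrite divr_gt0// lt_min d0.
  have mn : 0 < Num.min d r by rewrite lt_min d0.
  have xdr : x < Num.min d r by rewrite /x; move: (Num.min d r) mn; clear => a a0; lra.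
  move: xdr; rewrite lt_min => /andP[xd xr].
  have h3 := hd x; rewrite gtr0_norm// h0 HE addrK in h3.
  have {}h3 : `|hilbert g x - 2| <= e / 2.
    have x2 : 0 < x ^+ 2 by rewrite exprn_gt0.
    rewrite -(ler_pM2r x2) -[X in _ * X <= _](gtr0_norm x2) -normrM.
    apply: le_trans (h3 xd); rewrite le_eqVlt; apply/orP; left; apply/eqP; congr `|_|.
    by move: (hilbert g x) => u; field.
  have := hr x; rewrite /ball/= sub0r normrN gtr0_norm// => /(_ xr).
  move: h3; move: (hilbert g x) (hilbert g 0) => a b; clear.
  rewrite ltr_norml !ler_norml => /andP[? ?] /andP[? ?]; apply/andP; split; lra.
have cA := @CA_cvg _ _ _ 0 hg; rewrite hg0 in cA.
apply: cvg_trans cA; apply: near_eq_cvg; near=> e.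
have e0 : 0 < e by near: e; exact: nbhs_right_gt.
have e2 : e ^+ 2 != 0 by rewrite gt_eqF ?exprn_gt0.
(* At [x = 0], since [s Pk e s = e Qk e s], the identity becomes [CA f 0 e = 2 - e^2 * CA g 0 e]. *)
have := CA_mul_sqr 0 hg hF ig iyg e0.
rewrite yyg Ryg expr0n mul0r mul0r !add0r mulNr opprK [pi * 2]mulrC mulfK// => ->.
have -> : (fun s => (0 * g (0 - s) + (0 - s) * g (0 - s)) * Pk e s) =
   fun s => - e * (g (0 - s) * Qk e s).
  apply/funext => s; rewrite mul0r add0r sub0r /Pk /Qk.
  by move: (g _) (pi * _)^-1 => u v; ring.
have mQ : measurable_fun setT (Qk e) by apply: continuous_measurable_fun; exact: continuous_Qk.
rewrite RI_Z; last exact: itg_conv mg ig2 mQ (itg_Qk2 e0).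
rewrite -/(CA g 0 e); move: (CA g 0 e) => a.
by field; rewrite gt_eqF.
Unshelve. all: by end_near. Qed.

End HilbertTaylor.

(** * Concentration at the points [1] and [-1] *)

Section WeakLimit.
Variable R : realType.
Notation mu := (@lebesgue_measure R).

(* The partial fractions [1 + (4/3)/(y^2+1) - (25/3)/(y^2+4)] express the integral of this weight against
   the density through the Cauchy integral at [i] and [2i]. *)
Definition well (y : R) : R := (y ^+ 2 - 1) ^+ 2 / ((y ^+ 2 + 1 ^+ 2) * (y ^+ 2 + 2 ^+ 2)).

Lemma well_ge0 y : 0 <= well y.
Proof. by rewrite /well divr_ge0 ?sqr_ge0// mulr_ge0// addr_ge0 ?sqr_ge0. Qed.

(** The constant [28] is the value of [(z + 1) (z + 4)] at [z = 3], a bound for [z = y^2 <= 3];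
    beyond that point [(z - 1)^2] dominates the denominator. *)
Lemma well_ge (d y : R) : 0 < d -> d <= 1 -> d <= `|y ^+ 2 - 1| -> d ^+ 2 / 28 <= well y.
Proof.
move=> d0 d1 dy; have z0 := sqr_ge0 y.
have h : d ^+ 2 <= (y ^+ 2 - 1) ^+ 2.
  by rewrite -[(_ - 1) ^+ 2]real_normK ?num_real// lerXn2r ?nnegrE// ltW.
have d2 : d ^+ 2 <= 1 by rewrite expr_le1// ltW.
have d20 : 0 < d ^+ 2 by rewrite exprn_gt0.
rewrite /well; move: (y ^+ 2) (d ^+ 2) z0 h d2 d20; clear => z D z0 h d2 d20.
rewrite !expr1n (_ : 2 ^+ 2 = 4 :> R); last by ring.
have p0 : 0 < (z + 1) * (z + 4) by apply: mulr_gt0; lra.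
rewrite ler_pdivlMr// mulrAC ler_pdivrMr//.
have [z3|z3] := leP z 3.
  have p28 : (z + 1) * (z + 4) <= 28 by nra.
  nra.
have pz : (z + 1) * (z + 4) <= 28 * (z - 1) ^+ 2 by rewrite expr2; nra.
nra.
Qed.

(** Evenness reduces to [y >= 0], where [|y^2 - 1| >= |y - 1|]: near [1] continuity is used, and
    away from [1] the weight is bounded below while [g] varies by at most [2 B]. *)
Lemma well_bound (g : R -> R) (B : R) : continuous g -> (forall y, g (- y) = g y) ->
  (forall y, `|g y| <= B) -> forall e, 0 < e -> exists2 C, 0 <= C &
    forall y, `|g y - g 1| <= e + C * well y.
Proof.
move=> cg ev gB e e0; have B0 : 0 <= B by apply: le_trans (gB 0).
have c1 : g @ (1:R) --> g 1 by exact: cg.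
have /cvgrPdist_lt /(_ _ e0) /nbhs_ballP[r r0 hr] := c1.
pose d := Num.min r 1; have d0 : 0 < d by rewrite lt_min r0 ltr01.
have d1 : d <= 1 by rewrite ge_min lexx orbT.
have dr : d <= r by rewrite ge_min lexx.
have p28 : 0 < d ^+ 2 / 28 by rewrite divr_gt0// exprn_gt0.
exists (2 * B / (d ^+ 2 / 28)); first by apply: divr_ge0; [rewrite mulr_ge0|exact: ltW].
have nonneg y : 0 <= y -> `|g y - g 1| <= e + 2 * B / (d ^+ 2 / 28) * well y.
  move=> y0; have w0 := well_ge0 y.
  have K0 : 0 <= 2 * B / (d ^+ 2 / 28) by apply: divr_ge0; [rewrite mulr_ge0|exact: ltW].
  have [yd|yd] := ltP `|y - 1| d.
    apply: (@le_trans _ _ e); last by rewrite lerDl mulr_ge0.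
    rewrite distrC; apply: ltW; apply: hr; rewrite /ball/= distrC; exact: lt_le_trans dr.
  have dw : d <= `|y ^+ 2 - 1|.
    have -> : y ^+ 2 - 1 = (y - 1) * (y + 1) by ring.
    rewrite normrM; apply: (le_trans yd); rewrite ler_peMr// ger0_norm ?addr_ge0//.
    by rewrite lerDr.
  have wd := well_ge d0 d1 dw.
  apply: (@le_trans _ _ (2 * B)).
    apply: (le_trans (ler_normB _ _)); have := gB y; have := gB 1.
    by move: (`|g y|) (`|g 1|) => a b; clear; lra.
  apply: (@le_trans _ _ (2 * B / (d ^+ 2 / 28) * well y)); last by rewrite lerDr ltW.
  by rewrite -mulrA ler_peMr ?mulr_ge0// mulrC ler_pdivlMr// mul1r.
move=> y; have [y0|y0] := leP 0 y; first exact: nonneg.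
have := nonneg (- y); rewrite ev /well sqrrN; apply; rewrite oppr_ge0; exact: ltW.
Qed.

Lemma compact_support_bounded (g : R -> R) (K : R) : continuous g ->
  (forall y, K < `|y| -> g y = 0) -> exists B, forall y, `|g y| <= B.
Proof.
move=> cg gK; pose L := `|K| + 1; have L0 : 0 < L by rewrite ltr_wpDl.
have cn : {within `[- L, L], continuous (fun y => `|g y|)}.
  by apply: continuous_subspaceT => y; apply: cvg_norm; exact: cg.
have [c _ hc] := EVT_max (ltW (gtrN L0)) cn.
exists (`|g c|) => y; have [yL|yL] := leP `|y| L.
  by apply: hc; rewrite in_itv/= -ler_norml.
rewrite gK ?normr0//; apply: lt_trans yL; apply: le_lt_trans (ler_norm K) _.
by rewrite ltrDl.
Qed.

Lemma CB_odd0 (f : R -> R) (H e : R) : holder H f -> (forall y, f (- y) = - f y) -> 0 < e -> CB f 0 e = 0.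
Proof.
move=> hf od e0; have mf := holder_measurable hf; have [_ f2 _] := hf.
have mP : measurable_fun setT (Pk e) by apply: continuous_measurable_fun; exact: continuous_Pk.
rewrite /CB RI_odd ?oppr0//; first exact: (itg_conv 0 mf f2 mP (itg_Pk2 e0)).
by move=> y; rewrite !sub0r PkN opprK od mulNr opprK.
Qed.

Variables (Om : R -> R -> R).
Hypothesis sm : forall t : R, 0 <= t -> smooth (Om ^~ t) /\ H1 (Om ^~ t).
Hypothesis cOm : {within [set p : R * R | 0 <= p.2], continuous (fun p : R * R => Om p.1 p.2)}.
Hypothesis pde : forall X t : R, 0 < t -> derivable (Om X) t 1 /\
  derive1 (Om X) t + 2^-1 * X * derive1 (fun Y => Om Y t) X =
    (-1 + hilbert (fun Y => Om Y t) X) * Om X t.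
Notation u0 := (hilbert (Om ^~ 0)).
Notation o0 := (Om ^~ 0).
Notation k t := (expR (- (t / 2))).
Hypothesis od0 : forall X, o0 (- X) = - o0 X.
Hypothesis neg0 : forall X, 0 < X -> o0 X < 0.
Hypothesis d0 : derive1 o0 0 = 0.
Hypothesis h0 : u0 0 = 2.
Hypothesis h2 : has_second_deriv u0 0 4.

Lemma solution_odd (X t : R) : 0 <= t -> Om (- X) t = - Om X t.
Proof.
move=> t0; have [H hf] := solution_holder sm (lexx 0).
have [_ -> _] := solution_formula sm cOm pde X t0.
have [_ -> _] := solution_formula sm cOm pde (- X) t0.
by rewrite mulrN (hilbert_even _ hf od0) od0 !mulrN sqrrN mulNr.
Qed.

Lemma solution_neg (X t : R) : 0 <= t -> 0 < X -> Om X t < 0.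
Proof.
move=> t0 X0; have [D0 -> _] := solution_formula sm cOm pde X t0.
have Dp : 0 < (2 - (1 - expR (- t)) * u0 (k t * X)) ^+ 2 + ((1 - expR (- t)) * o0 (k t * X)) ^+ 2.
  by rewrite lt_neqAle eq_sym D0 addr_ge0 ?sqr_ge0.
rewrite -mulrA pmulr_rlt0 ?mulr_gt0 ?expR_gt0// pmulr_llt0 ?invr_gt0//.
by apply: neg0; rewrite mulr_gt0 ?expR_gt0.
Qed.

(** On the imaginary axis the Cauchy integral of the odd initial datum is real, and the Moebius
    relation becomes a scalar equation. The condition on [k t * n] is the range of heights in
    [linked]. *)
Lemma solution_CA_formula (n t : R) : 0 < n -> 0 <= t -> k t * n <= 1 ->
  CA (Om ^~ t) 0 n * (2 - (1 - expR (- t)) * CA o0 0 (k t * n)) = 2 * expR (- t) * CA o0 0 (k t * n).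
Proof.
move=> n0 t0 kn; have [H hf] := solution_holder sm (lexx 0); have [Ht hft] := solution_holder sm t0.
have kn0 : 0 < k t * n by rewrite mulr_gt0 ?expR_gt0.
have [M _] := flow_linked (unscaled_holder sm) (unscaled_cvg cOm) (unscaled_bounded cOm)
  (unscaled_evol sm cOm pde) t0 0 (introT andP (conj kn0 kn)).
move: M; rewrite /unscaled (CA_scale _ _ (expR_gt0 _) kn0 hf) (CB_scale _ _ (expR_gt0 _) kn0 hf).
rewrite (CA_scale _ _ (expR_gt0 _) kn0 hft) !mulr0 mul0r oppr0 expR0 !mul1r.
rewrite (CB_odd0 hf od0 kn0) mulr0 addr0.
have -> : expR (t / 2) * (k t * n) = n by rewrite mulrA -expRD subrr expR0 mul1r.
have E : expR (- t) * expR t = 1 by rewrite -expRD addNr expR0.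
move: (CA (Om ^~ t) 0 n) (CA o0 0 _) (expR t) (expR (- t)) E => a a1 p q E M.
have -> : a * (2 - (1 - q) * a1) = q * (p * a * (2 - (1 - q) * a1)) by rewrite -!mulrA (mulrA q) E mul1r.
by rewrite M; ring.
Qed.

(** The limit is [2 / (1 - z^2)] at [z = i n]. As in the real case, numerator and denominator are
    divided by their common size, here with the expansion of the initial Cauchy integral along the
    imaginary axis. *)
Lemma solution_CA_limit (n : R) : 0 < n ->
  (fun t => CA (Om ^~ t) 0 n) @ +oo --> 2 / (1 + n ^+ 2).
Proof.
move=> n0; have [H hf] := solution_holder sm (lexx 0); have [s0 _] := sm (lexx 0).
have c := CA_second_order s0 hf od0 d0 neg0 h0 h2.
have ck : (fun t : R => k t * n) @ +oo --> 0^'+.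
  move=> P [r /= r0 hP]; have rn : 0 < r / n by rewrite divr_gt0.
  have /cvgrPdist_lt /(_ _ rn) := @expR_half_vanish R.
  apply: (@filterS _ +oo) => t; rewrite sub0r normrN gtr0_norm ?expR_gt0// ltr_pdivlMr// => kr.
  have kn : 0 < k t * n by rewrite mulr_gt0 ?expR_gt0.
  by apply: hP => //; rewrite /ball_ /= sub0r normrN gtr0_norm.
pose p t : R := (2 - CA o0 0 (k t * n)) / (k t * n) ^+ 2 * n ^+ 2.
have cp : p @ +oo --> 2 * n ^+ 2.
  apply: cvgM; last exact: cvg_cst.
  exact: (cvg_comp _ _ ck c).
have cE : (fun t : R => expR (- t)) @ +oo --> (0:R) by exact: cvgr_expR.
have cc (a : R) : (fun _ : R => a) @ +oo --> a by exact: cvg_cst.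
(* The denominator [2 - s * CA o0 0 (k t * n)] equals [exp(-t) * D t]. *)
pose D t : R := 2 + (1 - expR (- t)) * p t.
have cD : D @ +oo --> 2 + (1 - 0) * (2 * n ^+ 2).
  by apply: cvgD => //; apply: cvgM => //; exact: cvgB.
have n2 : 0 < n ^+ 2 by rewrite exprn_gt0.
have Dp : 0 < 2 + (1 - 0) * (2 * n ^+ 2) by rewrite subr0 mul1r; lra.
have Dn : 2 + (1 - 0) * (2 * n ^+ 2) != 0 by rewrite gt_eqF.
have pE t : 2 - CA o0 0 (k t * n) = expR (- t) * p t.
  rewrite /p exprMn expR_half_sqr; have := expR_gt0 (- t).
  by move: (CA _ _ _) (expR _) => a e e0; field; rewrite !gt_eqF.
have cQ : (fun t => 2 * (2 - expR (- t) * p t) / D t) @ +oo -->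
    2 * (2 - 0 * (2 * n ^+ 2)) * (2 + (1 - 0) * (2 * n ^+ 2))^-1.
  apply: cvgM; last exact: cvgV.
  by apply: cvgM => //; apply: cvgB => //; exact: cvgM.
have -> : 2 / (1 + n ^+ 2) = 2 * (2 - 0 * (2 * n ^+ 2)) * (2 + (1 - 0) * (2 * n ^+ 2))^-1.
  rewrite mul0r !subr0 mul1r; move: (n ^+ 2) n2 => N N0.
  by field; rewrite !gt_eqF//; lra.
have hk : \forall t \near +oo, k t * n <= 1.
  have n1 : 0 < 1 / n by rewrite divr_gt0.
  have /cvgrPdist_lt /(_ _ n1) := @expR_half_vanish R.
  apply: (@filterS _ +oo) => t; rewrite sub0r normrN gtr0_norm ?expR_gt0// ltr_pdivlMr//.
  exact: ltW.
have hD : \forall t \near +oo, 0 < D t.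
  move/cvgrPdist_lt : cD => /(_ _ Dp); apply: (@filterS _ +oo) => t.
  by move: (D t) (2 + _) => u v; rewrite ltr_norml => /andP[]; lra.
apply: cvg_trans cQ; apply: near_eq_cvg; near=> t.
have t0 : 0 <= t by near: t; exact: nbhs_pinfty_ge.
have kn : k t * n <= 1 by near: t.
have DD : 0 < D t by near: t.
have := solution_CA_formula n0 t0 kn; have := pE t.
have e0 := expR_gt0 (- t); move: DD; rewrite /D.
move: (CA (Om ^~ t) 0 n) (CA _ _ _) (expR (- t)) (p t) e0 => a a1 e q e0 DD E F.
have a1E : a1 = 2 - e * q by rewrite -E; ring.
rewrite -a1E; apply/(canLR (mulfK _)); first by rewrite gt_eqF.
apply: (mulfI (_ : e != 0)); first by rewrite gt_eqF.
transitivity (2 * e * a1); first by ring.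
by rewrite -F a1E; ring.
Unshelve. all: by end_near. Qed.

Notation m t := (cauchy_density (Om ^~ t)).

(** The mass is the Hilbert transform at the origin, which keeps its initial value. *)
Lemma solution_mass (t : R) : 0 <= t -> itg (m t) /\ RI (m t) = 2.
Proof.
move=> t0; have [H hf] := solution_holder sm t0.
have [im ->] := cauchy_mass hf (fun X => solution_odd X t0) (fun X => solution_neg t0).
by split => //; have [] := hilbert_solution_flat2 sm cOm pde od0 d0 h0 h2 t0.
Qed.

Lemma solution_well (t : R) : 0 <= t -> itg (fun y => m t y * well y) /\
  RI (fun y => m t y * well y) =
    2 + 4 / 3 * (2 - CA (Om ^~ t) 0 1) - 25 / 12 * (2 - CA (Om ^~ t) 0 2).
Proof.
move=> t0; have [H hf] := solution_holder sm t0.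
have [im mE] := solution_mass t0.
have [_ mh] := cauchy_mass hf (fun X => solution_odd X t0) (fun X => solution_neg t0).
have [i1 e1] := cauchy_moment hf (fun X => solution_odd X t0) (fun X => solution_neg t0) ltr01.
have [i2 e2] := cauchy_moment hf (fun X => solution_odd X t0) (fun X => solution_neg t0) (ltr0Sn R 1).
have E : (fun y => m t y * well y) = fun y => (m t y + 4 / 3 * (m t y / (y ^+ 2 + 1 ^+ 2)))
    - 25 / 3 * (m t y / (y ^+ 2 + 2 ^+ 2)).
  apply/funext => y; rewrite /well; have := sqr_ge0 y; move: (y ^+ 2) (m t y) => z u z0.
  by field; rewrite !gt_eqF//; lra.
have j1 := itgZ (4 / 3) i1; have j2 := itgZ (25 / 3) i2; have j := itgD im j1.
rewrite E; split; first exact: itgB.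
rewrite (RI_B j j2) (RI_D im j1) (RI_Z _ i1) (RI_Z _ i2) mE e1 e2 -mh mE.
by move: (CA _ _ _) (CA _ _ _) => a b; field.
Qed.

(** The limiting Cauchy integrals at [i] and [2 i] are [1] and [2/5], and [2 + 4/3 - 10/3 = 0]:
    asymptotically no mass remains away from the zeros of the weight. *)
Lemma solution_well_limit : (fun t => RI (fun y => m t y * well y)) @ +oo --> (0 : R).
Proof.
have cc (a : R) : (fun _ : R => a) @ +oo --> a by exact: cvg_cst.
have c : (fun t => 2 + 4 / 3 * (2 - CA (Om ^~ t) 0 1) - 25 / 12 * (2 - CA (Om ^~ t) 0 2)) @ +oo -->
   (2 + 4 / 3 * (2 - 2 / (1 + 1 ^+ 2)) - 25 / 12 * (2 - 2 / (1 + 2 ^+ 2)) : R).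
  apply: cvgB.
    by apply: cvgD => //; apply: cvgM => //; apply: cvgB => //; exact: solution_CA_limit.
  by apply: cvgM => //; apply: cvgB => //; exact: solution_CA_limit.
have z : 2 + 4 / 3 * (2 - 2 / (1 + 1 ^+ 2)) - 25 / 12 * (2 - 2 / (1 + 2 ^+ 2)) = 0 :> R by field.
rewrite z in c; apply: cvg_trans c; apply: near_eq_cvg; near=> t.
by have [|_ ->] := @solution_well t; first by near: t; exact: nbhs_pinfty_ge.
Unshelve. all: by end_near. Qed.

(** [Om * phi] is [- pi] times the density times [y * phi y], of which the even density sees only
    the even part [chi]. The total mass [2] concentrates where [y^2 = 1], so the integral against
    [chi] tends to [2 * chi 1]. *)
Lemma solution_weak_limit (phi : R -> R) : continuous phi ->
  (exists K : R, forall X, K < `|X| -> phi X = 0) ->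
  (fun t => RI (fun X => Om X t * phi X)) @ +oo --> - pi * (phi 1 - phi (-1)).
Proof.
move=> cphi [K hK].
have p0 : 0 < (pi : R) by exact: lt_le_trans (pi_ge1 R).
pose psi y := y * phi y.
have cpsi : continuous psi by move=> y; apply: cvgM; [exact: cvg_id|exact: cphi].
have [B hB] : exists B, forall y, `|psi y| <= B.
  by apply: (compact_support_bounded (K := K) cpsi) => y /hK; rewrite /psi => ->; rewrite mulr0.
have mpsi : measurable_fun setT psi by exact: continuous_measurable_fun.
pose chi y := (psi y + psi (- y)) / 2.
have cchi : continuous chi.
  move=> y; apply: cvgM; last exact: cvg_cst.
  apply: cvgD; first exact: cpsi.
  apply: (cvg_comp (fun y : R => - y) psi); last exact: cpsi.
  by apply: cvgN; exact: cvg_id.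
have echi y : chi (- y) = chi y by rewrite /chi opprK addrC.
have bchi y : `|chi y| <= B.
  rewrite /chi normrM (@ger0_norm _ 2^-1)// ler_pdivrMr//; apply: (le_trans (ler_normD _ _)).
  by have := hB y; have := hB (- y); move: (`|psi y|) (`|psi (- y)|) => a b; lra.
have chi1 : chi 1 = (phi 1 - phi (-1)) / 2 by rewrite /chi /psi mul1r mulN1r.
have B0 : 0 <= B by apply: le_trans (hB 0).
have main t : 0 <= t -> itg (fun y => m t y * chi y) /\
    RI (fun X => Om X t * phi X) = - pi * RI (fun y => m t y * chi y).
  move=> t0; have [im _] := solution_mass t0; have [H hf] := solution_holder sm t0.
  have mm := measurable_cauchy_density hf.
  have m0 := cauchy_density_ge0 (fun X => solution_odd X t0) (fun X => solution_neg t0).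
  have em := cauchy_density_even (fun X => solution_odd X t0).
  have bnd (g : R -> R) : measurable_fun setT g -> (forall y, `|g y| <= B) -> itg (fun y => m t y * g y).
    move=> mg gB; apply: (@itg_le R _ (fun y => B * m t y)).
    - exact: measurable_funM.
    - move=> y /=; rewrite (normrM (m t y)) (ger0_norm (m0 y)) mulrC.
      by apply: ler_wpM2r => //; exact: gB.
    - exact: itgZ.
  have i1 := bnd psi mpsi hB.
  have i2 : itg (fun y => m t y * psi (- y)).
    apply: bnd => [|y]; last exact: hB.
    apply: continuous_measurable_fun => y.
    apply: (cvg_comp (fun y : R => - y) psi); last exact: cpsi.
    by apply: cvgN; exact: cvg_id.
  have ichi : itg (fun y => m t y * chi y).
    by apply: bnd => //; exact: continuous_measurable_fun.
  split=> //.
  have -> : (fun X => Om X t * phi X) = fun y => - pi * (m t y * psi y).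
    apply/funext => y; rewrite /cauchy_density /psi.
    have [->|y0] := eqVneq y 0.
      by rewrite (odd_at0 (fun X => solution_odd X t0)) !(mul0r, mulr0, oppr0).
    by move: (Om y t) (phi y) (pi : R) p0 => u v p pp; field; rewrite y0 gt_eqF.
  rewrite (RI_Z _ i1); congr (_ * _).
  have m1 : (-1 : R) != 0 by rewrite oppr_eq0 oner_eq0.
  have flip : RI (fun y => m t y * psi y) = RI (fun y => m t y * psi (- y)).
    rewrite (RI_affine 0 m1 i1) normrN1 mul1r; congr Rintegral; apply/funext => y.
    by rewrite addr0 mulN1r em.
  have -> : (fun y => m t y * chi y) = fun y => 2^-1 * (m t y * psi y + m t y * psi (- y)).
    by apply/funext => y; rewrite /chi; move: (m t y) (psi y) (psi (- y)) => a b c; field.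
  rewrite (RI_Z _ (itgD i1 i2)) (RI_D i1 i2) -flip.
  by move: (RI _) => v; field.
have c : (fun t => RI (fun y => m t y * chi y)) @ +oo --> 2 * chi 1.
  apply/cvgrPdist_le => e e0; have e4 : 0 < e / 4 by rewrite divr_gt0.
  (* The error is at most [e / 4] on a total mass of [2], plus [C] times the integral of the weight,
     which is eventually at most [e / 2]. *)
  have [C C0 hC] := well_bound cchi echi bchi e4.
  have C1 : 0 < C + 1 by rewrite ltr_wpDl.
  have eC : 0 < e / 2 / (C + 1) by rewrite !divr_gt0.
  have /cvgrPdist_le /(_ _ eC) cw := solution_well_limit.
  near=> t.
  have t0 : 0 <= t by near: t; exact: nbhs_pinfty_ge.
  have [im mE] := solution_mass t0; have [iw _] := solution_well t0.
  have [ichi _] := main t t0; have [H hf] := solution_holder sm t0.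
  have m0 := cauchy_density_ge0 (fun X => solution_odd X t0) (fun X => solution_neg t0).
  have j := itgZ (chi 1) im.
  have -> : 2 * chi 1 - RI (fun y => m t y * chi y) = - RI (fun y => m t y * chi y - chi 1 * m t y).
    by rewrite (RI_B ichi j) (RI_Z _ im) mE; move: (RI _) => v; ring.
  rewrite normrN.
  have h1 : `|RI (fun y => m t y * chi y - chi 1 * m t y)| <= RI (fun y => e / 4 * m t y + C * (m t y * well y)).
    apply: RI_norm => [||y].
    - by have := itgB ichi j; exact: itg_measurable.
    - by apply: itgD; exact: itgZ.
    - rewrite [chi 1 * _]mulrC -mulrBr (normrM (m t y)) (ger0_norm (m0 y)).
      apply: (le_trans (ler_wpM2l (m0 y) (hC y))); rewrite le_eqVlt; apply/orP; left; apply/eqP => /=.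
      by move: (m t y) (well y) => u v; ring.
  apply: (le_trans h1); rewrite (RI_D (itgZ _ im) (itgZ _ iw)) (RI_Z _ im) (RI_Z _ iw) mE.
  have : `|0 - RI (fun y => m t y * well y)| <= e / 2 / (C + 1) by near: t; exact: cw.
  rewrite sub0r normrN => h2'; have := le_trans (ler_norm _) h2'.
  move: (RI _) => v hv.
  have h3 : C * v <= C * (e / 2 / (C + 1)) by rewrite ler_wpM2l.
  have h4 : C * (e / 2 / (C + 1)) <= e / 2.
    by rewrite mulrCA ler_piMr ?divr_ge0 ?(ltW e0)// ler_pdivrMr// mul1r lerDl.
  by move: h3 h4; move: (C * v) (C * _) => a b; lra.
have -> : - pi * (phi 1 - phi (-1)) = - pi * (2 * chi 1) by rewrite chi1; field.
have cpi : (fun t => - pi * RI (fun y => m t y * chi y)) @ +oo --> - pi * (2 * chi 1).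
  by apply: cvgM => //; exact: cvg_cst.
apply: cvg_trans cpi; apply: near_eq_cvg; near=> t.
by have [|_ ->] := main t; first by near: t; exact: nbhs_pinfty_ge.
Unshelve. all: by end_near. Qed.

End WeakLimit.

Theorem mainTheorem2 (R : realType) (Om0 : R -> R) (Om : R -> R -> R) :
  smooth Om0 -> H1 Om0 ->
  (forall X, Om0 (- X) = - Om0 X) ->
  derive1 Om0 0 = 0 ->
  (forall X, 0 < X -> Om0 X < 0) ->
  (exists M : R, \forall X \near 0^', `|X * derive1 Om0 X / Om0 X| <= M) ->
  hilbert Om0 0 = 2 ->
  has_second_deriv (hilbert Om0) 0 4 ->
  gCLM_solution Om Om0 ->
  (forall tau, 0 <= tau ->
     hilbert (fun X => Om X tau) 0 = 2 /\
     has_second_deriv (hilbert (fun X => Om X tau)) 0 4) /\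
  (forall X, X != 1 -> X != -1 ->
     (Om X @ +oo --> 0) /\
     ((fun tau => hilbert (fun Y => Om Y tau) X) @ +oo --> 2 / (1 - X ^+ 2))) /\
  (forall phi : R -> R, smooth phi ->
     (exists K : R, forall X, K < `|X| -> phi X = 0) ->
     (fun tau => Rintegral (@lebesgue_measure R) setT (fun X => Om X tau * phi X))
       @ +oo --> - pi * (phi 1 - phi (-1))).
Proof.
move=> _ _ od0 d0 neg0 _ h0 h2 [e0 [sm [cOm [_ pde]]]].
have E : Om0 = Om ^~ 0 by apply/funext => X; rewrite e0.
move: od0 d0 neg0 h0 h2; rewrite E => od0 d0 neg0 h0 h2; split; [|split].
- move=> t t0; have F := hilbert_solution_flat2 sm cOm pde od0 d0 h0 h2 t0.
  by split; [have [] := F|exact: flat2_second F].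
- by move=> X X1 X2; exact: (solution_limits sm cOm pde od0 d0 h0 h2).
- move=> phi sphi hphi; apply: (solution_weak_limit sm cOm pde od0 neg0 d0 h0 h2) => // X.
  by apply/differentiable_continuous/derivable1_diffP; exact: (sphi 0%N X).
Qed.
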